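(* Consider the inhomogeneous free discrete bi-Schrödinger equation on $\mathbb{Z}$, $$i(\partial_tu)(t,n)-(\Delta^2u)(t,n)+F(t,n)=0,$$ with initial value $\{u(0,n)\}_{n\in\mathbb{Z}}\in\ell^2(\mathbb{Z})$. Then: (i) For all pairs $$(q,r),(\tilde q,\tilde r)\in\Big\{(x,y)\neq(2,\infty):\ \tfrac1x+\tfrac1{4y}\le\tfrac18,\ x,y\ge2\Big\}$$ there is a constant $C$ such that $$\|\{u(t,n)\}\|_{L^q_t\ell^r}\le C\Big(\|\{u(0,n)\}\|_{\ell^2}+\|\{F(t,n)\}\|_{L^{\tilde q'}_t\ell^{\tilde r'}}\Big),$$ where $\tilde q',\tilde r'$ are the dual exponents of $\tilde q,\tilde r$. (ii) The decay estimate $\|e^{-it\Delta^2}\|_{\ell^1\to\ell^\infty}\lesssim|t|^{-1/4}$ ($t\ne0$) is sharp, in the sense that $\frac14$ is the supremum of all $\alpha$ for which there exists a constant $C_\alpha$ such that $$\|e^{-it\Delta^2}\phi\|_{\ell^\infty}\le C_\alpha|t|^{-\alpha}\|\phi\|_{\ell^1}\qquad\text{for all }t\ne0\text{ and all }\phi\in\ell^1(\mathbb{Z}).$$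
   Context: $(\Delta\phi)(n)=\phi(n+1)+\phi(n-1)-2\phi(n)$ is the discrete Laplacian on $\ell^2(\mathbb{Z})$ and $\Delta^2$ is its square. The mixed norm is $$\|\{u(t,n)\}\|_{L^{q}_t\ell^{r}}=\left(\int_{0}^{\infty}\Big(\sum_{n\in\mathbb{Z}}|u(t,n)|^{r}\Big)^{\frac{q}{r}}dt\right)^{\frac{1}{q}},$$ with the usual modifications when an exponent is $\infty$. *)

(* Defs.v *)
From HB Require Import structures.
From mathcomp Require Import all_boot all_order all_algebra.
From mathcomp Require Import complex.
From mathcomp Require Import all_classical all_reals all_analysis.

Set Implicit Arguments.
Unset Strict Implicit.
Unset Printing Implicit Defensive.

Import Order.TTheory GRing.Theory Num.Theory.
Import numFieldNormedType.Exports.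
Import ComplexField.Normc.

Local Open Scope classical_set_scope.
Local Open Scope ring_scope.
Local Open Scope complex_scope.

HB.instance Definition _ := isPointed.Build int 0%R.

HB.instance Definition _ := @isMeasurable.Build default_measure_display
  int discrete_measurable discrete_measurable0
  discrete_measurableC discrete_measurableU.

Section DiscreteBiSchrodinger.
Context {R : realType}.
Implicit Types (phi : int -> R[i]) (u F : R -> int -> R[i]) (p q r : \bar R).

Definition dlaplacian phi : int -> R[i] :=
  fun n => phi (n + 1) + phi (n - 1) - 2 * phi n.

Definition dbilaplacian phi : int -> R[i] := dlaplacian (dlaplacian phi).

Definition lnorm p phi : \bar R :=
  Lnorm counting p (fun n => (normc (phi n))%:E).

Definition halfline : set R := `[0, +oo[.

Definition halfline_lebesgue : {measure set (measurableTypeR R) -> \bar R} :=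
  mrestr lebesgue_measure (@measurable_itv R `[0, +oo[).

Definition mixed_norm q r u : \bar R :=
  Lnorm halfline_lebesgue q (fun t => lnorm r (u t)).

(* Exponents range over the extended reals, with +oo^-1 = 0. *)
Definition strichartz_pairs : set (\bar R * \bar R) :=
  [set xy | [/\ xy <> (2%:E, +oo),
     xy.1^-1 + (4%:E * xy.2)^-1 <= (8^-1)%:E, 2%:E <= xy.1 & 2%:E <= xy.2]%E].

Definition abs_continuous (a b : R) (f : R -> R[i]) : Prop :=
  forall e : R, 0 < e -> exists2 d : R, 0 < d &
    forall (k : nat) (x y : 'I_k -> R),
      (forall j, [/\ a <= x j, x j <= y j & y j <= b]) ->
      (forall j l : 'I_k, (j < l)%N -> y j <= x l) ->
      \sum_(j < k) (y j - x j) < d ->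
      \sum_(j < k) normc (f (y j) - f (x j)) < e.

(* R[i] carries no normed-module structure over R, hence the componentwise
   derivative with respect to the real variable. *)
Definition cderivable (f : R -> R[i]) (t : R) : Prop :=
  derivable (fun s => complex.Re (f s)) t 1 /\
  derivable (fun s => complex.Im (f s)) t 1.

Definition cderive (f : R -> R[i]) (t : R) : R[i] :=
  derive1 (fun s => complex.Re (f s)) t +i*
  derive1 (fun s => complex.Im (f s)) t.

Definition measurable_forcing F : Prop := forall n,
  measurable_fun halfline (fun t => complex.Re (F t n)) /\
  measurable_fun halfline (fun t => complex.Im (F t n)).

(* Solutions on [0, +oo[ of class C([0, +oo[; l^2). As F is only measurable in
   time, the equation is required at almost every time, and each coordinate of u
   has to be locally absolutely continuous. *)
Record bi_schrodinger_solution F u : Prop := {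
  solution_l2 : forall t : R, 0 <= t -> (lnorm 2%:E (u t) < +oo)%E ;
  solution_continuous : forall t : R, 0 <= t ->
    lnorm 2%:E (fun n => u s n - u t n)
      @[s --> within halfline (nbhs t)] --> 0%E ;
  solution_abs_continuous : forall n (T : R),
    0 <= T -> abs_continuous 0 T (fun t => u t n) ;
  solution_equation : {ae lebesgue_measure, forall t : R, 0 < t -> forall n,
    cderivable (fun s => u s n) t /\
    'i%C * cderive (fun s => u s n) t - dbilaplacian (u t) n + F t n = 0}
}.

Definition cseries_sum (a : nat -> R[i]) : R[i] :=
  limn (series (fun k => complex.Re (a k))) +i*
  limn (series (fun k => complex.Im (a k))).

(* e^{-it Delta^2}, by the exponential series of the bounded operator
   -it Delta^2, summed coordinatewise. *)
Definition bi_propagator (t : R) phi : int -> R[i] := fun n =>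
  cseries_sum (fun k =>
    (- 'i%C * t%:C) ^+ k / (k`!)%:R * iter k dbilaplacian phi n).

Definition decay_rates : set R :=
  [set alpha | exists C : R, forall t : R, t != 0 -> forall phi,
     (lnorm 1%:E phi < +oo)%E ->
     (lnorm +oo (bi_propagator t phi)
        <= (C * `|t| `^ (- alpha))%:E * lnorm 1%:E phi)%E].

End DiscreteBiSchrodinger.

Arguments strichartz_pairs : clear implicits.
Arguments decay_rates : clear implicits.

(* Main.v *)
(* The propagator exp(-i t Delta^2) is convolution with the oscillatory integral
   K_t(m) = (1/pi) int_0^pi cos(m x) exp(-4 i t (1 - cos x)^2) dx, and van der
   Corput's second derivative test, applied away from the two points 0 and 2pi/3
   where the second derivative of the phase vanishes, gives |K_t(m)| <= C |t|^(-1/4).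

   All admissible pairs have q >= 8, and the whole range follows from a bound in
   L^oo l^2 and one in L^8 l^oo by interpolation at each time.  Both are obtained
   by duality: the solution u is paired with a solution k of the adjoint equation
   that jumps at near-extremal sample points (t_j, m_j), t_j in [j, j + 1].
   Positive definiteness of K is the TT* argument, controlling k in l^2 by a
   discrete Hardy-Littlewood-Sobolev sum with weight (1 + |j - l|)^(-1/4).  The
   forcing is cut at a level depending on t into a part in L^1 l^2 and a part in
   L^(8/7) l^1, which reduces every dual pair to these two.  As u need not be
   summable against k globally, the pairing is localised by a tent of width N,
   whose commutator with Delta^2 is O(1/N).

   For the sharpness, the test function psi(m) = (N^2 - m^2)^2 on |m| <= N moves
   little up to times of order N^4: by positivity, Re <psi, exp(-i t Delta^2) psi>
   >= sum psi^2 - t <psi, Delta^2 psi>, and Delta^2 psi <= 24 on the support.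
   Comparing with the decay estimate at such a time forces alpha <= 1/4. *)

Require Import Defs.
From HB Require Import structures.
From mathcomp Require Import all_boot all_order all_algebra.
From mathcomp Require Import complex.
From mathcomp Require Import all_classical all_reals all_analysis measurable_realfun ess_sup_inf.
From mathcomp Require Import ring lra zify.

Set Implicit Arguments.
Unset Strict Implicit.
Unset Printing Implicit Defensive.

Import Order.TTheory GRing.Theory Num.Theory.
Import numFieldNormedType.Exports.
Import ComplexField.Normc.

Local Open Scope classical_set_scope.
Local Open Scope ring_scope.
Local Open Scope complex_scope.

(** * Van der Corput's estimate and the symbol *)

Section VanDerCorput.
Context {R : realType}.
Implicit Types (a b x lam : R) (f df : R -> R).

(** On the lattice the kernel stays bounded at small times, so time can be cut into unit windows
    without loss. An l^8 bound on the suprema over the windows is stronger than one in L^8 l^oo, and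
    the nesting of sequence spaces then fills the region of exponents beyond its boundary line.
    Working with samples also avoids any question of measurability in time for the norms of u. A
    retarded estimate usually needs an extra argument to remove the time ordering. Here the adjoint
    solution used before the i-th sample contains only the samples j >= i, and it is estimated by
    absolute values, so the ordering costs nothing. Sequences in l^(8/7) are written as seventh
    powers of sequences in l^8, which keeps the powers integral; the balance of exponents is 7/8 +
    7/8 + 1/4 = 2. Each coordinate of u is only locally absolutely continuous and solves its
    equation almost everywhere, so the fundamental theorem of calculus enters as an inequality,
    proved by a gauge argument. Bounds in l^2 are handled as bounds on all finite partial sums. *)

Lemma derive_ge0_le f df a b : a <= b ->
  (forall x, a <= x <= b -> is_derive x 1 f (df x)) ->
  (forall x, a <= x <= b -> 0 <= df x) -> f a <= f b.
Proof.
move=> ab fdf df0.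
have [c cab E] : exists2 c, c \in `[a, b]%R & f b - f a = df c * (b - a).
  apply: MVT_segment => // [x xab|].
    by apply: fdf; rewrite !(itvP xab).
  apply: derivable_within_continuous => x xab.
  have xab' : a <= x <= b by rewrite !(itvP xab).
  by have [] := fdf x xab'.
by rewrite -subr_ge0 E mulr_ge0 ?subr_ge0// df0// !(itvP cab).
Qed.

Lemma derC (c : R) x : is_derive x 1 (fun=> c) 0.
Proof. exact: is_derive_cst. Qed.

Lemma derD (f g : R -> R) x a b : is_derive x 1 f a -> is_derive x 1 g b ->
  is_derive x 1 (fun y => f y + g y) (a + b).
Proof. exact: is_deriveD. Qed.

Lemma derB (f g : R -> R) x a b : is_derive x 1 f a -> is_derive x 1 g b ->
  is_derive x 1 (fun y => f y - g y) (a - b).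
Proof. exact: is_deriveB. Qed.

Lemma derN (f : R -> R) x a : is_derive x 1 f a ->
  is_derive x 1 (fun y => - f y) (- a).
Proof. exact: is_deriveN. Qed.

Lemma derM (f g : R -> R) x a b : is_derive x 1 f a -> is_derive x 1 g b ->
  is_derive x 1 (fun y => f y * g y) (a * g x + f x * b).
Proof.
move=> hf hg; apply: is_derive_eq (is_deriveM hf hg) _.
by rewrite /GRing.scale /=; ring.
Qed.

Lemma derMl (c : R) (f : R -> R) x a : is_derive x 1 f a ->
  is_derive x 1 (fun y => c * f y) (c * a).
Proof.
by move=> hf; apply: is_derive_eq (derM (is_derive_cst c x 1) hf) _; rewrite mul0r add0r.
Qed.

Lemma derX2 (f : R -> R) x a : is_derive x 1 f a ->
  is_derive x 1 (fun y => f y ^+ 2) (2 * f x * a).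
Proof.
move=> hf; rewrite (_ : (fun y => f y ^+ 2) = (fun y => f y * f y)).
  by apply: is_derive_eq (derM hf hf) _; ring.
by apply/funext => y; rewrite expr2.
Qed.

Lemma derV (f : R -> R) x a : f x != 0 -> is_derive x 1 f a ->
  is_derive x 1 (fun y => (f y)^-1) (- a / f x ^+ 2).
Proof.
move=> f0 hf; apply: (is_derive_eq (@is_deriveV _ f x a 1 f0 hf)).
by rewrite /GRing.scale /=; ring.
Qed.

Lemma dercos (f : R -> R) x a : is_derive x 1 f a ->
  is_derive x 1 (fun y => cos (f y)) (- sin (f x) * a).
Proof. by move=> hf; exact: (is_derive1_comp (is_derive_cos (f x)) hf). Qed.

Lemma dersin (f : R -> R) x a : is_derive x 1 f a ->
  is_derive x 1 (fun y => sin (f y)) (cos (f x) * a).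
Proof. by move=> hf; exact: (is_derive1_comp (is_derive_sin (f x)) hf). Qed.

Lemma deratan (f : R -> R) x a : is_derive x 1 f a ->
  is_derive x 1 (fun y => atan (f y)) ((1 + f x ^+ 2)^-1 * a).
Proof. by move=> hf; exact: (is_derive1_comp (is_derive1_atan (f x)) hf). Qed.

(* Integration by parts against P1 / (lam + P1 ^ 2) instead of 1 / P1: this
   multiplier has no singularity where the phase is stationary. *)
Lemma van_der_corput2 (I P P1 P2 : R -> R) a b lam : a <= b -> 0 < lam ->
  (forall x, a <= x <= b -> is_derive x 1 I (cos (P x))) ->
  (forall x, a <= x <= b -> is_derive x 1 P (P1 x)) ->
  (forall x, a <= x <= b -> is_derive x 1 P1 (P2 x)) ->
  (forall x, a <= x <= b -> lam <= P2 x) ->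
  I b - I a <= 10 / Num.sqrt lam.
Proof.
move=> ab lam0 dI dP dP1 P2lam.
set e := Num.sqrt lam; have e0 : 0 < e by rewrite sqrtr_gt0.
have e2 : e ^+ 2 = lam by rewrite sqr_sqrtr// ltW.
have q0 x : 0 < lam + P1 x ^+ 2 by rewrite ltr_wpDr// sqr_ge0.
pose A x := P1 x / (lam + P1 x ^+ 2) * sin (P x).
(* The derivative of [B] is 2 P2 / (lam + P1 ^ 2). One half of it absorbs the sine term in the
   derivative of [A]; the other half, since P2 >= lam, absorbs lam cos P / (lam + P1 ^ 2), the part
   of cos P that the integration by parts does not reproduce. *)
pose B x := 2 / e * atan (P1 x / e).
have lE x : e * (1 + (P1 x / e) ^+ 2) = (lam + P1 x ^+ 2) / e.
  by rewrite -e2; field; rewrite gt_eqF.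
have H : A a + B a - I a <= A b + B b - I b.
  apply: (@derive_ge0_le (fun x => A x + B x - I x)
    (fun x => (P2 x * (lam - P1 x ^+ 2) / (lam + P1 x ^+ 2) ^+ 2 * sin (P x)
       + P1 x ^+ 2 / (lam + P1 x ^+ 2) * cos (P x))
       + 2 * P2 x / (lam + P1 x ^+ 2) - cos (P x))) => // x xab.
    have hI := dI x xab; have hP := dP x xab; have hP1 := dP1 x xab.
    have hq := derD (derC lam x) (derX2 hP1).
    have hv := @derV (fun y => lam + P1 y ^+ 2) _ _ (lt0r_neq0 (q0 x)) hq.
    have ha := deratan (derM hP1 (derC e^-1 x)).
    apply: is_derive_eq (derB (derD (derM (derM hP1 hv) (dersin hP))
      (derMl (2 / e) ha)) hI) _.
    rewrite /= -/(P1 x / e).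
    have -> : (1 + (P1 x / e) ^+ 2)^-1 = e ^+ 2 / (lam + P1 x ^+ 2).
      by rewrite -e2; field; rewrite e2 !gt_eqF// expr2.
    by field; rewrite !gt_eqF.
  set p := P1 x; set q := P2 x; set s := sin _; set c := cos _.
  have lq : lam <= q by exact: P2lam.
  have hs : `|s| <= 1 by exact: sin_max.
  have hc : `|c| <= 1 by exact: cos_max.
  have Q0 := q0 x; rewrite -/p in Q0.
  have -> : q * (lam - p ^+ 2) / (lam + p ^+ 2) ^+ 2 * s +
      p ^+ 2 / (lam + p ^+ 2) * c + 2 * q / (lam + p ^+ 2) - c =
      (q * (1 + (lam - p ^+ 2) / (lam + p ^+ 2) * s) +
       (q - lam * c)) / (lam + p ^+ 2).
    by field; rewrite gt_eqF.
  apply: divr_ge0; last exact: ltW.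
  have q00 : 0 < q by apply: lt_le_trans lq.
  apply: addr_ge0.
    apply: mulr_ge0; first exact: ltW.
    have : `|(lam - p ^+ 2) / (lam + p ^+ 2) * s| <= 1.
      rewrite normrM -[leRHS]mulr1 ler_pM// normrM normfV (gtr0_norm Q0).
      rewrite ler_pdivrMr// mul1r ler_norml; have := sqr_ge0 p; lra.
    by rewrite ler_norml; lra.
  rewrite subr_ge0; apply: le_trans lq; rewrite -[leRHS]mulr1 ler_pM2l//.
  by move: hc; rewrite ler_norml; lra.
have Ab x : `|A x| <= (2 * e)^-1.
  rewrite /A normrM -[leRHS]mulr1 ler_pM ?sin_max// normrM normfV.
  rewrite (gtr0_norm (q0 x)) ler_pdivrMr// mulrC ler_pdivlMr ?mulr_gt0//.
  rewrite -e2 -(real_normK (num_real (P1 x))).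
  by have := sqr_ge0 (e - `|P1 x|); nra.
have pi4 : (pi : R) <= 4.
  by have := @pihalf_lt2 R; rewrite ltr_pdivrMr// => /ltW; rewrite -natrM.
have Bb x : `|B x| <= 4 / e.
  rewrite /B normrM gtr0_norm ?divr_gt0//.
  have : `|atan (P1 x / e)| <= 2.
    have := atan_gtNpi2 (P1 x / e); have := atan_ltpi2 (P1 x / e).
    have := @pihalf_lt2 R; rewrite ler_norml; lra.
  move=> h; rewrite (_ : 4 / e = 2 / e * 2); last by ring.
  by rewrite ler_pM2l// divr_gt0.
have eE : 10 / e = 2 * (2 * e)^-1 + 2 * (4 / e) + e^-1.
  by field; rewrite gt_eqF.
have ei : 0 < e^-1 by rewrite invr_gt0.
move: (Ab a) (Ab b) (Bb a) (Bb b); rewrite !ler_norml eE; lra.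
Qed.

End VanDerCorput.

(** * The phase of the kernel and its oscillatory integral *)

Section Phase.
Context {R : realType}.
Implicit Types (x y t s : R).

(** The Fourier multiplier of the squared Laplacian: the square of 2 cos x - 2. *)
Definition symb x : R := 4 * (1 - cos x) ^+ 2.

Definition phase (m t c x : R) : R := m * x + t * symb x + c.

Definition phase1 (m t x : R) : R := m + t * (8 * (1 - cos x) * sin x).

(** On [0, pi] the zero at 0 is double and the zero at 2pi/3 is simple. The double zero is what
    limits the decay to the exponent 1/4. *)
Definition phase2 (t x : R) : R := t * (8 * (1 - cos x) * (1 + 2 * cos x)).

Lemma is_derive_symb x : is_derive x 1 symb (8 * (1 - cos x) * sin x).
Proof.
apply: is_derive_eq (derMl 4 (derX2 (derB (derC 1 x) (is_derive_cos x)))) _.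
by rewrite /=; ring.
Qed.

Lemma is_derive_phase (m t c x : R) :
  is_derive x 1 (phase m t c) (phase1 m t x).
Proof.
apply: is_derive_eq (derD (derD (derMl m (is_derive_id x 1))
  (derMl t (is_derive_symb x))) (derC c x)) _.
by rewrite /phase1 /=; ring.
Qed.

Lemma is_derive_phase1 (m t x : R) :
  is_derive x 1 (phase1 m t) (phase2 t x).
Proof.
apply: is_derive_eq (derD (derC m x) (derMl t (derM (derMl 8
  (derB (derC 1 x) (is_derive_cos x))) (is_derive_sin x)))) _.
rewrite /phase2 /=.
transitivity (t * (8 * (sin x ^+ 2 + (1 - cos x) * cos x))); first by ring.
by rewrite sin2cos2; ring.
Qed.

(** The next four bounds form a chain: each one is the previous one integrated from 0, starting from
    cos <= 1. *)
Lemma sin_le x : 0 <= x -> sin x <= x.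
Proof.
move=> x0; rewrite -subr_ge0 -[leLHS](subrr 0) -{2}(@sin0 R).
apply: (@derive_ge0_le _ (fun x => x - sin x) (fun x => 1 - cos x)) => //.
Qed.

Lemma cos_ge x : 0 <= x -> 1 - x ^+ 2 / 2 <= cos x.
Proof.
move=> x0; rewrite -subr_ge0.
have -> : 0 = cos 0 - (1 - 0 ^+ 2 / 2) :> R by rewrite cos0; ring.
apply: (@derive_ge0_le _ (fun x => cos x - (1 - x ^+ 2 / 2))
  (fun x => x - sin x)) => //.
  move=> y _; apply: is_derive_eq (derB (is_derive_cos y) (derB (derC 1 y)
    (derM (derX2 (is_derive_id y 1)) (derC 2^-1 y)))) _.
  by rewrite /=; field.
by move=> y /andP[y0 _]; rewrite subr_ge0 sin_le.
Qed.

Lemma half_le_sin x : 0 <= x <= 1 -> x / 2 <= sin x.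
Proof.
move=> /andP[x0 x1]; rewrite -subr_ge0.
have -> : 0 = sin 0 - 0 / 2 :> R by rewrite sin0; ring.
apply: (@derive_ge0_le _ (fun x => sin x - x / 2)
  (fun x => cos x - 1 / 2)) => //.
  move=> y _; apply: is_derive_eq (derB (is_derive_sin y)
    (derM (is_derive_id y 1) (derC 2^-1 y))) _.
  by rewrite /=; ring.
by move=> y /andP[y0 yx]; have := cos_ge y0; nra.
Qed.

Lemma cos_le x : 0 <= x <= 1 -> cos x <= 1 - x ^+ 2 / 4.
Proof.
move=> /andP[x0 x1]; rewrite -subr_ge0.
have -> : 0 = (1 - 0 ^+ 2 / 4) - cos 0 :> R by rewrite cos0; ring.
apply: (@derive_ge0_le _ (fun x => (1 - x ^+ 2 / 4) - cos x)
  (fun x => sin x - x / 2)) => //.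
  move=> y _; apply: is_derive_eq (derB (derB (derC 1 y)
    (derM (derX2 (is_derive_id y 1)) (derC 4^-1 y))) (is_derive_cos y)) _.
  by rewrite /=; field.
by move=> y /andP[y0 yx]; rewrite subr_ge0 half_le_sin// y0 (le_trans yx).
Qed.

Lemma cos_le_mono x y : 0 <= x -> x <= y -> y <= pi -> cos y <= cos x.
Proof.
move=> x0 xy yp; move: xy; rewrite le_eqVlt => /predU1P[->//|xy].
by apply/ltW; rewrite ltr_cos// in_itv/= ?x0 ?yp ?(le_trans x0 (ltW xy))//
  (le_trans (ltW xy)).
Qed.

(** Two intervals of length at most 1 / s around the degenerate points are estimated by their
    length. On the three others the second derivative of the phase is at least s ^ 2 in absolute
    value, and each costs 10 / s: in all 1 + 10 + 10 + 1 + 10 = 32. A one-sided bound is enough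
    because adding pi to [c] reverses the sign of the integrand. *)
Lemma oscillatory_bound (I : R -> R) (m s c : R) : 1 <= s ->
  (forall x, 0 <= x <= pi -> is_derive x 1 I (cos (phase m (s ^+ 4) c x))) ->
  I pi - I 0 <= 32 / s.
Proof.
move=> s1 dI; have s0 : 0 < s by apply: lt_le_trans s1.
have si1 : s^-1 <= 1 by rewrite invf_le1.
have si0 : 0 < s^-1 by rewrite invr_gt0.
have pi2 := @pihalf_ge1 R; have pih : pi / 2 <= (pi : R) by have := @pi_gt0 R; lra.
have sub a b : 0 <= a -> a <= b -> b <= pi ->
    forall x, a <= x <= b -> 0 <= x <= pi.
  move=> a0 _ bp x /andP[ax xb].
  by rewrite (le_trans a0 ax) (le_trans xb bp).
have triv a b : 0 <= a -> a <= b -> b <= pi -> I b - I a <= b - a.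
  move=> a0 ab bp; suff : a - I a <= b - I b by lra.
  apply: (@derive_ge0_le _ (fun x => x - I x)
    (fun x => 1 - cos (phase m (s ^+ 4) c x))) => // x xab.
  by apply: derB => //; apply: dI; apply: sub xab.
have vdc a b : 0 <= a -> a <= b -> b <= pi ->
    (forall x, a <= x <= b -> s ^+ 2 <= phase2 (s ^+ 4) x) ->
    I b - I a <= 10 / s.
  move=> a0 ab bp h; rewrite -[s in leRHS]gtr0_norm// -sqrtr_sqr.
  apply: (@van_der_corput2 _ I (phase m (s ^+ 4) c) (phase1 m (s ^+ 4))
    (phase2 (s ^+ 4))) => //.
  - by rewrite exprn_gt0.
  - by move=> x xab; apply: dI; apply: sub xab.
  - by move=> x _; exact: is_derive_phase.
  - by move=> x _; exact: is_derive_phase1.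
have vdcN a b : 0 <= a -> a <= b -> b <= pi ->
    (forall x, a <= x <= b -> s ^+ 2 <= - phase2 (s ^+ 4) x) ->
    I b - I a <= 10 / s.
  move=> a0 ab bp h; rewrite -[s in leRHS]gtr0_norm// -sqrtr_sqr.
  apply: (@van_der_corput2 _ I (fun x => - phase m (s ^+ 4) c x)
    (fun x => - phase1 m (s ^+ 4) x) (fun x => - phase2 (s ^+ 4) x)) => //.
  - by rewrite exprn_gt0.
  - by move=> x xab; rewrite cosN; apply: dI; apply: sub xab.
  - by move=> x _; apply: derN; exact: is_derive_phase.
  - by move=> x _; apply: derN; exact: is_derive_phase1.
have d4 : 0 < (4 * s)^-1 by rewrite invr_gt0 mulr_gt0.
have e1 : (-1 : R) <= - 2^-1 + (4 * s)^-1 <= 1.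
  by rewrite invfM; lra.
have e2 : (-1 : R) <= - 2^-1 - (4 * s)^-1 <= 1.
  by rewrite invfM; lra.
(* The interval around 2pi/3, where the cosine is -1/2, is cut out by values of the cosine, so that
   |1 + 2 cos x| >= 1 / (2 s) outside it is immediate. *)
set x1 := acos (- 2^-1 + (4 * s)^-1) : R.
set x2 := acos (- 2^-1 - (4 * s)^-1) : R.
have c1 : cos x1 = - 2^-1 + (4 * s)^-1 by rewrite acosK// in_itv.
have c2 : cos x2 = - 2^-1 - (4 * s)^-1 by rewrite acosK// in_itv.
have x10 : 0 <= x1 by exact: acos_ge0.
have x20 : 0 <= x2 by exact: acos_ge0.
have x1p : x1 <= pi by exact: acos_lepi.
have x2p : x2 <= pi by exact: acos_lepi.
have c12 : cos x2 < cos x1.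
  by rewrite c1 c2; lra.
have x12 : x1 <= x2 by rewrite leNgt; apply/negP => /ltW/cos_le_mono => /(_ x20 x1p); lra.
have hx1 : pi / 2 <= x1.
  rewrite leNgt; apply/negP => /ltW /(cos_le_mono x10) /(_ pih).
  by rewrite cos_pihalf c1 invfM; lra.
have b1 : I s^-1 - I 0 <= s^-1.
  by rewrite -[leRHS]subr0; apply: triv => //; [exact: ltW|lra].
have b2 : I (pi / 2) - I s^-1 <= 10 / s.
  apply: vdc; rewrite ?(ltW si0)//; first by lra.
  move=> x /andP[sx xp].
  have x0 : 0 <= x by lra.
  have k1 : cos x <= 1 - s^-1 ^+ 2 / 4.
    apply: le_trans (cos_le_mono _ sx _) (cos_le _); rewrite ?(ltW si0)//; lra.
  have k2 : 0 <= cos x by apply: cos_ge0_pihalf; rewrite xp andbT; lra.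
  rewrite /phase2.
  have -> : s ^+ 2 = s ^+ 4 * (8 * (s^-1 ^+ 2 / 8)).
    by field; rewrite gt_eqF.
  rewrite ler_pM2l ?exprn_gt0// -mulrA ler_pM2l//.
  by have := sqr_ge0 s^-1; nra.
(* On [pi/2, pi] the factor 1 - cos x is at least 1, so the bound on |1 + 2 cos x| alone gives
   |phase2| >= 4 s ^ 3 >= s ^ 2. *)
have s3 : s ^+ 2 <= s ^+ 4 * (8 * (2 * (4 * s)^-1)).
  have -> : s ^+ 4 * (8 * (2 * (4 * s)^-1)) = s ^+ 2 * (4 * s).
    by field; rewrite gt_eqF.
  by rewrite -[leLHS]mulr1 ler_pM2l ?exprn_gt0//; lra.
have b3 : I x1 - I (pi / 2) <= 10 / s.
  apply: vdc => //; first by lra.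
  move=> x /andP[px xx1]; apply: le_trans s3 _.
  rewrite /phase2 ler_pM2l ?exprn_gt0// -[8 * _ * _]mulrA ler_pM2l//.
  have k1 : cos x <= 0 by rewrite -(@cos_pihalf R); apply: cos_le_mono => //; lra.
  have k2 : cos x1 <= cos x by apply: cos_le_mono => //; lra.
  by rewrite c1 in k2; move: d4 k1 k2; nra.
(* Between [x1] and [x2] the cosine lies in [-3/4, -1/4], hence sin >= 1/2; as the cosine drops only
   by 1 / (2 s), the length is at most 1 / s. *)
have b4 : I x2 - I x1 <= s^-1.
  apply: le_trans (triv _ _ _ _ _) _ => //.
  suff : - cos x1 - x1 / 2 <= - cos x2 - x2 / 2.
    by rewrite c1 c2 invfM; lra.
  apply: (@derive_ge0_le _ (fun x => - cos x - x / 2)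
    (fun x => sin x - 2^-1)) => //.
    move=> x _; apply: is_derive_eq (derB (derN (is_derive_cos x))
      (derM (is_derive_id x 1) (derC 2^-1 x))) _.
    by rewrite /=; ring.
  move=> x /andP[hx1' hx2'].
  have k1 : cos x <= cos x1 by apply: cos_le_mono => //; exact: le_trans x2p.
  have k2 : cos x2 <= cos x by apply: cos_le_mono => //; exact: le_trans hx1'.
  have k3 : 0 <= sin x.
    by apply: sin_ge0_pi; rewrite (le_trans x10 hx1') (le_trans hx2' x2p).
  have := cos2Dsin2 x; rewrite c1 in k1; rewrite c2 in k2.
  by move: k1 k2; rewrite invfM; nra.
have b5 : I pi - I x2 <= 10 / s.
  apply: vdcN => // x /andP[px xx1]; apply: le_trans s3 _.
  rewrite /phase2 -mulrN ler_pM2l ?exprn_gt0// -[8 * _ * _]mulrA -mulrN ler_pM2l//.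
  have k2 : cos x <= cos x2 by apply: cos_le_mono => //; lra.
  by rewrite c2 in k2; move: d4 k2; nra.
by lra.
Qed.

End Phase.

(** * The convolution kernel *)

Section Average.
Context {R : realType}.
Notation mu := (@lebesgue_measure R).
Implicit Types (f g F : R -> R) (x : R).

Definition avg f : R := pi^-1 * \int[mu]_(x in `[0, pi]) f x.

Let int_cont f (a b : R) : continuous f ->
  mu.-integrable `[a, b] (EFin \o f).
Proof.
move=> cf; apply: continuous_compact_integrable; first exact: segment_compact.
exact: continuous_subspaceT.
Qed.

Lemma eq_avg f g : (forall x, f x = g x) -> avg f = avg g.
Proof. by move=> fg; congr (avg _); apply/funext. Qed.

Lemma avgD f g : continuous f -> continuous g ->
  avg (fun x => f x + g x) = avg f + avg g.
Proof.
move=> cf cg; rewrite /avg RintegralD; [exact: mulrDr|by []|exact: int_cont..]. Qed.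

Lemma avgZ (k : R) f : continuous f -> avg (fun x => k * f x) = k * avg f.
Proof. move=> cf; rewrite /avg RintegralZl; [exact: mulrCA|by []|exact: int_cont]. Qed.

Lemma avgN f : continuous f -> avg (fun x => - f x) = - avg f.
Proof.
move=> cf; rewrite -mulN1r -avgZ//; apply: eq_avg => x; by rewrite mulN1r.
Qed.

Lemma avg0 : avg (fun=> 0) = 0.
Proof. by rewrite -{2}(mul0r (avg (fun=> 0))) -avgZ ?mul0r//; exact: cst_continuous. Qed.

Lemma avg_cst (k : R) : avg (fun=> k) = k.
Proof.
rewrite /avg Rintegral_cst//= lebesgue_measure_itv/= lte_fin pi_gt0/= subr0.
by rewrite mulrCA mulVf ?mulr1// gt_eqF// pi_gt0.
Qed.

Lemma continuous_sum (I : Type) (r : seq I) (f : I -> R -> R) :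
  (forall i, continuous (f i)) -> continuous (fun x => \sum_(i <- r) f i x).
Proof.
move=> cf; elim: r => [|i r IH].
  by rewrite (_ : (fun x => _) = fun=> 0);
    [exact: cst_continuous|apply/funext => x; rewrite big_nil].
rewrite (_ : (fun x => _) = fun x => f i x + \sum_(j <- r) f j x).
  by move=> x; apply: continuousD; [exact: cf|exact: IH].
by apply/funext => x; rewrite big_cons.
Qed.

Lemma avg_sum (I : Type) (r : seq I) (f : I -> R -> R) :
  (forall i, continuous (f i)) ->
  avg (fun x => \sum_(i <- r) f i x) = \sum_(i <- r) avg (f i).
Proof.
move=> cf; elim: r => [|i r IH].
  by rewrite big_nil -[RHS]avg0; apply: eq_avg => x; rewrite big_nil.
rewrite big_cons -IH -avgD//; last exact: continuous_sum.
by apply: eq_avg => x; rewrite big_cons.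
Qed.

Lemma le_avg f g : continuous f -> continuous g -> (forall x, f x <= g x) ->
  avg f <= avg g.
Proof.
move=> cf cg fg; rewrite /avg ler_pM2l ?invr_gt0 ?pi_gt0//.
by apply: le_Rintegral => //; exact: int_cont.
Qed.

Lemma avg_ge0 f : (forall x, 0 <= f x) -> 0 <= avg f.
Proof.
by move=> f0; rewrite /avg mulr_ge0 ?invr_ge0 ?pi_ge0// Rintegral_ge0.
Qed.

Lemma normr_avg f (M : R) : continuous f -> (forall x, `|f x| <= M) ->
  `|avg f| <= M.
Proof.
move=> cf fM; have cc (k : R) : continuous (fun _ : R => k) by move=> x; exact: cst_continuous.
rewrite ler_norml; apply/andP; split.
  rewrite -(avg_cst (- M)); apply: le_avg => // x.
  by have := fM x; rewrite ler_norml => /andP[].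
rewrite -[leRHS](avg_cst M); apply: le_avg => // x.
by have := fM x; rewrite ler_norml => /andP[].
Qed.

Lemma antiderivative f : continuous f -> exists F,
  (forall x, 0 <= x <= pi -> is_derive x 1 F (f x)) /\
  avg f = pi^-1 * (F pi - F 0).
Proof.
(* Integrating from -1 makes 0 an interior point, so the derivative there is two-sided. *)
move=> cf; exists (fun x => \int[mu]_(t in `[-1, x]) f t); split.
  move=> x /andP[x0 xpi].
  have xx1 : x < x + 1 by rewrite ltrDl.
  have mx : -1 < x by rewrite (lt_le_trans _ x0)// oppr_lt0.
  have [df <-] := @continuous_FTC1_closed _ f (-1) x (x + 1) xx1
    (@int_cont f _ _ cf) mx (cf x).
  by rewrite derive1E; apply: DeriveDef.
rewrite /avg; congr (_ * _).
rewrite (@Rintegral_itvB _ _ (BLeft (-1)) (BRight pi) 0)//.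
- by rewrite Rintegral_itv_obnd_cbnd//; apply: integrableS (@int_cont f _ _ cf) => //;
    apply: subset_itvr; rewrite bnd_simp.
- exact: int_cont.
- by rewrite bnd_simp lerN10.
- by rewrite bnd_simp pi_ge0.
Qed.

Lemma avg_FTC f F : continuous f -> (forall x, is_derive x 1 F (f x)) ->
  avg f = pi^-1 * (F pi - F 0).
Proof.
move=> cf dF; have [G [dG ->]] := antiderivative cf; congr (_ * _).
have H (A B : R -> R) : (forall x, 0 <= x <= pi -> is_derive x 1 A (f x)) ->
    (forall x, 0 <= x <= pi -> is_derive x 1 B (f x)) -> A pi - A 0 <= B pi - B 0.
  move=> dA dB; suff : B 0 - A 0 <= B pi - A pi by lra.
  apply: (@derive_ge0_le _ (fun x => B x - A x) (fun x => f x - f x)).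
  - exact: pi_ge0.
  - by move=> x x0; apply: derB; [exact: dB|exact: dA].
  - by move=> x _; rewrite subrr.
by apply/eqP; rewrite eq_le !H.
Qed.

End Average.

Section AverageOfDerivative.
Context {R : realType}.

Lemma is_derive_avg (f df : R -> R -> R) (t M : R) :
  (forall t : R, continuous (f t)) ->
  (forall (t x : R), is_derive t 1 (f ^~ x) (df t x)) ->
  (forall t x : R, `|df t x| <= M) ->
  is_derive t 1 (fun t => avg (f t)) (avg (df t)).
Proof.
move=> cf dfE dfM.
have intf s : (@lebesgue_measure R).-integrable `[0, pi] (EFin \o f s).
  apply: continuous_compact_integrable; first exact: segment_compact.
  exact: continuous_subspaceT.
have dE s x : partial1of2 f s x = df s x.
  by rewrite partial1of2E; exact: (@derive_val _ _ _ _ _ _ _ (dfE s x)).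
have Mge : 0 <= M by apply: le_trans (dfM 0 0).
have intM : (@lebesgue_measure R).-integrable `[0, pi] (EFin \o (fun=> M)).
  apply: continuous_compact_integrable; first exact: segment_compact.
  by apply: continuous_subspaceT => x; exact: cst_continuous.
have tI : `]t - 1, t + 1[%classic t by rewrite /= in_itv/=; apply/andP; split; lra.
have mp : measurable (`[0, pi]%classic : set (measurableTypeR R)) by [].
have d1 := @derivable_under_integral R _ _ lebesgue_measure f `[0, pi]%classic
  mp t (t - 1) (t + 1) tI (fun s _ => intf s)
  (fun s x _ _ => @ex_derive _ _ _ _ _ _ _ (dfE s x)) (fun=> M) (fun=> Mge)
  intM _.
have d2 := @differentiation_under_integral R _ _ lebesgue_measure f `[0, pi]%classic
  mp t (t - 1) (t + 1) tI (fun s _ => intf s)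
  (fun s x _ _ => @ex_derive _ _ _ _ _ _ _ (dfE s x)) (fun=> M) (fun=> Mge)
  intM _.
have h : is_derive t 1 (fun s => \int[lebesgue_measure]_(x in `[0, pi]) f s x)
    (\int[lebesgue_measure]_(x in `[0, pi]) df t x).
  apply: DeriveDef; first by apply: d1 => s x _ _; rewrite dE.
  rewrite -derive1E d2; last by move=> s x _ _; rewrite dE.
  by apply: eq_Rintegral => x _; exact: dE.
exact: derMl.
Qed.

End AverageOfDerivative.

Section ComplexParts.
Context {R : realType}.
Implicit Types (z w : R[i]).

Lemma Re_add z w : complex.Re (z + w) = complex.Re z + complex.Re w.
Proof. by case: z; case: w. Qed.

Lemma Im_add z w : complex.Im (z + w) = complex.Im z + complex.Im w.
Proof. by case: z; case: w. Qed.

Lemma Re_opp z : complex.Re (- z) = - complex.Re z.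
Proof. by case: z. Qed.

Lemma Im_opp z : complex.Im (- z) = - complex.Im z.
Proof. by case: z. Qed.

Lemma Re_mul z w : complex.Re (z * w) =
  complex.Re z * complex.Re w - complex.Im z * complex.Im w.
Proof. by case: z; case: w. Qed.

Lemma Im_mul z w : complex.Im (z * w) =
  complex.Re z * complex.Im w + complex.Im z * complex.Re w.
Proof. by case: z => a b; case: w => c d /=; rewrite [_ * c]mulrC. Qed.

Lemma ReMNi z : complex.Re (- 'i%C * z) = complex.Im z.
Proof. by case: z => a b /=; ring. Qed.

Lemma ImMNi z : complex.Im (- 'i%C * z) = - complex.Re z.
Proof. by case: z => a b /=; ring. Qed.

Lemma Re_nat n : complex.Re (n%:R : R[i]) = n%:R.
Proof. by elim: n => //= n IH; rewrite -addn1 !natrD Re_add IH. Qed.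

Lemma Im_nat n : complex.Im (n%:R : R[i]) = 0.
Proof. by elim: n => //= n IH; rewrite -addn1 !natrD Im_add IH addr0. Qed.

Lemma Re_sum (I : Type) (r : seq I) (F : I -> R[i]) :
  complex.Re (\sum_(i <- r) F i) = \sum_(i <- r) complex.Re (F i).
Proof. by elim: r => [|i r IH]; rewrite ?big_nil// !big_cons Re_add IH. Qed.

Lemma Im_sum (I : Type) (r : seq I) (F : I -> R[i]) :
  complex.Im (\sum_(i <- r) F i) = \sum_(i <- r) complex.Im (F i).
Proof. by elim: r => [|i r IH]; rewrite ?big_nil// !big_cons Im_add IH. Qed.

Lemma Re_conjc z : complex.Re z^*%C = complex.Re z.
Proof. by case: z. Qed.

Lemma Im_conjc z : complex.Im z^*%C = - complex.Im z.
Proof. by case: z. Qed.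

Lemma normc_ge0 z : 0 <= normc z.
Proof. by case: z => a b; exact: sqrtr_ge0. Qed.

Lemma normc_sqr z : normc z ^+ 2 = complex.Re z ^+ 2 + complex.Im z ^+ 2.
Proof. by case: z => a b; rewrite /= sqr_sqrtr// addr_ge0 ?sqr_ge0. Qed.

Lemma Re_le_normc z : `|complex.Re z| <= normc z.
Proof.
by case: z => a b /=; rewrite -sqrtr_sqr ler_wsqrtr// lerDl sqr_ge0.
Qed.

Lemma Im_le_normc z : `|complex.Im z| <= normc z.
Proof.
by case: z => a b /=; rewrite -sqrtr_sqr ler_wsqrtr// lerDr sqr_ge0.
Qed.

Lemma normc_le_ReIm z : normc z <= `|complex.Re z| + `|complex.Im z|.
Proof.
rewrite -(@ler_pXn2r _ 2) ?nnegrE ?normc_ge0 ?addr_ge0//.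
rewrite normc_sqr sqrrD !real_normK ?num_real// addrAC lerDl.
by rewrite mulrn_wge0// mulr_ge0.
Qed.

Lemma normc_conjc z : normc z^*%C = normc z.
Proof. by case: z => a b /=; rewrite sqrrN. Qed.

Lemma normc_sum (I : Type) (r : seq I) (F : I -> R[i]) :
  normc (\sum_(i <- r) F i) <= \sum_(i <- r) normc (F i).
Proof.
elim: r => [|i r IH]; first by rewrite !big_nil normc0.
by rewrite !big_cons (le_trans (le_normcD _ _))// lerD2l.
Qed.

Lemma mulc_conjc z : z * z^*%C = (normc z ^+ 2)%:C.
Proof.
by rewrite normc_sqr; case: z => a b; simpc => /=; congr (_ +i* _); ring.
Qed.

Lemma normc_real (x : R) : normc x%:C = `|x|.
Proof. by rewrite /= expr0n addr0 sqrtr_sqr. Qed.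

Lemma normcB_sqr z w : normc z ^+ 2 <= 2 * normc (z - w) ^+ 2 + 2 * normc w ^+ 2.
Proof.
rewrite !normc_sqr Re_add Im_add Re_opp Im_opp.
have := sqr_ge0 (complex.Re z - 2 * complex.Re w).
by have := sqr_ge0 (complex.Im z - 2 * complex.Im w); nra.
Qed.

Lemma conjcM z w : (z * w)^*%C = z^*%C * w^*%C.
Proof. exact: rmorphM. Qed.

Lemma conjcN z : (- z)^*%C = - z^*%C.
Proof. exact: rmorphN. Qed.

Lemma conjc_sum (I : Type) (r : seq I) (F : I -> R[i]) :
  (\sum_(i <- r) F i)^*%C = \sum_(i <- r) (F i)^*%C.
Proof. exact: rmorph_sum. Qed.

Lemma dbilaplacianE (phi : int -> R[i]) n : dbilaplacian phi n =
  phi (n + 2) + phi (n - 2) - 4 * (phi (n + 1) + phi (n - 1)) + 6 * phi n.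
Proof.
rewrite /dbilaplacian /dlaplacian.
have -> : n + 1 + 1 = n + 2 :> int by ring.
have -> : n + 1 - 1 = n :> int by ring.
have -> : n - 1 + 1 = n :> int by ring.
have -> : n - 1 - 1 = n - 2 :> int by ring.
by ring.
Qed.

(** The squared Laplacian has real coefficients and so acts on real and imaginary parts separately;
    this is its action on each of them. *)
Definition rbilap (f : int -> R) n :=
  f (n + 2) + f (n - 2) - 4 * (f (n + 1) + f (n - 1)) + 6 * f n.

Lemma Re_dbilaplacian (phi : int -> R[i]) n :
  complex.Re (dbilaplacian phi n) = rbilap (fun m => complex.Re (phi m)) n.
Proof.
rewrite dbilaplacianE /rbilap !Re_add Re_opp !Re_mul !Re_nat !Im_nat !Re_add.
by rewrite !mul0r !subr0.
Qed.

Lemma Im_dbilaplacian (phi : int -> R[i]) n :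
  complex.Im (dbilaplacian phi n) = rbilap (fun m => complex.Im (phi m)) n.
Proof.
rewrite dbilaplacianE /rbilap !Im_add Im_opp !Im_mul !Re_nat !Im_nat !Im_add.
by rewrite !mul0r !addr0.
Qed.

End ComplexParts.

Section Kernel.
Context {R : realType}.
Implicit Types (x t c s : R) (m : int).

Lemma is_derive_continuous (f df : R -> R) :
  (forall x : R, is_derive x 1 f (df x)) -> continuous f.
Proof.
by move=> dE x; apply/differentiable_continuous/derivable1_diffP; case: (dE x).
Qed.

Lemma continuous_phase (m t c : R) : continuous (fun x => cos (phase m t c x)).
Proof. exact: is_derive_continuous (fun x => dercos (is_derive_phase m t c x)). Qed.

(** Evenness of the cosine reduces to t >= 0, and the lower bound is the upper bound for the offset
    c + pi. The constant drops from 32 to 16 because pi >= 2. *)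
Lemma average_oscillation (m t c s : R) : 1 <= s -> `|t| = s ^+ 4 ->
  `|avg (fun x => cos (phase m t c x))| <= 16 / s.
Proof.
move=> s1 ts; have s0 : 0 < s by apply: lt_le_trans s1.
wlog t0 : m t c ts / 0 <= t.
  move=> H; have [t0|/ltW t0] := leP 0 t; first exact: H.
  rewrite (eq_avg (g := fun x => cos (phase (- m) (- t) (- c) x))).
    by apply: H; rewrite ?normrN// oppr_ge0.
  by move=> x; rewrite -cosN; congr cos; rewrite /phase; ring.
rewrite ger0_norm// in ts; subst t.
have H c' : avg (fun x => cos (phase m (s ^+ 4) c' x)) <= 16 / s.
  have [F [dF ->]] := antiderivative (@continuous_phase m (s ^+ 4) c').
  rewrite ler_pdivrMl ?pi_gt0//.
  apply: le_trans (oscillatory_bound s1 dF) _.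
  have := @pi_ge2 R; have : 0 < s^-1 by rewrite invr_gt0.
  by nra.
rewrite ler_norml H andbT lerNl -avgN; last exact: continuous_phase.
rewrite (eq_avg (g := fun x => cos (phase m (s ^+ 4) (c + pi) x))) ?H//.
by move=> x; rewrite -cosDpi; congr cos; rewrite /phase; ring.
Qed.

(** The offset [c] treats both parts of the kernel at once: c = 0 gives the real part, c = pi / 2
    turns the cosine into minus the sine and gives the imaginary part, and each time derivative adds
    another pi / 2. *)
Definition kern c t m : R :=
  avg (fun x => cos (m%:~R * x) * cos (t * symb x + c)).

Lemma kernE c t m x : cos (m%:~R * x) * cos (t * symb x + c) =
  2^-1 * (cos (phase m%:~R t c x) + cos (phase m%:~R (- t) (- c) x)).
Proof.
have -> : phase m%:~R (- t) (- c) x = m%:~R * x - (t * symb x + c).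
  by rewrite /phase; ring.
have -> : phase m%:~R t c x = m%:~R * x + (t * symb x + c).
  by rewrite /phase; ring.
by rewrite [cos (_ + (_ + c))]cosD cosB; field.
Qed.

Lemma continuous_kern c t m :
  continuous (fun x => cos (m%:~R * x) * cos (t * symb x + c)).
Proof.
under eq_fun do rewrite kernE.
apply: is_derive_continuous => x; apply: derMl; apply: derD;
  exact: dercos (is_derive_phase _ _ _ _).
Qed.

Lemma kern_le1 c t m : `|kern c t m| <= 1.
Proof.
apply: normr_avg; first exact: continuous_kern.
by move=> x; rewrite normrM -[leRHS]mulr1 ler_pM// cos_max.
Qed.

Lemma kern_decay c t m s : 1 <= s -> `|t| = s ^+ 4 -> `|kern c t m| <= 16 / s.
Proof.
move=> s1 ts; rewrite /kern (eq_avg (kernE c t m)) avgZ; last first.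
  move=> x; apply: continuousD; exact: continuous_phase.
rewrite avgD; [|exact: continuous_phase..].
rewrite normrM ger0_norm ?invr_ge0// ler_pdivrMl//.
apply: le_trans (ler_normD _ _) _.
have := average_oscillation m%:~R c s1 ts.
have := @average_oscillation m%:~R (- t) (- c) s s1; rewrite normrN => /(_ ts).
by lra.
Qed.

Lemma rbilap_cos m x :
  rbilap (fun k => cos (k%:~R * x)) m = symb x * cos (m%:~R * x).
Proof.
have E k : cos ((m + k)%:~R * x) + cos ((m - k)%:~R * x) =
    2 * cos (m%:~R * x) * cos (k%:~R * x) :> R.
  by rewrite intrD intrB mulrDl mulrBl cosD cosB; ring.
rewrite /rbilap !E mul1r.
have -> : cos (2%:~R * x) = 2 * cos x ^+ 2 - 1 :> R.
  have -> : 2%:~R * x = x *+ 2 by rewrite mulr2n -[2%:~R]/(1 + 1) mulrDl mul1r.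
  by rewrite cos_mulr2n mulr_natl.
by rewrite /symb; ring.
Qed.

Lemma avg_rbilap (f : int -> R -> R) m : (forall m, continuous (f m)) ->
  avg (fun x => rbilap (f ^~ x) m) = rbilap (fun k => avg (f k)) m.
Proof.
move=> cf; rewrite /rbilap.
have cZ (k : R) g : continuous g -> continuous (fun x : R => k * g x : R).
  by move=> cg x; apply: continuousM; [exact: cst_continuous|exact: cg].
have c1 : continuous (fun x : R => f (m + 2) x + f (m - 2) x : R).
  by move=> x; apply: cvgD; exact: cf.
have c2 : continuous (fun x : R => f (m + 1) x + f (m - 1) x : R).
  by move=> x; apply: cvgD; exact: cf.
have c3 := cZ 4 _ c2; have c4 := cZ 6 _ (cf m).
have c5 : continuous (fun x : R => - (4 * (f (m + 1) x + f (m - 1) x)) : R).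
  by move=> x; apply: cvgN; exact: c3.
rewrite avgD//; last by move=> x; apply: cvgD; [exact: c1|exact: c5].
by rewrite avgD// avgN// !avgZ// !avgD.
Qed.

(** Differentiating in time brings down [symb x], and multiplying cos (m x) by [symb x] is the same
    as taking its fourth difference in m. *)
Lemma is_derive_kern c t m :
  is_derive t 1 (fun t => kern c t m) (rbilap (kern (c + pi / 2) t) m).
Proof.
have -> : rbilap (kern (c + pi / 2) t) m =
    avg (fun x => cos (m%:~R * x) * (- sin (t * symb x + c) * symb x)).
  rewrite -(avg_rbilap m (@continuous_kern (c + pi / 2) t)); apply: eq_avg => x.
  rewrite addrA cosDpihalf.
  transitivity (rbilap (fun k => cos (k%:~R * x)) m * - sin (t * symb x + c)).
    by rewrite /rbilap; ring.
  by rewrite rbilap_cos; ring.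
apply: (@is_derive_avg _ (fun t x => cos (m%:~R * x) * cos (t * symb x + c))
  (fun t x => cos (m%:~R * x) * (- sin (t * symb x + c) * symb x)) t 16).
- by move=> s; exact: continuous_kern.
- move=> s x; apply: derMl; apply: dercos.
  apply: is_derive_eq (derD (derM (is_derive_id s 1) (derC (symb x) s)) (derC c s)) _.
  by rewrite /=; ring.
- move=> s x; rewrite normrM -[leRHS]mul1r ler_pM ?cos_max//.
  rewrite normrM -[leRHS]mul1r ler_pM// ?normrN ?sin_max//.
  rewrite /symb normrM normrX ger0_norm//.
  have : `|1 - cos x| <= 2.
    by have := cos_max x; rewrite !ler_norml; lra.
  by have := normr_ge0 (1 - cos x); nra.
Qed.

(* The symbol of the squared Laplacian is even, so the Fourier integral of
   e^{-it symb} over the circle reduces to an average over [0, pi]. *)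
Definition kernel t m : R[i] := kern 0 t m +i* kern (pi / 2) t m.

Definition is_cderive (f : R -> R[i]) t (z : R[i]) :=
  is_derive t 1 (fun s => complex.Re (f s)) (complex.Re z) /\
  is_derive t 1 (fun s => complex.Im (f s)) (complex.Im z).

Lemma is_cderive_kernel t m :
  is_cderive (fun t => kernel t m) t (- 'i%C * dbilaplacian (kernel t) m).
Proof.
split.
  rewrite ReMNi Im_dbilaplacian.
  apply: is_derive_eq (is_derive_kern 0 t m) _.
  by rewrite add0r.
rewrite ImMNi Re_dbilaplacian.
apply: is_derive_eq (is_derive_kern (pi / 2) t m) _.
have E k : kern (pi / 2 + pi / 2) t k = - kern 0 t k.
  rewrite /kern -avgN; last exact: continuous_kern.
  apply: eq_avg => x; rewrite addr0.
  have -> : t * symb x + (pi / 2 + pi / 2) = t * symb x + pi by field.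
  by rewrite cosDpi mulrN.
by rewrite /rbilap !E /=; ring.
Qed.

Lemma sin_int_pi m : sin (m%:~R * pi) = 0 :> R.
Proof.
have H n : sin (n%:R * pi) = 0 :> R.
  elim: n => [|n IH]; first by rewrite mul0r sin0.
  by rewrite -addn1 natrD mulrDl mul1r sinDpi IH oppr0.
by case: (intP m) => [|n|n]; rewrite ?mul0r ?sin0// ?rmorphN ?mulNr ?sinN/= H ?oppr0.
Qed.

Lemma kernel0 m : kernel 0 m = (m == 0)%:R.
Proof.
rewrite /kernel /kern.
rewrite (eq_avg (g := fun x => cos (m%:~R * x))); last first.
  by move=> x; rewrite mul0r addr0 cos0 mulr1.
rewrite (eq_avg (f := fun x => _ * cos (_ + pi / 2)) (g := fun=> 0)); last first.
  by move=> x; rewrite mul0r add0r cos_pihalf mulr0.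
rewrite avg0; have [->|m0] := eqVneq m 0.
  rewrite (eq_avg (g := fun=> 1)) ?avg_cst// => x; by rewrite mul0r cos0.
have mr0 : m%:~R != 0 :> R by rewrite intr_eq0.
have cc : continuous (fun x => cos (m%:~R * x) : R).
  by apply: is_derive_continuous => x; apply: dercos; exact: derMl.
have dF (x : R) : is_derive x 1 (fun x => m%:~R^-1 * sin (m%:~R * x)) (cos (m%:~R * x)).
  apply: is_derive_eq (derMl _ (dersin (derMl _ (is_derive_id x 1)))) _.
  by rewrite /=; field.
by rewrite (avg_FTC cc dF) sin_int_pi !mulr0 sin0 !mulr0 subrr mulr0.
Qed.

Lemma kernelNl t m : kernel (- t) m = (kernel t m)^*%C.
Proof.
rewrite /kernel /=; congr (_ +i* _).
  by apply: eq_avg => x; rewrite !addr0 mulNr cosN.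
rewrite /kern -avgN; last exact: continuous_kern.
by apply: eq_avg => x; rewrite !cosDpihalf mulNr sinN; ring.
Qed.

Lemma kernelNr t m : kernel t (- m) = kernel t m.
Proof.
by rewrite /kernel; congr (_ +i* _); apply: eq_avg => x; rewrite rmorphN/= mulNr cosN.
Qed.

Lemma normc_kernel_le2 t m : normc (kernel t m) <= 2.
Proof.
apply: le_trans (normc_le_ReIm _) _ => /=.
by have := kern_le1 0 t m; have := kern_le1 (pi / 2) t m; lra.
Qed.

Lemma normc_kernel_decay t m s : 1 <= s -> `|t| = s ^+ 4 ->
  normc (kernel t m) <= 32 / s.
Proof.
move=> s1 ts; apply: le_trans (normc_le_ReIm _) _ => /=.
by have := kern_decay 0 m s1 ts; have := kern_decay (pi / 2) m s1 ts; lra.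
Qed.

End Kernel.

(** * Positive definiteness and the discrete Hardy-Littlewood-Sobolev inequality *)

Section PositiveDefinite.
Context {R : realType}.

(** At each frequency x the integrand is a sum of four squares: [p j] and [q j] are the real and
    imaginary parts of a_j exp(-i t_j symb x), and cos ((m_j - m_l) x) splits into a product of
    cosines plus a product of sines. *)
Lemma kernel_posdef (I : Type) (r : seq I) (a : I -> R[i]) (t : I -> R)
    (m : I -> int) :
  0 <= complex.Re (\sum_(j <- r) \sum_(l <- r)
         a j * (a l)^*%C * kernel (t j - t l) (m j - m l)).
Proof.
pose G j l x : R :=
  complex.Re (a j * (a l)^*%C) *
    (cos ((m j - m l)%:~R * x) * cos ((t j - t l) * symb x + 0)) +
  - complex.Im (a j * (a l)^*%C) *
    (cos ((m j - m l)%:~R * x) * cos ((t j - t l) * symb x + pi / 2)).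
have cZ (k c t' : R) (m' : int) :
    continuous (fun x : R => k * (cos (m'%:~R * x) * cos (t' * symb x + c)) : R).
  by move=> x; apply: cvgM; [exact: cvg_cst|exact: continuous_kern].
have cG j l : continuous (G j l) by move=> x; apply: cvgD; exact: cZ.
rewrite [leRHS](_ : _ = avg (fun x => \sum_(j <- r) \sum_(l <- r) G j l x)).
  apply: avg_ge0 => x.
  pose al j := t j * symb x.
  pose p j := complex.Re (a j) * cos (al j) + complex.Im (a j) * sin (al j).
  pose q j := complex.Im (a j) * cos (al j) - complex.Re (a j) * sin (al j).
  pose c j := cos ((m j)%:~R * x) : R.
  pose s j := sin ((m j)%:~R * x) : R.
  have GE j l : G j l x = (c j * p j) * (c l * p l) + (c j * q j) * (c l * q l)
      + ((s j * p j) * (s l * p l) + (s j * q j) * (s l * q l)).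
    rewrite /G addr0 cosDpihalf intrB !mulrBl cosB cosB sinB Re_mul Im_mul.
    rewrite Re_conjc Im_conjc /p /q /c /s /al.
    by ring.
  under eq_bigr do under eq_bigr do rewrite GE.
  under eq_bigr do rewrite !big_split /=.
  by rewrite !big_split /= -!big_distrlr /= !addr_ge0// -expr2 sqr_ge0.
rewrite avg_sum; last by move=> j; exact: continuous_sum.
rewrite Re_sum; apply: eq_bigr => j _; rewrite avg_sum// Re_sum.
apply: eq_bigr => l _; rewrite Re_mul /kernel /=.
by rewrite /G avgD; [rewrite !avgZ ?mulNr//; exact: continuous_kern|exact: cZ..].
Qed.

(** Bessel's inequality drawn from positivity alone. The points (0, n) with n in [s] are adjoined
    with coefficients - c n. The kernel at time 0 being the delta, the two cross blocks each
    contribute minus the sum of squares and the new diagonal block contributes it once. *)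
Lemma kernel_bessel (I : Type) (r : seq I) (a : I -> R[i]) (t : I -> R)
    (m : I -> int) (s : seq int) : uniq s ->
  \sum_(n <- s) normc (\sum_(j <- r) a j * kernel (t j) (m j - n)) ^+ 2 <=
  complex.Re (\sum_(j <- r) \sum_(l <- r)
         a j * (a l)^*%C * kernel (t j - t l) (m j - m l)).
Proof.
move=> us; pose c n := \sum_(j <- r) a j * kernel (t j) (m j - n).
pose A (i : I + int) := match i with inl j => a j | inr n => - c n end.
pose T (i : I + int) : R := match i with inl j => t j | inr n => 0 end.
pose M (i : I + int) : int := match i with inl j => m j | inr n => n end.
have := kernel_posdef ([seq inl j | j <- r] ++ [seq inr n | n <- s]) A T M.
set Q := (X in _ -> _ <= complex.Re X).
rewrite [X in complex.Re X](_ : _ = Q - \sum_(n <- s) c n * (c n)^*%C).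
  under eq_bigr do rewrite mulc_conjc.
  rewrite Re_add Re_opp (Re_sum s) subr_ge0 => h.
  exact: h.
rewrite big_cat !big_map /=.
under eq_bigr do rewrite big_cat !big_map /=.
under [X in _ + X]eq_bigr do rewrite big_cat !big_map /=.
rewrite !big_split /= -/Q.
have -> : \sum_(j <- r) \sum_(n <- s) a j * (- c n)^*%C * kernel (t j - 0) (m j - n)
    = - \sum_(n <- s) c n * (c n)^*%C.
  rewrite exchange_big /= -[in RHS]sumrN; apply: eq_bigr => n _.
  have -> : c n * (c n)^*%C = \sum_(j <- r) a j * kernel (t j) (m j - n) * (c n)^*%C.
    by rewrite -mulr_suml.
  rewrite -[in RHS]sumrN; apply: eq_bigr => j _.
  by rewrite subr0 conjcN; ring.
have -> : \sum_(n <- s) \sum_(l <- r) - c n * (a l)^*%C * kernel (0 - t l) (n - m l)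
    = - \sum_(n <- s) c n * (c n)^*%C.
  rewrite -[in RHS]sumrN; apply: eq_bigr => n _.
  have -> : c n * (c n)^*%C =
      \sum_(j <- r) c n * (a j * kernel (t j) (m j - n))^*%C.
    by rewrite -mulr_sumr -conjc_sum.
  rewrite -[in RHS]sumrN; apply: eq_bigr => j _.
  by rewrite sub0r kernelNl -opprB kernelNr conjcM; ring.
have -> : \sum_(n <- s) \sum_(l <- s) - c n * (- c l)^*%C * kernel (0 - 0) (n - l)
    = \sum_(n <- s) c n * (c n)^*%C.
  apply: eq_big_seq => n ns; rewrite (bigD1_seq n)//= subr0 subrr kernel0 eqxx.
  rewrite big1 ?addr0 ?mulr1 => [|l ln].
    by rewrite conjcN mulrNN.
  by rewrite kernel0 subr_eq0 eq_sym (negbTE ln) mulr0.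
by rewrite addrA subrK.
Qed.

Lemma kernel_bessel_normc (I : Type) (r : seq I) (a : I -> R[i]) (t : I -> R)
    (m : I -> int) (s : seq int) : uniq s ->
  \sum_(n <- s) normc (\sum_(j <- r) a j * kernel (t j) (m j - n)) ^+ 2 <=
  \sum_(j <- r) \sum_(l <- r)
    normc (a j) * normc (a l) * normc (kernel (t j - t l) (m j - m l)).
Proof.
move=> us; apply: le_trans (kernel_bessel r a t m us) _.
rewrite Re_sum ler_sum// => j _; rewrite Re_sum ler_sum// => l _.
apply: le_trans (ler_norm _) _; apply: le_trans (Re_le_normc _) _.
by rewrite !normcM normc_conjc.
Qed.

End PositiveDefinite.

Section DiscreteHLS.
Context {R : realType}.
Implicit Types (x y a b rho : R) (g p q : nat -> R).

Definition root4 x : R := Num.sqrt (Num.sqrt x).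

Lemma root4_ge0 x : 0 <= root4 x.
Proof. exact: sqrtr_ge0. Qed.

Lemma root4_gt0 x : 0 < x -> 0 < root4 x.
Proof. by move=> x0; rewrite !sqrtr_gt0. Qed.

Lemma root4K x : 0 <= x -> root4 x ^+ 4 = x.
Proof.
move=> x0; rewrite (_ : 4 = 2 * 2)%N// exprM sqr_sqrtr ?sqrtr_ge0//.
by rewrite sqr_sqrtr.
Qed.

Lemma ler_root4 x y : x <= y -> root4 x <= root4 y.
Proof. by move=> xy; rewrite !ler_wsqrtr. Qed.

Definition wt (d : nat) : R := (root4 d.+1%:R)^-1.

Lemma wt_ge0 d : 0 <= wt d.
Proof. by rewrite invr_ge0 root4_ge0. Qed.

Lemma wt8 d : wt d ^+ 8 = (d.+1%:R ^+ 2)^-1.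
Proof. by rewrite /wt exprVn (_ : 8 = 4 * 2)%N// exprM root4K. Qed.

Lemma sum_wt_le J x : 0 <= x ->
  \sum_(0 <= d < J | d.+1%:R <= x ^+ 4) wt d <= 4 * x ^+ 3.
Proof.
move=> x0; suff : \sum_(0 <= d < J | d.+1%:R <= x ^+ 4) wt d <= 4 * x ^+ 3 /\
    \sum_(0 <= d < J | d.+1%:R <= x ^+ 4) wt d <= 4 * root4 J%:R ^+ 3 by case.
elim: J => [|J [IH1 IH2]].
  by rewrite big_geq//; split; rewrite mulr_ge0// exprn_ge0// root4_ge0.
rewrite big_mkcond big_nat_recr //= -big_mkcond /=.
have step : 4 * root4 J%:R ^+ 3 + wt J <= 4 * root4 J.+1%:R ^+ 3.
  rewrite /wt; set a := root4 J.+1%:R; set b := root4 J%:R.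
  have a0 : 0 < a by rewrite root4_gt0.
  have b0 : 0 <= b by exact: root4_ge0.
  have ab : b <= a by rewrite ler_root4// ler_nat.
  have E : a ^+ 4 = b ^+ 4 + 1 by rewrite !root4K// -natr1.
  rewrite -lerBrDl -div1r ler_pdivrMr//.
  apply: (@le_trans _ _ (a ^+ 4 - b ^+ 4)); first by rewrite E; lra.
  have h : 0 <= (a - b) * (3 * a ^+ 3 + 3 * a ^+ 2 * b + 3 * a * b ^+ 2 - b ^+ 3).
    rewrite mulr_ge0 ?subr_ge0//; have := exprn_ge0 2 (ltW a0).
    have ab3 : b ^+ 3 <= a ^+ 3 by rewrite lerXn2r ?nnegrE// ltW.
    have h1 : 0 <= a ^+ 2 * b by rewrite mulr_ge0// exprn_ge0// ltW.
    have h2 : 0 <= a * b ^+ 2 by rewrite mulr_ge0 ?exprn_ge0// ltW.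
    have h3 : 0 <= a ^+ 3 by rewrite exprn_ge0// ltW.
    by lra.
  by rewrite -subr_ge0; apply: le_trans h _; rewrite le_eqVlt; apply/orP; left;
    apply/eqP; ring.
case: ifPn => [Jx|_].
  have h := le_trans (lerD IH2 (lexx (wt J))) step; split => //.
  apply: le_trans h _; rewrite ler_pM2l// lerXn2r ?nnegrE ?root4_ge0//.
  by rewrite -(@ler_pXn2r _ 4) ?nnegrE ?root4_ge0// root4K.
rewrite addr0; split => //; apply: le_trans IH2 _.
by apply: le_trans step; rewrite lerDl wt_ge0.
Qed.

(** Telescoping with 1 / n ^ 2 <= 2 / n - 2 / (n + 1). The case distinction in the strengthened
    claim is there because the sum stays empty until J exceeds [rho]. *)
Lemma sum_invsqr_le J rho : 0 < rho ->
  \sum_(0 <= d < J | rho < d.+1%:R) (d.+1%:R ^+ 2)^-1 <= 2 / rho.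
Proof.
move=> r0; suff : if J%:R <= rho
    then \sum_(0 <= d < J | rho < d.+1%:R) (d.+1%:R ^+ 2)^-1 = 0 :> R
    else \sum_(0 <= d < J | rho < d.+1%:R) (d.+1%:R ^+ 2)^-1
           <= 2 / rho - 2 / J.+1%:R.
  case: ifP => _ h; first by rewrite h divr_ge0// ltW.
  by apply: le_trans h _; rewrite gerBl divr_ge0.
elim: J => [|J IH]; first by rewrite big_geq// ltW.
rewrite big_mkcond big_nat_recr //= -big_mkcond /=.
case: ifPn => [Jr|]; rewrite -?ltNge.
  rewrite (le_trans _ Jr) ?ler_nat// in IH.
  by rewrite IH add0r ifF// ltNge Jr.
move=> rJ; rewrite rJ.
have h : \sum_(0 <= d < J | rho < d.+1%:R) (d.+1%:R ^+ 2)^-1 <=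
    2 / rho - 2 / J.+1%:R.
  case: ifP IH => // _ ->; rewrite subr_ge0 ler_pM2l// lef_pV2 ?posrE//.
  exact: ltW.
suff k : ((J.+1%:R : R) ^+ 2)^-1 <= 2 / J.+1%:R - 2 / J.+2%:R.
  by apply: le_trans (lerD h k) _; rewrite addrA subrK.
rewrite -(natr1 J.+1); set x := J.+1%:R : R.
have x1 : 1 <= x by rewrite /x ler1n.
have x0 : 0 < x by apply: lt_le_trans x1.
have y0 : 0 < x + 1 by rewrite addr_gt0.
rewrite -subr_ge0.
have -> : 2 / x - 2 / (x + 1) - (x ^+ 2)^-1 = (x - 1) / (x ^+ 2 * (x + 1)).
  by field; rewrite !gt_eqF.
by rewrite divr_ge0 ?subr_ge0// mulr_ge0 ?exprn_ge0 ?ltW.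
Qed.

(** Each distance to j is attained at most twice. *)
Lemma sum_distn_le (J j : nat) (f : nat -> R) : (j < J)%N ->
  (forall d, 0 <= f d) ->
  \sum_(0 <= l < J) f `|j - l|%N <= 2 * \sum_(0 <= d < J) f d.
Proof.
move=> jJ f0; rewrite (big_cat_nat (n := j))//=; last exact: ltnW.
have mono (a b : nat) : (a <= b)%N -> \sum_(0 <= d < a) f d <= \sum_(0 <= d < b) f d.
  by move=> ab; rewrite [leRHS](big_cat_nat (n := a))//= lerDl sumr_ge0.
have -> : 2 * \sum_(0 <= d < J) f d =
    \sum_(0 <= d < J) f d + \sum_(0 <= d < J) f d by rewrite mulr_natl mulr2n.
apply: lerD.
  apply: le_trans (mono j.+1 J jJ); rewrite big_nat_recl//= big_nat_rev /= add0n.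
  rewrite addrC; apply: ler_wpDr => //; rewrite le_eqVlt; apply/orP; left; apply/eqP.
  by apply: eq_big_nat => i ij; congr f; lia.
apply: le_trans (mono (J - j)%N J (leq_subr _ _)).
rewrite -{1}(add0n j) big_addn; apply: ler_sum_nat => i _.
by rewrite le_eqVlt; apply/orP; left; apply/eqP; congr f; lia.
Qed.

Lemma pow7_mul_le a b : 0 <= a -> 0 <= b -> a ^+ 7 * b <= a ^+ 8 + b ^+ 8.
Proof.
move=> a0 b0; have [ba|/ltW ab] := leP b a.
  by rewrite (exprSr a 7) (le_trans (ler_wpM2l _ ba)) ?exprn_ge0// lerDl exprn_ge0.
rewrite (exprSr b 7) (le_trans (ler_wpM2r b0 (lerXn2r 7 _ _ ab)))//.
by rewrite lerDr exprn_ge0.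
Qed.

(* Only the terms dominated by g j are kept.  Splitting the distances at
   g j ^- 8, each term is bounded using g l <= g j below the threshold and
   Young's inequality above it. *)
Lemma hls_dominated J j g : (j < J)%N -> (forall l, 0 <= g l) ->
  \sum_(0 <= l < J) g l ^+ 8 <= 2 ->
  \sum_(0 <= l < J | g l <= g j) g l ^+ 7 * wt `|j - l|%N <= 14 * g j.
Proof.
move=> jJ g0 g8; have [gj0|gjN0] := eqVneq (g j) 0.
  rewrite gj0 mulr0 big1// => l gl0; have /eqP -> : g l == 0 by rewrite eq_le gl0 g0.
  by rewrite expr0n mul0r.
have gj : 0 < g j by rewrite lt_def gjN0 g0.
pose x := (g j ^+ 2)^-1; have x0 : 0 < x by rewrite invr_gt0 exprn_gt0.
pose u d := if d.+1%:R <= x ^+ 4 then wt d else 0.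
pose v d := if x ^+ 4 < d.+1%:R then ((d.+1%:R : R) ^+ 2)^-1 else 0.
have u0 d : 0 <= u d by rewrite /u; case: ifP => // _; exact: wt_ge0.
have v0 d : 0 <= v d by rewrite /v; case: ifP => // _; rewrite invr_ge0 exprn_ge0.
have term l : g l <= g j -> g l ^+ 7 * wt `|j - l|%N <=
    g j ^+ 7 * u `|j - l|%N + g j * g l ^+ 8 + (g j ^+ 7)^-1 * v `|j - l|%N.
  move=> glj; set d := `|j - l|%N; rewrite /u /v; case: leP => dx.
    rewrite mulr0 addr0; apply: ler_wpDr; first by rewrite mulr_ge0 ?exprn_ge0// ltW.
    by rewrite ler_wpM2r ?wt_ge0// lerXn2r ?nnegrE.
  rewrite mulr0 add0r -wt8.
  have := @pow7_mul_le (g l) (wt d / g j) (g0 l) (divr_ge0 (wt_ge0 d) (ltW gj)).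
  rewrite -(ler_pM2l gj) => h; apply: le_trans (le_trans _ h) _;
    rewrite le_eqVlt; apply/orP; left; apply/eqP; by field.
apply: (@le_trans _ _ (\sum_(0 <= l < J) (g j ^+ 7 * u `|j - l|%N +
    g j * g l ^+ 8 + (g j ^+ 7)^-1 * v `|j - l|%N))).
  rewrite big_mkcond; apply: ler_sum_nat => l _; case: ifP => [/term//|_].
  by rewrite !addr_ge0// ?mulr_ge0 ?invr_ge0 ?exprn_ge0// ltW.
(* The near part, the eighth powers and the far part contribute 8, 2 and 4 times [g j]. *)
rewrite !big_split /= -!mulr_sumr.
have h1 : \sum_(0 <= l < J) u `|j - l|%N <= 8 * x ^+ 3.
  apply: le_trans (sum_distn_le jJ u0) _.
  rewrite (_ : 8 * x ^+ 3 = 2 * (4 * x ^+ 3)); last by ring.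
  by rewrite ler_pM2l// /u -big_mkcond; exact: sum_wt_le (ltW x0).
have h2 : \sum_(0 <= l < J) v `|j - l|%N <= 4 / x ^+ 4.
  apply: le_trans (sum_distn_le jJ v0) _.
  rewrite (_ : 4 / x ^+ 4 = 2 * (2 / x ^+ 4)); last by ring.
  by rewrite ler_pM2l// /v -big_mkcond; exact: sum_invsqr_le (exprn_gt0 _ x0).
have e1 : g j ^+ 7 * (8 * x ^+ 3) = 8 * g j by rewrite /x; field.
have e2 : (g j ^+ 7)^-1 * (4 / x ^+ 4) = 4 * g j by rewrite /x; field.
have k1 := ler_wpM2l (exprn_ge0 7 (ltW gj)) h1.
have k2 := ler_wpM2l (ltW gj) g8.
have k3 : (g j ^+ 7)^-1 * \sum_(0 <= l < J) v `|j - l|%N <=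
    (g j ^+ 7)^-1 * (4 / x ^+ 4) by rewrite ler_wpM2l// invr_ge0 exprn_ge0// ltW.
by rewrite e1 in k1; rewrite e2 in k3; lra.
Qed.

(** Replacing both sequences by their maximum [g] makes the form symmetric. Each pair (j, l) is then
    charged to the index with the larger value of [g], where [hls_dominated] applies; each of the
    two halves costs 14 * 2. *)
Lemma hls_normalized J p q : (forall l, 0 <= p l) -> (forall l, 0 <= q l) ->
  \sum_(0 <= l < J) p l ^+ 8 <= 1 -> \sum_(0 <= l < J) q l ^+ 8 <= 1 ->
  \sum_(0 <= j < J) \sum_(0 <= l < J) p j ^+ 7 * q l ^+ 7 * wt `|j - l|%N <= 56.
Proof.
move=> p0 q0 p8 q8; pose g l := Num.max (p l) (q l).
have g0 l : 0 <= g l by rewrite le_max p0.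
have g8 : \sum_(0 <= l < J) g l ^+ 8 <= 2.
  apply: (@le_trans _ _ (\sum_(0 <= l < J) (p l ^+ 8 + q l ^+ 8))).
    by apply: ler_sum_nat => l _; rewrite /g; case: (leP (p l) (q l)) => _;
      [rewrite lerDr|rewrite lerDl]; exact: exprn_ge0.
  by rewrite big_split /=; lra.
have half : \sum_(0 <= j < J) \sum_(0 <= l < J | g l <= g j)
    g j ^+ 7 * (g l ^+ 7 * wt `|j - l|%N) <= 28.
  apply: (@le_trans _ _ (\sum_(0 <= j < J) 14 * g j ^+ 8)); last first.
    by rewrite -mulr_sumr; lra.
  apply: ler_sum_nat => j /andP[_ jJ]; rewrite -mulr_sumr.
  rewrite (exprSr (g j) 7) mulrCA ler_wpM2l ?exprn_ge0//.
  exact: hls_dominated.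
apply: (@le_trans _ _ (\sum_(0 <= j < J) \sum_(0 <= l < J)
   ((if g l <= g j then g j ^+ 7 * (g l ^+ 7 * wt `|j - l|%N) else 0) +
    (if g j <= g l then g l ^+ 7 * (g j ^+ 7 * wt `|l - j|%N) else 0)))).
  apply: ler_sum_nat => j _; apply: ler_sum_nat => l _.
  have h : p j ^+ 7 * q l ^+ 7 * wt `|j - l|%N <=
      g j ^+ 7 * (g l ^+ 7 * wt `|j - l|%N).
    rewrite mulrA ler_wpM2r ?wt_ge0// ler_pM ?exprn_ge0//.
      by rewrite lerXn2r ?nnegrE// le_max lexx.
    by rewrite lerXn2r ?nnegrE// le_max lexx orbT.
  have t0 i k : 0 <= g i ^+ 7 * (g k ^+ 7 * wt `|i - k|%N).
    by rewrite !mulr_ge0 ?exprn_ge0 ?wt_ge0.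
  have [glj|/ltW gjl] := leP (g l) (g j).
    by rewrite (le_trans h)// lerDl; case: ifP.
  by rewrite gjl add0r (le_trans h)// mulrCA distnC.
under eq_bigr do rewrite big_split /=.
rewrite big_split /= [X in _ + X]exchange_big_nat /=.
have e : forall F : nat -> nat -> R, \sum_(0 <= j < J) \sum_(0 <= l < J)
    (if g l <= g j then F j l else 0) =
    \sum_(0 <= j < J) \sum_(0 <= l < J | g l <= g j) F j l.
  by move=> F; apply: eq_bigr => j _; rewrite -big_mkcond.
by rewrite !e; lra.
Qed.

Lemma discrete_hls J p q (P Q : R) : 0 < P -> 0 < Q ->
  (forall l, 0 <= p l) -> (forall l, 0 <= q l) ->
  \sum_(0 <= l < J) p l ^+ 8 <= P ^+ 8 -> \sum_(0 <= l < J) q l ^+ 8 <= Q ^+ 8 ->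
  \sum_(0 <= j < J) \sum_(0 <= l < J) p j ^+ 7 * q l ^+ 7 * wt `|j - l|%N
    <= 56 * P ^+ 7 * Q ^+ 7.
Proof.
move=> P0 Q0 p0 q0 p8 q8.
have n8 r (S : R) : 0 < S -> \sum_(0 <= l < J) r l ^+ 8 <= S ^+ 8 ->
    \sum_(0 <= l < J) (r l / S) ^+ 8 <= 1 :> R.
  move=> S0 h; under eq_bigr do rewrite expr_div_n.
  by rewrite -mulr_suml ler_pdivrMr ?exprn_gt0// mul1r.
have h := @hls_normalized J (fun l => p l / P) (fun l => q l / Q)
  (fun l => divr_ge0 (p0 l) (ltW P0)) (fun l => divr_ge0 (q0 l) (ltW Q0))
  (n8 p P P0 p8) (n8 q Q Q0 q8).
have PQ : 0 < P ^+ 7 * Q ^+ 7 by rewrite mulr_gt0 ?exprn_gt0.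
rewrite -mulrA -ler_pdivrMr//; apply: le_trans h.
rewrite le_eqVlt; apply/orP; left; apply/eqP.
rewrite mulr_suml; apply: eq_bigr => j _; rewrite mulr_suml.
by apply: eq_bigr => l _; field; rewrite !gt_eqF.
Qed.

End DiscreteHLS.

(** * Homogeneous estimates at sample points *)

Section SampledStrichartz.
Context {R : realType}.
Implicit Types (t : nat -> R) (m : nat -> int) (s : seq int).

Lemma cauchy_schwarz_sqr (I : Type) (r : seq I) (x y : I -> R) :
  (\sum_(i <- r) x i * y i) ^+ 2 <=
  (\sum_(i <- r) x i ^+ 2) * (\sum_(i <- r) y i ^+ 2).
Proof.
elim: r => [|i r IH]; first by rewrite !big_nil expr0n mul0r.
rewrite !big_cons; move: IH.
set A := \sum_(i <- r) x i * y i; set B := \sum_(i <- r) x i ^+ 2.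
set C := \sum_(i <- r) y i ^+ 2 => ABC.
have B0 : 0 <= B by apply: sumr_ge0 => j _; exact: sqr_ge0.
have C0 : 0 <= C by apply: sumr_ge0 => j _; exact: sqr_ge0.
move: A B C (x i) (y i) ABC B0 C0 => A B C u v ABC B0 C0.
suff H : 2 * A * u * v <= B * v ^+ 2 + C * u ^+ 2.
  rewrite -subr_ge0 (_ : _ - _ = (B * C - A ^+ 2) +
    (B * v ^+ 2 + C * u ^+ 2 - 2 * A * u * v)); last by ring.
  by rewrite addr_ge0 ?subr_ge0.
apply: le_trans (ler_norm _) _.
have Bv := mulr_ge0 B0 (sqr_ge0 v); have Cu := mulr_ge0 C0 (sqr_ge0 u).
rewrite -(@ler_pXn2r _ 2) ?nnegrE ?(addr_ge0 Bv Cu)//.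
rewrite real_normK ?num_real//.
apply: (@le_trans _ _ (4 * (B * C) * (u * v) ^+ 2)).
  rewrite (_ : (2 * A * u * v) ^+ 2 = 4 * A ^+ 2 * (u * v) ^+ 2); last by ring.
  by rewrite ler_wpM2r ?sqr_ge0// ler_pM2l.
rewrite -subr_ge0 (_ : _ - _ = (B * v ^+ 2 - C * u ^+ 2) ^+ 2) ?sqr_ge0//.
by ring.
Qed.

Lemma cauchy_schwarz (I : Type) (r : seq I) (x y : I -> R) (X Y : R) :
  0 <= X -> 0 <= Y -> \sum_(i <- r) x i ^+ 2 <= X ^+ 2 ->
  \sum_(i <- r) y i ^+ 2 <= Y ^+ 2 -> \sum_(i <- r) x i * y i <= X * Y.
Proof.
move=> X0 Y0 hx hy; apply: le_trans (ler_norm _) _.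
rewrite -(@ler_pXn2r _ 2) ?nnegrE ?mulr_ge0// real_normK ?num_real//.
apply: le_trans (cauchy_schwarz_sqr r x y) _; rewrite exprMn.
by apply: ler_pM => //; apply: sumr_ge0 => i _; exact: sqr_ge0.
Qed.

(** The 1 in the hypothesis is the loss from knowing each sample time only up to its window. For |t|
    >= 1, d + 1 <= 16 |t| turns the constant 32 into 64; for |t| < 1 the trivial bound 2 is
    enough. *)
Lemma normc_kernel_wt (t : R) (m : int) (d : nat) :
  d%:R <= `|t| + 1 -> normc (kernel t m) <= 64 * wt d.
Proof.
move=> dt; have d0 : 0 < root4 (d.+1%:R : R) by rewrite root4_gt0.
have d2 (x : R) : 0 <= x -> d.+1%:R <= x ^+ 4 -> root4 (d.+1%:R : R) <= x.
  by move=> x0 h; rewrite -(@ler_pXn2r _ 4) ?nnegrE ?root4_ge0// root4K.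
have d1 : (d.+1%:R : R) = d%:R + 1 by rewrite -natr1.
have [t1|t1] := leP 1 `|t|.
  have s1 : 1 <= root4 `|t|.
    by rewrite -(@ler_pXn2r _ 4) ?nnegrE ?root4_ge0// root4K// expr1n.
  have tE : `|t| = root4 `|t| ^+ 4 by rewrite root4K.
  apply: le_trans (normc_kernel_decay m s1 tE) _.
  have t0 : 0 < root4 `|t| by apply: lt_le_trans s1.
  rewrite /wt ler_pdivrMr// mulrAC ler_pdivlMr//.
  have : root4 d.+1%:R <= 2 * root4 `|t|.
    apply: d2; first by rewrite mulr_ge0// root4_ge0.
    by rewrite exprMn -tE d1; lra.
  by lra.
apply: le_trans (normc_kernel_le2 t m) _.
rewrite /wt ler_pdivlMr//.
have : root4 (d.+1%:R : R) <= 2 by apply: d2 => //; rewrite d1; lra.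
by lra.
Qed.

Definition separated (J : nat) t := forall j l, (j < J)%N -> (l < J)%N ->
  `|j - l|%N%:R <= `|t j - t l| + 1.

(** The dual homogeneous estimate, from l^(8/7) over the samples to l^2. The constant comes from 64
    * 56 <= 60 ^ 2. *)
Lemma sampled_bessel J t m (a : nat -> R[i]) (p : nat -> R) (P : R) s :
  separated J t -> uniq s -> 0 < P -> (forall j, 0 <= p j) ->
  (forall j, normc (a j) <= p j ^+ 7) -> \sum_(0 <= j < J) p j ^+ 8 <= P ^+ 8 ->
  \sum_(n <- s) normc (\sum_(0 <= j < J) a j * kernel (t j) (m j - n)) ^+ 2 <=
  (60 * P ^+ 7) ^+ 2.
Proof.
move=> sep us P0 p0 ap pP; apply: le_trans (kernel_bessel_normc _ _ _ _ us) _.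
have h := discrete_hls P0 P0 p0 p0 pP pP.
apply: (@le_trans _ _ (64 * (56 * P ^+ 7 * P ^+ 7))); last first.
  rewrite exprMn (_ : 64 * _ = 64 * 56 * (P ^+ 7) ^+ 2); last by ring.
  by apply: ler_wpM2r; [exact: sqr_ge0|lra].
apply: le_trans (ler_wpM2l _ h) => //.
rewrite mulr_sumr; apply: ler_sum_nat => j /andP[_ jJ].
rewrite mulr_sumr; apply: ler_sum_nat => l /andP[_ lJ].
rewrite mulrCA; apply: ler_pM; rewrite ?mulr_ge0 ?normc_ge0//.
  by apply: ler_pM; rewrite ?normc_ge0.
exact/normc_kernel_wt/sep.
Qed.

Definition evolve s (psi : int -> R[i]) (t : R) (k : int) : R[i] :=
  \sum_(n <- s) psi n * kernel t (n - k).

(** With all times equal, the quadratic form in [kernel_bessel] collapses to its diagonal. *)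
Lemma evolve_l2 s s' (psi : int -> R[i]) (t Y : R) : uniq s -> uniq s' ->
  \sum_(n <- s) normc (psi n) ^+ 2 <= Y ^+ 2 ->
  \sum_(k <- s') normc (evolve s psi t k) ^+ 2 <= Y ^+ 2.
Proof.
move=> us us' psiY.
apply: le_trans (kernel_bessel s psi (fun=> t) id us') _.
apply: le_trans psiY; rewrite Re_sum le_eqVlt; apply/orP; left; apply/eqP.
apply: eq_big_seq => n ns; rewrite (bigD1_seq n)//= big1 ?addr0.
  by rewrite !subrr kernel0 eqxx mulr1 mulc_conjc.
by move=> l ln; rewrite subrr kernel0 subr_eq0 eq_sym (negbTE ln) mulr0.
Qed.

Lemma pow8_root (S : R) : 0 <= S -> exists2 P, 0 <= P & P ^+ 8 = S.
Proof.
move=> S0; exists (root4 (Num.sqrt S)); first exact: root4_ge0.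
by rewrite (_ : 8 = 4 * 2)%N// exprM root4K ?sqrtr_ge0// sqr_sqrtr.
Qed.

(** Closes the duality arguments: a sum S of eighth powers is tested against seventh powers of its
    own terms, and P ^ 7 is divided out. When S = 0 there is nothing to divide by. *)
Lemma pow8_absorb (S c : R) : 0 <= S -> 0 <= c ->
  (forall P, 0 < P -> P ^+ 8 = S -> S <= c * P ^+ 7) -> S <= c ^+ 8.
Proof.
move=> S0 c0 h; have [P P0 PS] := pow8_root S0.
move: P0; rewrite le_eqVlt => /predU1P[P0|P0].
  by rewrite -PS -P0 expr0n exprn_ge0.
rewrite -PS lerXn2r ?nnegrE ?(ltW P0)//.
by have := h P P0 PS; rewrite -PS (exprS P 7) ler_pM2r// exprn_gt0.
Qed.

Lemma evolve_sampled J t m s psi (Y : R) :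
  separated J t -> uniq s -> 0 <= Y ->
  \sum_(n <- s) normc (psi n) ^+ 2 <= Y ^+ 2 ->
  \sum_(0 <= j < J) normc (evolve s psi (t j) (m j)) ^+ 8 <= (60 * Y) ^+ 8.
Proof.
move=> sep us Y0 psiY; pose b j := evolve s psi (t j) (m j).
apply: pow8_absorb.
- by apply: sumr_ge0 => j _; rewrite exprn_ge0// normc_ge0.
- by rewrite mulr_ge0.
(* The extremal sequence of the duality between l^8 and l^(8/7): a_j b_j = |b_j| ^ 8 and |a_j| =
   |b_j| ^ 7. *)
move=> P P0 PS; pose a j := (b j)^*%C * ((normc (b j) ^+ 6)%:C).
have na j : normc (a j) = normc (b j) ^+ 7.
  by rewrite normcM normc_conjc normc_real ger0_norm ?exprn_ge0 ?normc_ge0// -exprS.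
have -> : \sum_(0 <= j < J) normc (b j) ^+ 8 =
    complex.Re (\sum_(n <- s) psi n * \sum_(0 <= j < J) a j * kernel (t j) (m j - n)).
  transitivity (complex.Re (\sum_(0 <= j < J) a j * b j)).
    rewrite Re_sum; apply: eq_bigr => j _.
    rewrite /a mulrAC [_^*%C * _]mulrC mulc_conjc -rmorphM /=.
    by rewrite -exprD.
  congr complex.Re.
  transitivity (\sum_(0 <= j < J) \sum_(n <- s) psi n * (a j * kernel (t j) (m j - n))).
    apply: eq_bigr => j _; rewrite /b /evolve mulr_sumr; apply: eq_bigr => n _.
    by rewrite -[in RHS]kernelNr opprB; ring.
  by rewrite exchange_big /=; apply: eq_bigr => n _; rewrite mulr_sumr.
apply: le_trans (ler_norm _) _; apply: le_trans (Re_le_normc _) _.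
apply: le_trans (normc_sum _ _) _.
under eq_bigr do rewrite normcM.
rewrite mulrAC mulrC; apply: cauchy_schwarz => //.
  by rewrite mulr_ge0// exprn_ge0// ltW.
apply: (@sampled_bessel _ _ _ _ (fun j => normc (b j))) => //.
- by move=> j; exact: normc_ge0.
- by move=> j; rewrite na.
- by rewrite PS.
Qed.

End SampledStrichartz.

(** * Absolutely continuous functions *)

Section Cousin.
Context {R : realType}.
Notation mu := (@lebesgue_measure R).
Implicit Types (a b c x y z : R) (f g : R -> R).

(** The local hypothesis at the supremum c of the points reachable from a would carry beyond c
    unless c = b. This is the form of compactness used both for absolutely continuous functions and
    for the local boundedness of u in l^2. *)
Lemma cousin (P : R -> R -> Prop) a b : a <= b ->
  (forall x y z, a <= x -> x <= y -> y <= z -> z <= b ->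
     P x y -> P y z -> P x z) ->
  (forall x, a <= x <= b -> exists2 r, 0 < r & forall y z, a <= y -> y <= x ->
     x <= z -> z <= b -> x - r < y -> z < x + r -> P y z) ->
  P a b.
Proof.
move=> ab trans loc; pose S := [set x | a <= x <= b /\ P a x].
have Sa : S a.
  split; first by rewrite lexx.
  have [|r r0 H] := loc a; first by rewrite lexx.
  by apply: H => //; rewrite ?ltrBlDr ltrDl.
have Sub : has_ubound S by exists b => x [/andP[]].
have Ssup : has_sup S by split=> //; exists a.
pose c := sup S.
have ac : a <= c by exact: ub_le_sup.
have cb : c <= b by apply: ge_sup; [exists a|move=> x [/andP[]]].
have [|r r0 H] := loc c; first by rewrite ac.
have [s [/andP[as_ sb] Ps] cs] := sup_adherent r0 Ssup.
have sc : s <= c by apply: ub_le_sup => //; split=> //; rewrite as_.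
suff -> : b = c.
  apply: (trans a s c) => //; apply: H => //.
  by rewrite ltrDl.
apply/eqP; rewrite eq_le cb andbT leNgt; apply/negP => cltb.
pose z := Num.min b (c + r / 2).
have cz : c < z by rewrite lt_min cltb ltrDl divr_gt0.
have zb : z <= b by rewrite ge_min lexx.
have Sz : S z.
  split; first by rewrite zb (le_trans ac (ltW cz)).
  apply: (trans a s z) => //; first exact: le_trans (ltW cz).
  apply: H => //; first exact: ltW.
  by rewrite gt_min ltrD2l ltr_pdivrMr// ltr_pMr// ltr1n orbT.
by have := ub_le_sup Sub Sz; rewrite leNgt cz.
Qed.

Lemma is_derive_local f x (d e : R) : is_derive x 1 f d -> 0 < e ->
  exists2 r, 0 < r & forall w, `|w - x| < r ->
    `|f w - f x - (w - x) * d| <= e * `|w - x|.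
Proof.
move=> [df dE] e0.
have : h^-1 *: (f (h *: 1 + x) - f x) @[h --> 0^'] --> d.
  by move: df => /cvg_ex[l hl]; rewrite -dE /derive (cvg_lim _ hl).
move=> /cvgrPdist_le /(_ e e0) [r /= r0 H]; exists r => // w wr.
have [->|wx] := eqVneq w x; first by rewrite !subrr mul0r subr0 !normr0 mulr0.
have wx0 : w - x != 0 by rewrite subr_eq0.
have := H (w - x); rewrite /= sub0r normrN => /(_ wr wx0).
rewrite /GRing.scale /= mulr1 subrK => h.
have -> : f w - f x - (w - x) * d = - (w - x) * (d - (w - x)^-1 * (f w - f x)).
  by field.
by rewrite normrM normrN mulrC ler_wpM2r.
Qed.

(** Lists of intervals replace the families indexed by ordinals of [abs_continuous], because the
    gluing step of [cousin] concatenates them. *)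
Definition rabs_continuous a b f := forall e : R, 0 < e ->
  exists2 d : R, 0 < d & forall s : seq (R * R),
    (forall p, p \in s -> [/\ a <= p.1, p.1 <= p.2 & p.2 <= b]) ->
    pairwise (fun p q => p.2 <= q.1) s ->
    \sum_(p <- s) (p.2 - p.1) < d ->
    \sum_(p <- s) `|f p.2 - f p.1| < e.

(** Let F be the primitive of g and H = f - F - eps x. The points where a derivative is missing or
    too large lie in an open set U of small measure. Around a point outside U, H does not increase;
    inside U it grows at most as much as f, and the total variation of f over the intervals spent
    there is below eps by absolute continuity. *)
Lemma ac_le_integral f g a b : a <= b -> rabs_continuous a b f ->
  (forall x, 0 <= g x) -> mu.-integrable `[a, b] (EFin \o g) ->
  {ae mu, forall t, a < t < b -> exists2 d, is_derive t 1 f d & d <= g t} ->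
  f b - f a <= \int[mu]_(t in `[a, b]) g t.
Proof.
move=> ab acf g0 intg aeD; pose G := g \_ `[a, b].
have G0 x : 0 <= G x by rewrite /G patchE; case: ifP.
have intG : mu.-integrable setT (EFin \o G).
  by rewrite -restrict_EFin; apply/integrable_restrict => //=; rewrite setTI.
have intG' (A : set R) : measurable A -> mu.-integrable A (EFin \o G).
  by move=> mA; exact: integrableS intG.
pose F x := \int[mu]_(t in `[a, x]) G t.
have Fmono y z : a <= y -> y <= z -> F y <= F z.
  move=> ay yz; rewrite -subr_ge0 /F (@Rintegral_itvB _ _ (BLeft a) (BRight z) y);
    rewrite ?bnd_simp//; last exact: intG'.
  by apply: Rintegral_ge0.
have Fa : F a = 0.
  by rewrite /F set_itv1 Rintegral_set1.
have Fb : F b = \int[mu]_(t in `[a, b]) g t.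
  by apply: eq_Rintegral => x xab; rewrite /G patchE xab.
have aeF : {ae mu, forall x, a < x -> is_derive x 1 F (G x)}.
  have locG : locally_integrable [set: R] G.
    exact: integrable_locally.
  have := @FTC1 _ G (BLeft a) (fun y => intG' _ (measurable_itv _)) locG.
  apply: filterS; first exact: (ae_filter_ringOfSetsType mu).
  move=> x H ax.
  have aX : (a%:E < x%:E)%E by rewrite lte_fin.
  have [dF <-] := H aX; rewrite derive1E; exact: DeriveDef.
apply/ler_addgt0Pr => e e0.
suff main (eps : R) : 0 < eps -> f b - f a <= F b - F a + eps * (b - a) + eps.
  have b0 : 0 < b - a + 1 by rewrite ltr_wpDl ?subr_ge0.
  have := main (e / (b - a + 1)); rewrite divr_gt0// => /(_ isT) h.
  apply: le_trans h _; rewrite Fa subr0 Fb -addrA lerD2l.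
  by rewrite le_eqVlt; apply/orP; left; apply/eqP; field; rewrite gt_eqF.
move=> eps0; have [d d0 Hd] := acf eps eps0.
have [A [mA muA0 subA]] : exists A : set R, [/\ measurable A, mu A = 0%E &
    (([set a] `|` [set b]) `|`
    (~` [set t | a < t < b -> exists2 d, is_derive t 1 f d & d <= g t] `|`
    ~` [set t | a < t -> is_derive t 1 F (G t)]) : set R) `<=` A].
  suff [A [mA muA0 subA]] : mu.-negligible (([set a] `|` [set b]) `|`
    (~` [set t | a < t < b -> exists2 d, is_derive t 1 f d & d <= g t] `|`
    ~` [set t | a < t -> is_derive t 1 F (G t)]) : set R).
    by exists A; split => //; exact: muA0.
  apply: negligibleU; last exact: negligibleU.
  by apply: negligibleU; apply/negligibleP => //; exact: lebesgue_measure_set1.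
have [U [oU AU muU]] : exists U : set R, [/\ open U, A `<=` U & (mu U < d%:E)%E].
  have Afin : (mu A < +oo)%E by rewrite muA0 ltry.
  have [U [oU AU UA]] := @lebesgue_regularity_outer R A d mA Afin d0.
  exists U; split => //; rewrite -(setDUK AU) measureU//.
  - have UA' : (mu A + mu (U `\` A) < d%:E)%E by rewrite muA0 add0e.
    exact: UA'.
  - by apply: measurableD => //; exact: open_measurable.
  - by rewrite setDE setICA setICr setI0.
have mU (y z : R) : measurable (U `&` `[y, z[%classic).
  by apply: measurableI => //; exact: open_measurable.
pose H x := f x - F x - eps * x.
(* The list [s] records the intervals spent inside [U]. Half-open intervals make their share of the
   measure of [U] additive under concatenation. *)
pose P y z := exists s : seq (R * R), [/\
  forall p, p \in s -> [/\ y <= p.1, p.1 <= p.2 & p.2 <= z],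
  pairwise (fun p q => p.2 <= q.1) s,
  ((\sum_(p <- s) (p.2 - p.1))%:E <= mu (U `&` `[y, z[%classic))%E &
  H z - H y <= \sum_(p <- s) `|f p.2 - f p.1|].
have [s [sab spw smu sH]] : P a b.
  apply: cousin => //.
    move=> x y z ax xy yz zb [s [sab spw smu sH]] [s' [sab' spw' smu' sH']].
    exists (s ++ s'); split.
    - move=> p; rewrite mem_cat => /orP[/sab[? ? py]|/sab'[yp ? ?]]; split => //.
        exact: le_trans yz.
      exact: le_trans yp.
    - rewrite pairwise_cat spw spw' !andbT; apply/allrelP => p q /sab[_ _ py] /sab'[yq _ _].
      exact: le_trans yq.
    - rewrite big_cat /= EFinD.
      have -> : U `&` `[x, z[%classic = (U `&` `[x, y[%classic) `|` (U `&` `[y, z[%classic).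
        by rewrite -setIUr -itv_bndbnd_setU// bnd_simp.
      rewrite measureU; [exact: leeD|exact: mU|exact: mU|].
      rewrite -setIIr (_ : `[x, y[%classic `&` `[y, z[%classic = set0) ?setI0//.
      rewrite -subset0 => w /=; rewrite !in_itv/= => -[/andP[_ wy] /andP[yw _]].
      by move: wy; rewrite ltNge yw.
    - rewrite big_cat /=; lra.
  (* For x in [U] the interval itself is recorded, and [F] being nondecreasing only helps; for x
     outside [U] the list is empty. *)
  move=> x /andP[ax xb]; have [Ux|Ux] := pselect (U x).
    have [r r0 xr] : exists2 r : R, 0 < r & ball x r `<=` U.
      by move: oU => /(_ x Ux) /nbhs_ballP[r r0 h]; exists r.
    exists r => // y z ay yx xz zb yr zr; exists [:: (y, z)]; split.
    - by move=> p; rewrite inE => /eqP -> /=; rewrite lexx (le_trans yx xz).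
    - by [].
    - rewrite big_seq1 /= (_ : U `&` _ = `[y, z[%classic).
        rewrite lebesgue_measure_itv/= lte_fin; case: ltP => // zy.
        by rewrite lee_fin subr_le0.
      apply/setIidr => w /=; rewrite in_itv/= => /andP[yw wz]; apply: xr.
      by rewrite /ball/= ltr_norml; lra.
    - rewrite big_seq1 /=; have := Fmono y z ay (le_trans yx xz).
      have := ler_norm (f z - f y); have : 0 <= eps * (z - y).
        by rewrite mulr_ge0 ?(ltW eps0)// subr_ge0 (le_trans yx).
      rewrite /H; lra.
  have nAx : ~ A x by move=> /AU.
  have xa : x != a by apply/eqP => xa; apply/nAx/subA; left; left.
  have xb' : x != b by apply/eqP => xb'; apply/nAx/subA; left; right.
  have ltax : a < x by rewrite lt_def xa.
  have ltxb : x < b by rewrite lt_def eq_sym xb'.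
  have [|D dfD Dg] : a < x < b -> exists2 d, is_derive x 1 f d & d <= g x.
    by apply: contrapT => h; apply/nAx/subA; right; left.
    by rewrite ltax.
  have dF : is_derive x 1 F (G x).
    have h : a < x -> is_derive x 1 F (G x).
      by apply: contrapT => h; apply/nAx/subA; right; right.
    exact: h.
  have Gx : G x = g x by rewrite /G patchE ifT// inE/= in_itv/= ax.
  have dH : is_derive x 1 H (D - G x - eps).
    apply: is_derive_eq (derB (derB dfD dF) (derMl eps (is_derive_id x 1))) _.
    by rewrite mulr1.
  (* The error [eps] of the linear approximation is absorbed by the term - eps x of [H]. *)
  have [r r0 hr] := is_derive_local dH eps0.
  exists r => // y z ay yx xz zb yr zr; exists [::]; split => //.
    by rewrite big_nil measure_ge0.
  rewrite big_nil.
  have h1 : H z - H x <= 0.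
    have := hr z; rewrite [`|z - x|]ger0_norm ?subr_ge0// => /(_ _).
    rewrite ltrBlDl => /(_ zr); rewrite ler_norml => /andP[_].
    have : (z - x) * (D - G x) <= 0 by rewrite mulr_ge0_le0 ?subr_ge0// Gx subr_le0.
    by lra.
  have h2 : H x - H y <= 0.
    have := hr y; rewrite [`|y - x|]distrC [`|x - y|]ger0_norm ?subr_ge0// => /(_ _).
    rewrite ltrBlDl -ltrBlDr => /(_ yr); rewrite ler_norml => /andP[+ _].
    have : (x - y) * (D - G x) <= 0 by rewrite mulr_ge0_le0 ?subr_ge0// Gx subr_le0.
    by lra.
  by lra.
have hs : \sum_(p <- s) `|f p.2 - f p.1| < eps.
  apply: Hd => //; rewrite -lte_fin; apply: le_lt_trans smu _.
  apply: le_lt_trans muU; apply: le_measure; rewrite ?inE//; first exact: mU.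
  exact: open_measurable.
by move: sH hs; rewrite /H; lra.
Qed.

End Cousin.

Section AbsoluteContinuity.
Context {R : realType}.
Implicit Types (a b : R) (f h : R -> R[i]).

Lemma abs_continuous_dominated a b f h (L : R) : 0 <= L ->
  (forall x y, a <= x -> x <= y -> y <= b ->
     normc (h y - h x) <= L * (normc (f y - f x) + (y - x))) ->
  abs_continuous a b f -> abs_continuous a b h.
Proof.
move=> L0 hf acf e e0.
have c0 : 0 < e / (2 * (L + 1)) by rewrite divr_gt0// mulr_gt0// ltr_wpDl.
have [d d0 Hd] := acf _ c0.
exists (Num.min d (e / (2 * (L + 1)))); first by rewrite lt_min d0.
move=> k x y xy ord; rewrite lt_min => /andP[sd se].
apply: (@le_lt_trans _ _ (\sum_(j < k) L * (normc (f (y j) - f (x j)) + (y j - x j)))).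
  by apply: ler_sum => j _; have [ax xyj yb] := xy j; exact: hf.
rewrite -mulr_sumr big_split /=.
apply: (@le_lt_trans _ _ (L * (e / (2 * (L + 1)) + e / (2 * (L + 1))))).
  by rewrite ler_wpM2l// lerD// ltW//; exact: Hd.
have -> : L * (e / (2 * (L + 1)) + e / (2 * (L + 1))) = e * (L / (L + 1)).
  by field; rewrite !gt_eqF// ltr_wpDl.
by rewrite gtr_pMr// ltr_pdivrMr ?mul1r ?ltrDl// ltr_wpDl.
Qed.

Lemma abs_continuous_sum (I : Type) (r : seq I) a b (h : I -> R -> R[i]) :
  (forall i, abs_continuous a b (h i)) ->
  abs_continuous a b (fun t => \sum_(i <- r) h i t).
Proof.
move=> ach; elim: r => [|i r IH] e e0.
  exists 1 => // k x y _ _ _; rewrite big1// => j _.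
  by rewrite !big_nil subrr normc0.
have e2 : 0 < e / 2 by rewrite divr_gt0.
have [d1 d10 H1] := ach i _ e2; have [d2 d20 H2] := IH _ e2.
exists (Num.min d1 d2); first by rewrite lt_min d10.
move=> k x y xy ord; rewrite lt_min => /andP[s1 s2].
apply: (@le_lt_trans _ _ (\sum_(j < k) normc (h i (y j) - h i (x j)) +
  \sum_(j < k) normc (\sum_(i <- r) h i (y j) - \sum_(i <- r) h i (x j)))).
  rewrite -big_split /=; apply: ler_sum => j _; rewrite !big_cons.
  by rewrite opprD addrACA le_normcD.
by rewrite [ltRHS]splitr ltrD// ?H1 ?H2.
Qed.

Lemma abs_continuous_Re a b h : abs_continuous a b h ->
  rabs_continuous a b (fun t => complex.Re (h t)).
Proof.
move=> ach e e0; have [d d0 Hd] := ach e e0; exists d => // s sab spw.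
rewrite (big_nth (0, 0)) big_mkord => sd.
rewrite (big_nth (0, 0)) big_mkord.
apply: le_lt_trans (Hd (size s) (fun j => (nth (0, 0) s j).1)
  (fun j => (nth (0, 0) s j).2) _ _ sd).
- apply: ler_sum => j _; rewrite -Re_opp -Re_add; exact: Re_le_normc.
- by move=> j; apply: sab; exact: mem_nth.
- by move=> j l jl; apply: (pairwiseP (0, 0) spw); rewrite ?inE.
Qed.

Lemma abs_continuousS a b a' b' h : a <= a' -> b' <= b ->
  abs_continuous a b h -> abs_continuous a' b' h.
Proof.
move=> aa bb ach e e0; have [d d0 Hd] := ach e e0; exists d => // k x y xy.
apply: Hd => j; have [ax xj yb] := xy j; split => //; first exact: le_trans ax.
exact: le_trans bb.
Qed.

End AbsoluteContinuity.

(** * Pairing with the adjoint equation *)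

Section FiniteWindows.
Context {V : zmodType}.
Implicit Types (f : int -> V) (n : nat).

Definition zs n : seq int := [seq i%:Z - n%:Z | i <- iota 0 n.*2.+1].

Lemma mem_zs n (m : int) : (m \in zs n) = (`|m| <= n)%N.
Proof.
apply/mapP/idP => [ [i hi ->] | mn ].
  by move: hi; rewrite mem_iota => /andP[_ h]; lia.
by exists (absz (m + n%:Z)); rewrite ?mem_iota; lia.
Qed.

Lemma uniq_zs n : uniq (zs n).
Proof.
rewrite map_inj_uniq ?iota_uniq// => i j; lia.
Qed.

Lemma sum_zs_shift f n :
  \sum_(m <- zs n) f (m + 1) = \sum_(m <- zs n) f m + f (n%:Z + 1) - f (- n%:Z).
Proof.
rewrite /zs !big_map -[n.*2.+1]subn0 -/(index_iota 0 n.*2.+1).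
pose g i := f (i%:Z - n%:Z).
have E : \sum_(0 <= i < n.*2.+1) g i.+1 - \sum_(0 <= i < n.*2.+1) g i =
    g n.*2.+1 - g 0%N by rewrite -sumrB telescope_sumr.
have -> : \sum_(0 <= i < n.*2.+1) f (i%:Z - n%:Z + 1) = \sum_(0 <= i < n.*2.+1) g i.+1.
  by apply: eq_bigr => i _; rewrite /g; congr f; lia.
have g1 : g n.*2.+1 = f (n%:Z + 1) by rewrite /g; congr f; lia.
have g2 : g 0%N = f (- n%:Z) by rewrite /g; congr f; lia.
rewrite -g1 -g2 -addrA -E addrC subrK; first by [].
Qed.

(** Summation by parts on a finite window: the vanishing near both ends removes the boundary
    terms. *)
Lemma sum_zs_shift0 f n (d : nat) : (forall m, (n < `|m| + d)%N -> f m = 0) ->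
  \sum_(m <- zs n) f (m + d%:Z) = \sum_(m <- zs n) f m.
Proof.
elim: d f => [|d IH] f f0; first by apply: eq_bigr => m _; rewrite addr0.
have := IH (fun m => f (m + 1)).
have -> : \sum_(m <- zs n) f (m + d%:Z + 1) = \sum_(m <- zs n) f (m + d.+1%:Z).
  by apply: eq_bigr => m _; congr f; lia.
move=> -> => [|m hm]; last by apply: f0; lia.
rewrite sum_zs_shift (f0 (n%:Z + 1)); last by lia.
by rewrite (f0 (- n%:Z)) ?subr0 ?addr0//; lia.
Qed.

End FiniteWindows.

Section Tent.
Context {R : realType}.
Implicit Types (N : nat) (m : int).

Definition tent N m : R := Num.max 0 (1 - `|m|%N%:R / N%:R).

Lemma tent_ge0 N m : 0 <= tent N m.
Proof. by rewrite le_max lexx. Qed.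

Lemma tent_le1 N m : tent N m <= 1.
Proof. by rewrite ge_max ler01/= gerBl divr_ge0. Qed.

Lemma tent_out N m : (0 < N)%N -> (N <= `|m|)%N -> tent N m = 0.
Proof.
move=> N0 Nm; apply/max_idPl.
by rewrite subr_le0 ler_pdivlMr ?ltr0n// mul1r ler_nat.
Qed.

Lemma tent_ge N m (M : nat) : (`|m| <= M)%N -> 1 - M%:R / N%:R <= tent N m.
Proof.
move=> mM; rewrite le_max; apply/orP; right; rewrite lerD2l lerN2.
by rewrite ler_wpM2r ?invr_ge0// ler_nat.
Qed.

Lemma tent_lipschitz N m (d : nat) : `|tent N m - tent N (m + d%:Z)| <= d%:R / N%:R.
Proof.
have h : `|(1 - `|m|%N%:R / N%:R) - (1 - (absz (m + d%:Z))%:R / N%:R)| <= d%:R / N%:R :> R.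
  rewrite (_ : _ - _ = ((absz (m + d%:Z))%:R - `|m|%N%:R) / N%:R); last by ring.
  rewrite normrM [`|_^-1|]ger0_norm ?invr_ge0//.
  rewrite ler_wpM2r ?invr_ge0// ler_norml lerBrDr lerBlDr addrC lerBlDr -!natrD !ler_nat.
  by apply/andP; split; lia.
apply: le_trans h; rewrite /tent.
move: (1 - _) (1 - _) => x y.
by case: (leP 0 x) => h1; case: (leP 0 y) => h2; rewrite ?subrr ?normr0//;
  rewrite ler_norml; have := ler_norm (x - y); have := ler_norm (y - x);
  rewrite [`|y - x|]distrC; lra.
Qed.

End Tent.

Section Commutator.
Context {R : realType}.
Implicit Types (k u : int -> R[i]) (Y B : R).

(** For Y >= 0, a bound by Y on the l^2 norm, put in terms of finite partial sums so that every
    rearrangement is finite. *)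
Definition l2_bounded (phi : int -> R[i]) (Y : R) := forall s : seq int, uniq s ->
  \sum_(m <- s) normc (phi m) ^+ 2 <= Y ^+ 2.

Lemma l2_bounded_shift phi Y (d : int) : l2_bounded phi Y ->
  l2_bounded (fun m => phi (m + d)) Y.
Proof.
move=> h s us; have := h [seq m + d | m <- s]; rewrite big_map; apply.
by rewrite map_inj_uniq// => x y /addIr.
Qed.

Lemma l2_bounded_normc phi Y m : 0 <= Y -> l2_bounded phi Y -> normc (phi m) <= Y.
Proof.
move=> Y0 h; have := h [:: m] isT; rewrite big_seq1.
by rewrite ler_pXn2r ?nnegrE ?normc_ge0.
Qed.

(** The bracket is a discrete divergence: the two-step difference of [W 2] minus four times the
    one-step difference of [W 1]. Summation by parts moves the differences to the tent, where a step
    d costs d / N, and Cauchy-Schwarz gives 2 Y B; hence 12 = 4 + 4 * 2. The window exceeds the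
    support of the tent by the largest step, 2. *)
Lemma commutator_bound k u Y B N : (0 < N)%N -> 0 <= Y -> 0 <= B ->
  l2_bounded k Y -> l2_bounded u B ->
  normc (\sum_(m <- zs N.+2) (tent N m)%:C *
    (dbilaplacian k m * u m - k m * dbilaplacian u m)) <= 12 * Y * B / N%:R.
Proof.
move=> N0 Y0 B0 kY uB.
pose W (d : nat) m := k (m + d%:Z) * u m - k m * u (m + d%:Z).
pose T d := \sum_(m <- zs N.+2) (tent N m)%:C * (W d m - W d (m - d%:Z)).
have TE d : (d <= 2)%N -> T d =
    \sum_(m <- zs N.+2) (tent N m - tent N (m + d%:Z))%:C * W d m.
  move=> d2; rewrite /T.
  under eq_bigr do rewrite mulrBr.
  rewrite sumrB -(@sum_zs_shift0 _ (fun m => (tent N m)%:C * W d (m - d%:Z)) N.+2 d).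
    rewrite -sumrB; apply: eq_bigr => m _.
    by rewrite addrK rmorphB /= mulrBl.
  by move=> m hm; rewrite tent_out ?mul0r//; lia.
have Tb d : (d <= 2)%N -> normc (T d) <= d%:R / N%:R * (2 * Y * B).
  move=> d2; rewrite TE//; apply: le_trans (normc_sum _ _) _.
  apply: (@le_trans _ _ (\sum_(m <- zs N.+2) d%:R / N%:R *
      (normc (k (m + d%:Z)) * normc (u m) + normc (k m) * normc (u (m + d%:Z))))).
    apply: ler_sum => m _; rewrite normcM normc_real.
    apply: ler_pM => //; [exact: normc_ge0|exact: tent_lipschitz|].
    by apply: le_trans (le_normcD _ _) _; rewrite normcN !normcM.
  rewrite -mulr_sumr ler_wpM2l ?divr_ge0// big_split /=.
  rewrite (_ : 2 * Y * B = Y * B + Y * B); last by ring.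
  by apply: lerD; apply: cauchy_schwarz => //; try apply: l2_bounded_shift => //;
    try exact: uniq_zs; try exact/kY/uniq_zs; exact/uB/uniq_zs.
rewrite (_ : \sum_(m <- _) _ = T 2 - 4 * T 1%N).
  apply: le_trans (le_normcD _ _) _; rewrite normcN normcM.
  have -> : normc (4 : R[i]) = 4.
    have -> : (4 : R[i]) = (4 : R)%:C by rewrite rmorph_nat.
    by rewrite normc_real ger0_norm.
  have h2 := Tb 2 isT; have h1 := Tb 1%N isT.
  have e2 : 2%:R / N%:R * (2 * Y * B) = 4 * Y * B / N%:R :> R by ring.
  have e1 : 1%:R / N%:R * (2 * Y * B) = 2 * Y * B / N%:R :> R by ring.
  have e3 : 12 * Y * B / N%:R = 4 * Y * B / N%:R + 4 * (2 * Y * B / N%:R) by ring.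
  rewrite e2 in h2; rewrite e1 in h1; rewrite e3; lra.
rewrite /T mulr_sumr -sumrB; apply: eq_bigr => m _.
rewrite !dbilaplacianE /W !subrK.
by ring.
Qed.

End Commutator.

Section ComplexDerivative.
Context {R : realType}.
Implicit Types (f g : R -> R[i]) (t : R) (a b c : R[i]).

Lemma cderM f g t a b : is_cderive f t a -> is_cderive g t b ->
  is_cderive (fun s => f s * g s) t (a * g t + f t * b).
Proof.
move=> [fr fi] [gr gi]; split.
  rewrite (_ : (fun s => _) = fun s => complex.Re (f s) * complex.Re (g s) -
    complex.Im (f s) * complex.Im (g s)); last by apply/funext => s; rewrite Re_mul.
  by apply: is_derive_eq (derB (derM fr gr) (derM fi gi)) _;
    rewrite Re_add !Re_mul; ring.
rewrite (_ : (fun s => _) = fun s => complex.Re (f s) * complex.Im (g s) +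
    complex.Im (f s) * complex.Re (g s)); last by apply/funext => s; rewrite Im_mul.
by apply: is_derive_eq (derD (derM fr gi) (derM fi gr)) _;
  rewrite Im_add !Im_mul; ring.
Qed.

Lemma cderC c t : is_cderive (fun=> c) t 0.
Proof. by split; exact: derC. Qed.

Lemma cderMl c f t a : is_cderive f t a -> is_cderive (fun s => c * f s) t (c * a).
Proof. by move=> h; have := cderM (cderC c t) h; rewrite mul0r add0r. Qed.

Lemma cderD f g t a b : is_cderive f t a -> is_cderive g t b ->
  is_cderive (fun s => f s + g s) t (a + b).
Proof.
move=> [fr fi] [gr gi]; split.
  rewrite (_ : (fun s => _) = fun s => complex.Re (f s) + complex.Re (g s)).
    by rewrite Re_add; exact: derD.
  by apply/funext => s; rewrite Re_add.
rewrite (_ : (fun s => _) = fun s => complex.Im (f s) + complex.Im (g s)).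
  by rewrite Im_add; exact: derD.
by apply/funext => s; rewrite Im_add.
Qed.

Lemma cder_sum (I : Type) (r : seq I) (f : I -> R -> R[i]) t (a : I -> R[i]) :
  (forall i, is_cderive (f i) t (a i)) ->
  is_cderive (fun s => \sum_(i <- r) f i s) t (\sum_(i <- r) a i).
Proof.
move=> h; elim: r => [|i r IH].
  rewrite (_ : (fun s => _) = fun=> 0) ?big_nil; first exact: cderC.
  by apply/funext => s; rewrite big_nil.
rewrite (_ : (fun s => _) = fun s => f i s + \sum_(j <- r) f j s) ?big_cons.
  exact: cderD.
by apply/funext => s; rewrite big_cons.
Qed.

Lemma is_cderive_Re f t a : is_cderive f t a ->
  is_derive t 1 (fun s => complex.Re (f s)) (complex.Re a).
Proof. by case. Qed.

Lemma is_cderive_kernelB (T t : R) (m : int) :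
  is_cderive (fun s => kernel (T - s) m) t ('i%C * dbilaplacian (kernel (T - t)) m).
Proof.
have [hr hi] := is_cderive_kernel (T - t) m.
have hB : is_derive t 1 (fun s => T - s) (-1).
  by apply: is_derive_eq (derB (derC T t) (is_derive_id t 1)) _; rewrite sub0r.
split.
  apply: is_derive_eq (@is_derive1_comp _ (fun s => complex.Re (kernel s m))
    (fun s => T - s) t _ _ hr hB) _.
  by rewrite mulNr Re_opp mulrNN mulr1.
apply: is_derive_eq (@is_derive1_comp _ (fun s => complex.Im (kernel s m))
  (fun s => T - s) t _ _ hi hB) _.
by rewrite mulNr Im_opp mulrNN mulr1.
Qed.

Lemma kern_lipschitz (c s t : R) (m : int) : s <= t ->
  `|kern c t m - kern c s m| <= 16 * (t - s).
Proof.
move=> st.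
have D x : `|rbilap (kern (c + pi / 2) x) m| <= 16.
  have h n := kern_le1 (c + pi / 2) x n.
  rewrite /rbilap; move: (h (m + 2)) (h (m - 2)) (h (m + 1)) (h (m - 1)) (h m).
  by rewrite !ler_norml; lra.
have h1 : 16 * s - kern c s m <= 16 * t - kern c t m.
  apply: (@derive_ge0_le _ (fun x => 16 * x - kern c x m)
    (fun x => 16 * 1 - rbilap (kern (c + pi / 2) x) m) s t st) => x _.
    exact: (derB (derMl 16 (is_derive_id x 1)) (is_derive_kern c x m)).
  by have := D x; rewrite ler_norml mulr1; lra.
have h2 : 16 * s + kern c s m <= 16 * t + kern c t m.
  apply: (@derive_ge0_le _ (fun x => 16 * x + kern c x m)
    (fun x => 16 * 1 + rbilap (kern (c + pi / 2) x) m) s t st) => x _.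
    exact: (derD (derMl 16 (is_derive_id x 1)) (is_derive_kern c x m)).
  by have := D x; rewrite ler_norml mulr1; lra.
by rewrite ler_norml; lra.
Qed.

Lemma kernel_lipschitz (s t : R) (m : int) :
  normc (kernel t m - kernel s m) <= 32 * `|t - s|.
Proof.
wlog st : s t / s <= t.
  move=> H; have [/H//|/ltW/H] := leP s t.
  by rewrite -(opprB (kernel t m)) normcN distrC.
rewrite ger0_norm ?subr_ge0//; apply: le_trans (normc_le_ReIm _) _.
rewrite Re_add Re_opp Im_add Im_opp /=.
by have := kern_lipschitz 0 m st; have := kern_lipschitz (pi / 2) m st; lra.
Qed.

Section Backward.
Variables (I : Type) (r : seq I) (a : I -> R[i]) (T : I -> R) (M : I -> int).

(** A solution of k' = i Delta^2 k whose j-th term is a_j times the delta at M_j when s = T_j. It is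
    paired with u bilinearly, so complex conjugates have to be put into the coefficients. *)
Definition backward (s : R) (m : int) : R[i] :=
  \sum_(j <- r) a j * kernel (T j - s) (M j - m).

Lemma dbilaplacian_backward s m : dbilaplacian (backward s) m =
  \sum_(j <- r) a j * dbilaplacian (kernel (T j - s)) (M j - m).
Proof.
rewrite dbilaplacianE /backward.
rewrite -!big_split /= !mulr_sumr -sumrB -big_split /=.
apply: eq_bigr => j _; rewrite dbilaplacianE.
have -> : M j - (m + 2) = M j - m - 2 by ring.
have -> : M j - (m - 2) = M j - m + 2 by ring.
have -> : M j - (m + 1) = M j - m - 1 by ring.
have -> : M j - (m - 1) = M j - m + 1 by ring.
by ring.
Qed.

Lemma is_cderive_backward s m :
  is_cderive (fun s => backward s m) s ('i%C * dbilaplacian (backward s) m).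
Proof.
rewrite dbilaplacian_backward mulr_sumr.
rewrite (eq_bigr (fun j => a j * ('i%C * dbilaplacian (kernel (T j - s)) (M j - m)))).
  by apply: cder_sum => j; apply: cderMl; exact: is_cderive_kernelB.
by move=> j _; rewrite mulrCA.
Qed.

Lemma backward_lipschitz m : exists2 L, 0 <= L & forall x y,
  normc (backward y m - backward x m) <= L * `|y - x|.
Proof.
exists (\sum_(j <- r) normc (a j) * 32).
  by apply: sumr_ge0 => j _; rewrite mulr_ge0// normc_ge0.
move=> x y; rewrite /backward -sumrB mulr_suml.
apply: le_trans (normc_sum _ _) _; apply: ler_sum => j _.
rewrite -mulrBr normcM -mulrA ler_wpM2l ?normc_ge0//.
apply: le_trans (kernel_lipschitz _ _ _) _.
have -> : T j - y - (T j - x) = x - y by ring.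
by rewrite distrC.
Qed.

End Backward.

End ComplexDerivative.

Section Pairing.
Context {R : realType}.
Notation mu := (@lebesgue_measure R).
Variables (k u F : R -> int -> R[i]) (a b Y B : R) (N : nat) (g : R -> R).
Hypothesis (ab : a <= b) (N0 : (0 < N)%N) (Y0 : 0 <= Y) (B0 : 0 <= B).
Hypothesis k_l2 : forall t, l2_bounded (k t) Y.
Hypothesis k_lip : forall m, exists2 L, 0 <= L & forall x y,
  normc (k y m - k x m) <= L * `|y - x|.
Hypothesis k_der : forall t m,
  is_cderive (fun s => k s m) t ('i%C * dbilaplacian (k t) m).
Hypothesis u_l2 : forall t, a <= t <= b -> l2_bounded (u t) B.
Hypothesis u_ac : forall m, abs_continuous a b (fun t => u t m).
Hypothesis u_der : {ae mu, forall t, a < t < b -> forall m,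
  is_cderive (fun s => u s m) t (- 'i%C * dbilaplacian (u t) m + 'i%C * F t m)}.
Hypothesis g0 : forall t, 0 <= g t.
Hypothesis intg : mu.-integrable `[a, b] (EFin \o g).
Hypothesis kF : {ae mu, forall t, a < t < b ->
  normc (\sum_(m <- zs N.+2) (tent N m)%:C * (k t m * F t m)) <= g t}.

Definition pair t := \sum_(m <- zs N.+2) (tent N m)%:C * (k t m * u t m).

Let is_cderive_pair t : (forall m, is_cderive (fun s => u s m) t
    (- 'i%C * dbilaplacian (u t) m + 'i%C * F t m)) ->
  is_cderive pair t
   ('i%C * (\sum_(m <- zs N.+2) (tent N m)%:C *
      (dbilaplacian (k t) m * u t m - k t m * dbilaplacian (u t) m)) +
    'i%C * \sum_(m <- zs N.+2) (tent N m)%:C * (k t m * F t m)).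
Proof.
move=> ud.
have := cder_sum (zs N.+2) (fun m => cderMl (tent N m)%:C (cderM (k_der t m) (ud m))).
congr (is_cderive _ _ _).
rewrite !mulr_sumr -big_split /=; apply: eq_bigr => m _; ring.
Qed.

Lemma pair_ac : abs_continuous a b pair.
Proof.
apply: abs_continuous_sum => m.
have [L L0 kL] := k_lip m.
apply: (@abs_continuous_dominated _ _ _ (fun t => u t m) _ (Y + B * L)) => //.
  by rewrite addr_ge0// mulr_ge0.
move=> x y ax xy yb; rewrite -mulrBr normcM normc_real ger0_norm ?tent_ge0//.
have -> : k y m * u y m - k x m * u x m =
    k y m * (u y m - u x m) + (k y m - k x m) * u x m by ring.
apply: (@le_trans _ _ (normc (k y m * (u y m - u x m) + (k y m - k x m) * u x m))).
  by rewrite -[leRHS]mul1r ler_wpM2r ?normc_ge0 ?tent_le1.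
apply: le_trans (le_normcD _ _) _; rewrite !normcM.
have hk := l2_bounded_normc m Y0 (k_l2 y).
have hu : normc (u x m) <= B.
  by apply: l2_bounded_normc => //; apply: u_l2; rewrite ax (le_trans xy).
have hL := kL x y; rewrite ger0_norm ?subr_ge0// in hL.
have yx : 0 <= y - x by rewrite subr_ge0.
have h1 : normc (k y m) * normc (u y m - u x m) <= Y * normc (u y m - u x m).
  by rewrite ler_wpM2r ?normc_ge0.
have h2 : normc (k y m - k x m) * normc (u x m) <= L * (y - x) * B.
  by apply: ler_pM; rewrite ?normc_ge0.
have h3 : 0 <= Y * (y - x) by rewrite mulr_ge0.
have h4 : 0 <= B * L * normc (u y m - u x m) by rewrite !mulr_ge0 ?normc_ge0.
apply: le_trans (lerD h1 h2) _.
by rewrite mulrDl !mulrDr; move: h3 h4; lra.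
Qed.

(** The derivative of the pairing is i times the commutator term plus i times the forcing tested
    against k. Rotating the increment by a unimodular [c] makes it a positive real number, so that
    [ac_le_integral] applies to a real part. *)
Lemma pair_le :
  normc (pair b - pair a) <= \int[mu]_(t in `[a, b]) g t +
    (b - a) * (12 * Y * B / N%:R).
Proof.
pose e := 12 * Y * B / N%:R.
have e0 : 0 <= e by rewrite divr_ge0 ?mulr_ge0.
set z := pair b - pair a.
have [->|z0] := eqVneq z 0.
  by rewrite normc0 addr_ge0 ?mulr_ge0 ?subr_ge0// Rintegral_ge0.
have nz : 0 < normc z.
  by rewrite lt_def normc_ge0 andbT; apply: contra z0 => /eqP/eq0_normc ->.
pose c : R[i] := (normc z)^-1%:C * z^*%C.
have nc : normc c = 1.
  by rewrite normcM normc_real normc_conjc ger0_norm ?invr_ge0 ?ltW// mulVf ?gt_eqF.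
have cz : complex.Re (c * z) = normc z.
  rewrite /c -mulrA [_^*%C * z]mulrC mulc_conjc -rmorphM /=.
  by rewrite expr2 mulrA mulVf ?mul1r// gt_eqF.
pose f t := complex.Re (c * pair t).
have -> : normc z = f b - f a by rewrite -cz /f -Re_opp -Re_add -mulrBr.
have eint : mu.-integrable `[a, b] (EFin \o (fun=> e)).
  apply: continuous_compact_integrable; first exact: segment_compact.
  by apply: continuous_subspaceT => x; exact: cst_continuous.
have -> : \int[mu]_(t in `[a, b]) g t + (b - a) * e =
    \int[mu]_(t in `[a, b]) (g t + e).
  rewrite RintegralD// Rintegral_cst//= lebesgue_measure_itv/= lte_fin.
  by case: ltP ab => [_ _|ba ab'] /=; [rewrite mulrC|rewrite (le_anti (introT andP (conj ba ab'))) subrr mul0r mulr0].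
apply: ac_le_integral => //.
- apply: abs_continuous_Re.
  apply: abs_continuous_dominated pair_ac => [|x y ax xy yb]; first exact: ler01.
  by rewrite -mulrBr normcM nc !mul1r lerDl subr_ge0.
- by move=> t; rewrite addr_ge0.
- rewrite (_ : EFin \o _ = (EFin \o g) \+ (EFin \o (fun=> e)))//.
  exact: integrableD.
have FF := ae_filter_ringOfSetsType mu.
apply: (@filterS2 _ _ FF _ _ _ _ u_der kF) => t ud kFt atb.
have h := is_cderive_Re (cderMl c (is_cderive_pair (ud atb))).
exists (complex.Re (c * ('i%C * (\sum_(m <- zs N.+2) (tent N m)%:C *
      (dbilaplacian (k t) m * u t m - k t m * dbilaplacian (u t) m)) +
    'i%C * \sum_(m <- zs N.+2) (tent N m)%:C * (k t m * F t m)))) => //.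
apply: le_trans (ler_norm _) _; apply: le_trans (Re_le_normc _) _.
rewrite normcM nc mul1r; apply: le_trans (le_normcD _ _) _; rewrite !normcM.
have -> : normc ('i%C : R[i]) = 1 by rewrite /= expr0n expr1n add0r sqrtr1.
rewrite !mul1r addrC lerD ?kFt//.
apply: commutator_bound => //; apply: u_l2.
by case/andP: atb => /ltW -> /ltW ->.
Qed.

End Pairing.

(** * Estimates for forced solutions *)

Section RealHelpers.
Context {R : realType}.
Implicit Types (x y z c : R).

(** Used to let the width of the tent tend to infinity. *)
Lemma le_of_forall_nat x z c (n0 : nat) :
  (forall n, (n0 < n)%N -> x <= z + c / n%:R) -> x <= z.
Proof.
move=> H; apply/ler_addgt0Pr => e e0.
pose n := (maxn n0 (Num.truncn (`|c| / e))).+1.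
have n0n : (n0 < n)%N by rewrite ltnS leq_maxl.
have nc : `|c| / e <= n%:R.
  apply: le_trans (ltW (truncnS_gt _)) _.
  by rewrite ler_nat ltnS leq_maxr.
apply: le_trans (H n n0n) _; rewrite lerD2l ler_pdivrMr ?ltr0n//.
apply: le_trans (ler_norm c) _.
by rewrite ler_pdivrMr// mulrC in nc.
Qed.

(** A supremum over a window need not be attained; a factor 2 buys an actual sample point, also when
    the supremum is 0. *)
Lemma near_sup (S : set R) (B : R) : S !=set0 ->
  (forall x, S x -> 0 <= x <= B) -> exists2 x, S x & forall y, S y -> y <= 2 * x.
Proof.
move=> [x0 Sx0] SB.
have Sub : has_ubound S by exists B => x /SB/andP[].
have Ssup : has_sup S by split=> //; exists x0.
have s0 : 0 <= sup S.
  by apply: le_trans (ub_le_sup Sub Sx0); case/andP: (SB _ Sx0).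
move: s0; rewrite le_eqVlt => /predU1P[s0|s0].
  exists x0 => // y Sy; have := ub_le_sup Sub Sy; rewrite -s0 => y0.
  by apply: le_trans y0 _; rewrite mulr_ge0//; case/andP: (SB _ Sx0).
have e0 : 0 < sup S / 2 by rewrite divr_gt0.
have [x Sx xs] := sup_adherent e0 Ssup; exists x => // y Sy.
by have := ub_le_sup Sub Sy; lra.
Qed.

(** Hoelder's inequality for the exponents 8 and 8/7 up to a factor 2, by [pow7_mul_le] applied to q
    and x / X. *)
Lemma young7_sum (J : nat) (x q : nat -> R) (X : R) : 0 <= X ->
  (forall j, 0 <= x j) -> (forall j, 0 <= q j) ->
  \sum_(0 <= j < J) x j ^+ 8 <= X ^+ 8 -> \sum_(0 <= j < J) q j ^+ 8 <= 1 ->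
  \sum_(0 <= j < J) x j * q j ^+ 7 <= 2 * X.
Proof.
move=> X0 x0 q0 xX q1; move: X0; rewrite le_eqVlt => /predU1P[X0|X0].
  rewrite -X0 mulr0; rewrite -X0 expr0n /= in xX.
  rewrite big_nat big1 // => j /andP[_ jJ].
  have : x j ^+ 8 <= 0.
    apply: le_trans xX; rewrite (bigD1_seq j) ?mem_index_iota ?iota_uniq//=.
    by rewrite lerDl sumr_ge0// => i _; rewrite exprn_ge0.
  move=> h; have : x j ^+ 8 == 0 by rewrite eq_le h exprn_ge0.
  by rewrite expf_eq0 /= => /eqP ->; rewrite mul0r.
apply: (@le_trans _ _ (\sum_(0 <= j < J) X * (q j ^+ 8 + (x j / X) ^+ 8))).
  apply: ler_sum_nat => j _.
  have h := ler_wpM2l (ltW X0) (pow7_mul_le (q0 j) (divr_ge0 (x0 j) (ltW X0))).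
  apply: le_trans h; rewrite le_eqVlt; apply/orP; left.
  by apply/eqP; field; rewrite gt_eqF.
rewrite -mulr_sumr big_split /= [2 * X]mulrC ler_pM2l//.
under [X in _ + X]eq_bigr do rewrite expr_div_n.
rewrite -mulr_suml (_ : 2 = 1 + 1 :> R)// lerD// ler_pdivrMr ?exprn_gt0//.
by rewrite mul1r.
Qed.

End RealHelpers.

(* The forcing enters only through y: after the splitting of F into an l^2 part
   of size D * y ^ 8 and an l^1 part of size D * y ^ 7, the condition on y says
   that these parts have size D in L^1 l^2 and L^{8/7} l^1. *)
Record forced_flow {R : realType} (u F : R -> int -> R[i]) (y : R -> R) (D : R)
    : Prop := {
  flow_l2 : forall T : R, 0 <= T -> exists2 B : R, 0 <= B &
    forall t, 0 <= t <= T -> l2_bounded (u t) B ;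
  flow_ac : forall m T, 0 <= T -> abs_continuous 0 T (fun t => u t m) ;
  flow_der : {ae lebesgue_measure, forall t : R, 0 < t -> forall m,
    is_cderive (fun s => u s m) t
      (- 'i%C * dbilaplacian (u t) m + 'i%C * F t m)} ;
  flow_D0 : 0 <= D ;
  flow_initial : l2_bounded (u 0) D ;
  flow_y0 : forall t, 0 <= y t ;
  flow_ymeas : measurable_fun setT y ;
  flow_yint : forall T : R,
    lebesgue_measure.-integrable `[0, T] (EFin \o (fun t => y t ^+ 8)) ;
  flow_y1 : forall T : R, \int[lebesgue_measure]_(t in `[0, T]) y t ^+ 8 <= 1 ;
  flow_split : {ae lebesgue_measure, forall t : R, 0 < t ->
    forall (s : seq int) (k : int -> R[i]) (Y kap : R),
    uniq s -> 0 <= Y -> 0 <= kap ->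
    l2_bounded k Y -> (forall m, normc (k m) <= kap) ->
    \sum_(m <- s) normc (k m) * normc (F t m) <=
      D * (Y * y t ^+ 8 + kap * y t ^+ 7)} }.

Section FlowPieces.
Context {R : realType}.
Notation mu := (@lebesgue_measure R).
Variables (u F : R -> int -> R[i]) (y : R -> R) (D : R).
Hypothesis flow : forced_flow u F y D.

Let y0 := flow_y0 flow.
Let D0 := flow_D0 flow.

Definition cumul x := \int[mu]_(t in `[0, x]) y t ^+ 8.

Notation Phi := cumul.

Lemma cumul_integrable (a b : R) : 0 <= a -> mu.-integrable `[a, b] (EFin \o (fun t => y t ^+ 8)).
Proof.
move=> a0; apply: integrableS (flow_yint flow b) => //.
by apply: subset_itvr; rewrite bnd_simp.
Qed.

Lemma int_cumul (a b : R) : 0 <= a -> a <= b ->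
  \int[mu]_(t in `[a, b]) y t ^+ 8 = Phi b - Phi a.
Proof.
move=> a0 ab; rewrite /cumul (@Rintegral_itvB _ _ (BLeft 0) (BRight b) a);
  [|exact: (flow_yint flow)|by rewrite bnd_simp|by rewrite bnd_simp].
rewrite Rintegral_itv_obnd_cbnd//; apply: integrableS (cumul_integrable b a0) => //.
by apply: subset_itvr; rewrite bnd_simp.
Qed.

Lemma cumul_mono (a b : R) : 0 <= a -> a <= b -> Phi a <= Phi b.
Proof.
move=> a0 ab; rewrite -subr_ge0 -int_cumul//; apply: Rintegral_ge0 => t _.
by rewrite exprn_ge0.
Qed.

(** Hoelder on an interval of length at most 2, through y ^ 7 <= y ^ 8 / c + c ^ 7: the choice c = q
    gives q ^ 7 + 2 q ^ 7, and for q = 0 one lets c tend to 0. *)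
Lemma int_pow7_le (a b q : R) : 0 <= a -> a <= b -> b <= a + 2 -> 0 <= q ->
  q ^+ 8 = Phi b - Phi a ->
  mu.-integrable `[a, b] (EFin \o (fun t => y t ^+ 7)) /\
  \int[mu]_(t in `[a, b]) y t ^+ 7 <= 3 * q ^+ 7.
Proof.
move=> a0 ab ba q0 qE.
have intc (c : R) : mu.-integrable `[a, b] (EFin \o (fun=> c)).
  apply: continuous_compact_integrable; first exact: segment_compact.
  by apply: continuous_subspaceT => x; exact: cst_continuous.
have int8 c : mu.-integrable `[a, b] (EFin \o (fun t => c * y t ^+ 8)).
  by apply: (integrableZl _ _ (cumul_integrable b a0)).
have bnd c t : 0 < c -> y t ^+ 7 <= c^-1 * y t ^+ 8 + c ^+ 7.
  move=> c0; have := pow7_mul_le (y0 t) (ltW c0).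
  rewrite -ler_pdivlMr// mulrDl [c ^+ 8]exprSr mulfK ?gt_eqF//.
  by rewrite [_ / c]mulrC.
have intb c : mu.-integrable `[a, b] (EFin \o (fun t => c^-1 * y t ^+ 8 + c ^+ 7)).
  rewrite (_ : EFin \o _ =
    (EFin \o (fun t => c^-1 * y t ^+ 8)) \+ (EFin \o (fun=> c ^+ 7)))//.
  exact: integrableD.
have m7 : measurable_fun `[a, b] (fun t => y t ^+ 7).
  apply: measurable_funX; exact: measurable_funS (flow_ymeas flow).
have int7 : mu.-integrable `[a, b] (EFin \o (fun t => y t ^+ 7)).
  apply: le_integrable (intb 1) => //; first exact/measurable_EFinP.
  move=> t _; rewrite lee_fin ger0_norm ?exprn_ge0//.
  by apply: le_trans (bnd 1 t ltr01) _; exact: ler_norm.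
split => //.
have main c : 0 < c -> \int[mu]_(t in `[a, b]) y t ^+ 7 <= c^-1 * q ^+ 8 + 2 * c ^+ 7.
  move=> c0; apply: (@le_trans _ _ (\int[mu]_(t in `[a, b]) (c^-1 * y t ^+ 8 + c ^+ 7))).
    by apply: le_Rintegral => // t _; exact: bnd.
  rewrite RintegralD// RintegralZl//; last exact: cumul_integrable.
  rewrite int_cumul// -qE lerD2l Rintegral_cst//= lebesgue_measure_itv/= lte_fin.
  have c7 : 0 <= c ^+ 7 by rewrite exprn_ge0 ?ltW.
  case: ltP => _ /=; last by rewrite mulr0 mulr_ge0.
  by rewrite mulrC ler_wpM2r//; lra.
move: q0; rewrite le_eqVlt => /predU1P[q0|q0].
  rewrite -q0 expr0n /= mulr0.
  apply/ler_addgt0Pr => e e0; rewrite add0r.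
  have := main (Num.min 1 (e / 2)); rewrite lt_min ltr01 divr_gt0// => /(_ isT) h.
  apply: le_trans h _; rewrite -q0 expr0n mulr0 add0r.
  set c := Num.min _ _; have c0 : 0 <= c by rewrite le_min ler01 divr_ge0 ?ltW.
  have c1 : c <= 1 by rewrite ge_min lexx.
  have c2 : c <= e / 2 by rewrite ge_min lexx orbT.
  have : c ^+ 7 <= c by rewrite exprS -[leRHS]mulr1 ler_wpM2l// exprn_ile1.
  by lra.
apply: le_trans (main q q0) _.
have -> : q^-1 * q ^+ 8 = q ^+ 7 by field; rewrite gt_eqF.
lra.
Qed.

(** The l^2 part of the forcing meets the l^2 bound [Y] of k, the l^1 part meets its supremum [kap].
    The length 2 allows for samples taken in neighbouring windows. *)
Lemma piece_bound (k : R -> int -> R[i]) (a b Y kap q T B : R) (N : nat) :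
  0 <= a -> a <= b -> b <= a + 2 -> b <= T -> (0 < N)%N -> 0 <= Y -> 0 <= kap ->
  0 <= B -> (forall t, 0 <= t <= T -> l2_bounded (u t) B) ->
  (forall t, l2_bounded (k t) Y) ->
  (forall m, exists2 L, 0 <= L & forall s t,
    normc (k t m - k s m) <= L * `|t - s|) ->
  (forall t m, is_cderive (fun s => k s m) t ('i%C * dbilaplacian (k t) m)) ->
  (forall t m, a < t < b -> normc (k t m) <= kap) ->
  0 <= q -> q ^+ 8 = Phi b - Phi a ->
  normc (pair k u N b - pair k u N a) <=
    D * (Y * q ^+ 8 + 3 * (kap * q ^+ 7)) + (b - a) * (12 * Y * B / N%:R).
Proof.
move=> a0 ab ba bT N0 Y0 kap0 B0 uB kY klip kder kkap q0 qE.
have T0 : 0 <= T by rewrite (le_trans a0)// (le_trans ab).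
have [int7 le7] := int_pow7_le a0 ab ba q0 qE.
pose g t := D * (Y * y t ^+ 8 + kap * y t ^+ 7).
have i8 : mu.-integrable `[a, b] (EFin \o (fun t => Y * y t ^+ 8)).
  by apply: (integrableZl _ _ (cumul_integrable b a0)).
have i7 : mu.-integrable `[a, b] (EFin \o (fun t => kap * y t ^+ 7)).
  by apply: (integrableZl _ _ int7).
have i87 : mu.-integrable `[a, b] (EFin \o (fun t => Y * y t ^+ 8 + kap * y t ^+ 7)).
  rewrite (_ : EFin \o _ =
    (EFin \o (fun t => Y * y t ^+ 8)) \+ (EFin \o (fun t => kap * y t ^+ 7)))//.
  exact: integrableD.
have ig : mu.-integrable `[a, b] (EFin \o g) by apply: (integrableZl _ _ i87).
have g0 t : 0 <= g t by rewrite mulr_ge0// addr_ge0// mulr_ge0// exprn_ge0.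
have FF := ae_filter_ringOfSetsType mu.
apply: le_trans (@pair_le R k u F a b Y B N g ab N0 Y0 B0 kY klip kder _ _ _ g0 ig _) _.
- by move=> t /andP[at_ tb]; apply: uB; rewrite (le_trans a0)//= (le_trans tb).
- by move=> m; apply: abs_continuousS (flow_ac flow m T0).
- apply: (@filterS _ _ FF _ _ _ (flow_der flow)) => t ht /andP[at_ _]; apply: ht.
  exact: le_lt_trans at_.
- apply: (@filterS _ _ FF _ _ _ (flow_split flow)) => t ht /andP[at_ tb].
  have t0 : 0 < t by exact: le_lt_trans at_.
  have atb : a < t < b by rewrite at_.
  have := ht t0 (zs N.+2) (k t) Y kap (uniq_zs _) Y0 kap0 (kY t)
     (fun m => kkap t m atb).
  apply: le_trans.
  apply: le_trans (normc_sum _ _) _; apply: ler_sum => m _.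
  rewrite !normcM normc_real ger0_norm ?tent_ge0//.
  by rewrite -[leRHS]mul1r ler_wpM2r ?tent_le1// mulr_ge0 ?normc_ge0.
rewrite lerD2r /g RintegralZl// ler_wpM2l// RintegralD// RintegralZl//; last exact: cumul_integrable.
rewrite RintegralZl// int_cumul// -qE lerD2l mulrCA ler_wpM2l//.
Qed.

Lemma cumul_le1 T : cumul T <= 1.
Proof. exact: (flow_y1 flow). Qed.

Lemma cumul0 : cumul 0 = 0.
Proof. by rewrite /cumul set_itv1 Rintegral_set1. Qed.

End FlowPieces.

Section FlowEstimates.
Context {R : realType}.
Variables (u F : R -> int -> R[i]) (y : R -> R) (D : R).
Hypothesis flow : forced_flow u F y D.

Let D0 := flow_D0 flow.

(** The adjoint solution ends at time T in the conjugate of u restricted to [s], so the final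
    pairing tends to X ^ 2 as the tent widens. [evolve_sampled] controls its suprema over unit
    intervals. In 722 = 1 + 1 + 3 * 240 the summands come from the initial value, the l^2 part and
    the l^1 part of the forcing. *)
Lemma l2_estimate T s : 0 <= T -> uniq s ->
  \sum_(n <- s) normc (u T n) ^+ 2 <= (722 * D) ^+ 2.
Proof.
move=> T0 us; set X2 := \sum_(n <- s) _.
have X20 : 0 <= X2 by apply: sumr_ge0 => n _; exact: sqr_ge0.
pose X := Num.sqrt X2; have X0 : 0 <= X by exact: sqrtr_ge0.
have XE : X ^+ 2 = X2 by rewrite sqr_sqrtr.
have [B B0 uB] := flow_l2 flow T0.
pose k := backward s (fun n => (u T n)^*%C) (fun=> T) id.
have kE t m : k t m = evolve s (fun n => (u T n)^*%C) (T - t) m by [].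
have cu2 : \sum_(n <- s) normc (u T n)^*%C ^+ 2 <= X ^+ 2.
  by rewrite XE; under eq_bigr do rewrite normc_conjc.
have kX t : l2_bounded (k t) X by move=> s' us'; exact: evolve_l2.
pose L := (Num.truncn T).+1; pose tau i := Num.min (i%:R : R) T.
have tau0 i : 0 <= tau i by rewrite le_min ler0n.
have tauT i : tau i <= T by rewrite ge_min lexx orbT.
have tau_mono i : tau i <= tau i.+1.
  by rewrite le_min tauT andbT ge_min ler_nat leqnSn.
have tau1 i : tau i.+1 <= tau i + 1.
  rewrite /tau -natr1; case: (leP (i%:R : R) T) => h; rewrite ge_min ?lexx//.
  by rewrite lerDl ler01 orbT.
have tauL i : (i < L)%N -> tau i = i%:R.
  rewrite ltnS => iL; apply/min_idPl.
  by apply: (@le_trans _ _ (Num.truncn T)%:R); [rewrite ler_nat|rewrite truncn_le].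
have tauLT : tau L = T by apply/min_idPr/ltW/truncnS_gt.
have /choice[w wP] : forall i, exists w : R * int, tau i <= w.1 <= tau i.+1 /\
    forall t m, tau i < t < tau i.+1 -> normc (k t m) <= 2 * normc (k w.1 w.2).
  move=> i; pose S := [set x | exists t m, tau i <= t <= tau i.+1 /\ x = normc (k t m)].
  have [||x [t [m [ht ->]]] hx] := @near_sup R S X.
  - by exists (normc (k (tau i) 0)), (tau i), 0; rewrite lexx tau_mono.
  - by move=> x [t [m [_ ->]]]; rewrite normc_ge0 l2_bounded_normc.
  exists (t, m); split => // t' m' /andP[h1 h2]; apply: hx.
  by exists t', m'; rewrite !ltW.
pose x i := normc (k (w i).1 (w i).2).
have sumx : \sum_(0 <= i < L) x i ^+ 8 <= (60 * X) ^+ 8.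
  apply: (@evolve_sampled _ _ (fun i => T - (w i).1) (fun i => (w i).2)) => //.
  have sep i j : (i < j)%N -> (j < L)%N -> (j - i)%N%:R <= (w j).1 - (w i).1 + 1.
    move=> ij jL; have [/andP[_ h1] _] := wP i; have [/andP[h2 _] _] := wP j.
    rewrite tauL// in h2; have h3 : tau i.+1 <= i.+1%:R by rewrite ge_min lexx.
    rewrite natrB ?(ltnW ij)//; rewrite -natr1 in h3; lra.
  move=> i j iL jL; have -> : T - (w i).1 - (T - (w j).1) = (w j).1 - (w i).1 by ring.
  case: (ltngtP i j) => ij.
  - rewrite distnEr ?(ltnW ij)//; apply: le_trans (sep _ _ ij jL) _.
    by rewrite lerD2r ler_norm.
  - rewrite distnEl ?(ltnW ij)// distrC; apply: le_trans (sep _ _ ij iL) _.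
    by rewrite lerD2r ler_norm.
  - by rewrite ij distnn subrr normr0 add0r ler01.
have /choice[q qP] : forall i, exists q, 0 <= q /\ q ^+ 8 = cumul y (tau i.+1) - cumul y (tau i).
  move=> i; have [|q q0 qE] := @pow8_root R (cumul y (tau i.+1) - cumul y (tau i)).
    by rewrite subr_ge0 (cumul_mono flow).
  by exists q.
have sumq : \sum_(0 <= i < L) q i ^+ 8 <= 1.
  rewrite (eq_bigr (fun i => cumul y (tau i.+1) - cumul y (tau i))) => [|i _]; last exact: (qP i).2.
  rewrite telescope_sumr// tauLT /tau min_l// cumul0 subr0; exact: (cumul_le1 flow).
have young : \sum_(0 <= i < L) x i * q i ^+ 7 <= 120 * X.
  have -> : 120 * X = 2 * (60 * X) by ring.
  apply: young7_sum => //; first by rewrite mulr_ge0.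
  - by move=> i; exact: normc_ge0.
  - by move=> i; have [] := qP i.
pose N0 := \max_(n <- s) `|n|%N.
have sN0 n : n \in s -> (`|n| <= N0)%N by move=> ns; exact: leq_bigmax_seq.
(* At time T the function k is supported in [s], hence in |n| <= N0, where the tent is at least 1 -
   N0 / N. *)
have pairT N : (N0 < N)%N -> (1 - N0%:R / N%:R) * X ^+ 2 <= normc (pair k u N T).
  move=> N0N; apply: le_trans (le_trans (ler_norm _) (Re_le_normc _)).
  rewrite /pair; have -> : \sum_(m <- zs N.+2) (tent N m)%:C * (k T m * u T m) =
      \sum_(m <- s) (tent N m * normc (u T m) ^+ 2)%:C.
    rewrite (bigID (mem s)) /= [X in _ + X]big1 ?addr0 => [|m ms]; last first.
      rewrite kE /evolve big_seq big1 ?mul0r ?mulr0// => n ns.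
      rewrite subrr kernel0 subr_eq0 (negbTE (_ : n != m)) ?mulr0//.
      by apply: contra ms => /eqP <-.
    rewrite -big_filter; transitivity (\sum_(m <- [seq m <- zs N.+2 | m \in s])
        (tent N m * normc (u T m) ^+ 2)%:C).
      apply: eq_big_seq => m; rewrite mem_filter => /andP[ms _].
      rewrite kE /evolve (bigD1_seq m)//= big1 ?addr0 => [|n nm].
        rewrite !subrr kernel0 eqxx mulr1 [_^*%C * _]mulrC mulc_conjc.
        by rewrite -rmorphM.
      by rewrite subrr kernel0 subr_eq0 (negbTE nm) mulr0.
    apply: perm_big; apply: uniq_perm => //; first exact/filter_uniq/uniq_zs.
    move=> m; rewrite mem_filter mem_zs; case ms : (m \in s) => //=.
    exact: leq_trans (sN0 m ms) (leqW (leqW (ltnW N0N))).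
  rewrite Re_sum XE /X2 mulr_sumr big_seq [leRHS]big_seq; apply: ler_sum => m ms /=.
  by rewrite ler_wpM2r ?sqr_ge0// tent_ge// sN0.
have pair0 N : normc (pair k u N 0) <= X * D.
  apply: le_trans (normc_sum _ _) _.
  apply: (@le_trans _ _ (\sum_(m <- zs N.+2) normc (k 0 m) * normc (u 0 m))).
    apply: ler_sum => m _; rewrite !normcM normc_real ger0_norm ?tent_ge0//.
    by rewrite -[leRHS]mul1r ler_wpM2r ?tent_le1// mulr_ge0 ?normc_ge0.
  apply: cauchy_schwarz => //; [exact/kX/uniq_zs|exact/(flow_initial flow)/uniq_zs].
have main N : (N0 < N)%N ->
    X ^+ 2 <= 722 * (X * D) + (N0%:R * X ^+ 2 + T * (12 * X * B)) / N%:R.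
  move=> N0N; have N_gt0 : (0 < N)%N by exact: leq_ltn_trans N0N.
  have tel : normc (pair k u N T - pair k u N 0) <= \sum_(0 <= i < L)
      (D * (X * q i ^+ 8 + 3 * (2 * x i * q i ^+ 7)) +
       (tau i.+1 - tau i) * (12 * X * B / N%:R)).
    have -> : pair k u N T - pair k u N 0 =
        \sum_(0 <= i < L) (pair k u N (tau i.+1) - pair k u N (tau i)).
      by rewrite telescope_sumr// tauLT /tau min_l.
    apply: le_trans (normc_sum _ _) _; apply: ler_sum_nat => i _.
    have [q0 qE] := qP i; have [_ wk] := wP i.
    apply: (@piece_bound _ u F y D flow k (tau i) (tau i.+1) X (2 * x i) (q i) T B N) => //.
    - by apply: le_trans (tau1 i) _; lra.
    - by rewrite mulr_ge0// normc_ge0.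
    - by move=> m; exact: backward_lipschitz.
    - by move=> t m; exact: is_cderive_backward.
  rewrite big_split /= -mulr_sumr -mulr_suml telescope_sumr// tauLT in tel.
  rewrite [tau 0%N]min_l// subr0 big_split /= -!mulr_sumr in tel.
  have h1 : \sum_(0 <= i < L) 2 * x i * q i ^+ 7 <= 240 * X.
    rewrite (eq_bigr (fun i => 2 * (x i * q i ^+ 7))); last by move=> i _; rewrite mulrA.
    by rewrite -mulr_sumr; lra.
  have h2 : D * (X * (\sum_(0 <= i < L) q i ^+ 8) +
      3 * \sum_(0 <= i < L) 2 * x i * q i ^+ 7) <= D * (X * 1 + 3 * (240 * X)).
    by rewrite ler_wpM2l// lerD// ?ler_wpM2l.
  have h3 : normc (pair k u N T) <= normc (pair k u N T - pair k u N 0) +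
      normc (pair k u N 0) by rewrite -{1}(subrK (pair k u N 0) (pair k u N T)) le_normcD.
  have h4 := pairT N N0N; have h5 := pair0 N.
  have e : (N0%:R * X ^+ 2 + T * (12 * X * B)) / N%:R =
    N0%:R / N%:R * X ^+ 2 + T * (12 * X * B / N%:R) by ring.
  rewrite e; rewrite mulrBl mul1r in h4.
  by move: (le_trans h4 (le_trans h3 (lerD (le_trans tel (lerD h2 (lexx _))) h5))); lra.
have h : X ^+ 2 <= 722 * (X * D) by exact: le_of_forall_nat main.
have XD : X <= 722 * D.
  clear -X0 D0 h; move: X0; rewrite le_eqVlt => /predU1P[<-|X0].
    exact: mulr_ge0 (ler0n _ _) D0.
  by rewrite -(ler_pM2l X0) -expr2 mulrCA.
rewrite -XE; apply: lerXn2r XD; rewrite nnegrE; first exact: X0.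
exact: mulr_ge0 (ler0n _ _) D0.
Qed.

(** Twice 60, for the initial value and the l^2 part of the forcing, plus 3 * 64 * 56 for its l^1
    part. *)
Definition sampled_const : R := 120 + 192 * 56.

Lemma sampled_const_ge0 : 0 <= sampled_const.
Proof. by rewrite addr_ge0// mulr_ge0. Qed.

(** The jumps of the adjoint solution at the samples add up to the sum S of eighth powers, up to the
    tent. Between samples its l^2 norm is controlled by [sampled_bessel]. Its supremum is controlled
    by a discrete potential, which is paired with the profile of the forcing by a second use of
    [discrete_hls]. *)
Lemma sampled_estimate (J : nat) (t : nat -> R) (m : nat -> int) :
  (forall j, j%:R <= t j <= j.+1%:R) ->
  \sum_(0 <= j < J) normc (u (t j) (m j)) ^+ 8 <= (sampled_const * D) ^+ 8.
Proof.
move=> tj; have tj0 j : 0 <= t j by case/andP: (tj j) => h _; exact: le_trans h.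
set S := \sum_(0 <= j < J) _.
apply: pow8_absorb.
- by apply: sumr_ge0 => j _; rewrite exprn_ge0// normc_ge0.
- exact: mulr_ge0 sampled_const_ge0 D0.
move=> P P0 PS; pose p j := normc (u (t j) (m j)).
have p0 j : 0 <= p j by exact: normc_ge0.
have pP : \sum_(0 <= j < J) p j ^+ 8 <= P ^+ 8 by rewrite PS.
pose a j := (u (t j) (m j))^*%C * ((p j ^+ 6)%:C).
have na j : normc (a j) = p j ^+ 7.
  by rewrite normcM normc_conjc normc_real ger0_norm ?exprn_ge0// -exprS.
have aE j : a j * u (t j) (m j) = (p j ^+ 8)%:C.
  by rewrite /a mulrAC [_^*%C * _]mulrC mulc_conjc -rmorphM /= -exprD.
(* Before the i-th sample time only the samples still to come are present. *)
pose ai i j := if (i <= j)%N then a j else 0.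
pose k i := backward (index_iota 0 J) (ai i) t m.
pose Y := 60 * P ^+ 7; have Y0 : 0 <= Y by rewrite mulr_ge0// exprn_ge0// ltW.
have sep s : separated J (fun j => t j - s).
  have sep1 i j : (i < j)%N -> (j - i)%N%:R <= t j - t i + 1.
    move=> ij; have /andP[h1 _] := tj j; have /andP[_ h2] := tj i.
    by rewrite natrB ?(ltnW ij)//; rewrite -natr1 in h2; lra.
  move=> i j iL jL; have -> : t i - s - (t j - s) = t i - t j by ring.
  case: (ltngtP i j) => ij.
  - rewrite distnEr ?(ltnW ij)//; apply: le_trans (sep1 _ _ ij) _.
    by rewrite lerD2r distrC ler_norm.
  - rewrite distnEl ?(ltnW ij)//; apply: le_trans (sep1 _ _ ij) _.
    by rewrite lerD2r ler_norm.
  - by rewrite ij distnn subrr normr0 add0r ler01.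
have kY i s : l2_bounded (k i s) Y.
  move=> s' us'; apply: (@sampled_bessel _ _ (fun j => t j - s) m (ai i) p) => // j.
  by rewrite /ai; case: ifP => _; rewrite ?na// normc0 exprn_ge0.
(* Shifted by one: piece i ends at the i-th sample time, where [k i] gives way to [k i.+1]. *)
pose tau i := if i is i'.+1 then t i' else 0.
have tau0 i : 0 <= tau i by case: i => //= i; exact: tj0.
have tau_mono i : tau i <= tau i.+1.
  case: i => [|i] /=; first exact: tj0.
  by have /andP[_ h1] := tj i; have /andP[h2 _] := tj i.+1; exact: le_trans h1 h2.
have tau2 i : tau i.+1 <= tau i + 2.
  case: i => [|i] /=; first by have /andP[_ h] := tj 0%N; lra.
  have /andP[h1 _] := tj i; have /andP[_ h2] := tj i.+1.
  by rewrite -!natr1 in h2; lra.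
have tauJ i : (i <= J)%N -> tau i <= tau J.
  move=> iJ; rewrite -(subnK iJ); elim: (J - i)%N => // n IH.
  by rewrite addSn (le_trans IH).
have [B B0 uB] := flow_l2 flow (tau0 J).
(* The sum runs over all j, although [k i] only sees j >= i, in order to match the symmetric form of
   [discrete_hls]. *)
pose kap i := 64 * \sum_(0 <= j < J) p j ^+ 7 * wt `|i - j|%N.
have kap0 i : 0 <= kap i.
  by rewrite mulr_ge0// sumr_ge0// => j _; rewrite mulr_ge0 ?exprn_ge0 ?wt_ge0.
have kkap i s n : (i < J)%N -> tau i < s < tau i.+1 -> normc (k i s n) <= kap i.
  move=> iJ /andP[_ st]; apply: le_trans (normc_sum _ _) _.
  rewrite /kap mulr_sumr; apply: ler_sum_nat => j _; rewrite normcM /ai.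
  case: leqP => ij; last first.
    by rewrite normc0 mul0r mulr_ge0// mulr_ge0 ?exprn_ge0 ?wt_ge0.
  rewrite na mulrCA ler_wpM2l ?exprn_ge0//; apply: normc_kernel_wt.
  rewrite distnEr// natrB//; have /andP[h1 _] := tj j; have /andP[_ h2] := tj i.
  by have := ler_norm (t j - s); rewrite /= in st; rewrite -natr1 in h2; lra.
have /choice[q qP] : forall i, exists q, 0 <= q /\
    q ^+ 8 = cumul y (tau i.+1) - cumul y (tau i).
  move=> i; have [|q q0 qE] := @pow8_root R (cumul y (tau i.+1) - cumul y (tau i)).
    by rewrite subr_ge0 (cumul_mono flow).
  by exists q.
have sumq : \sum_(0 <= i < J) q i ^+ 8 <= 1.
  rewrite (eq_bigr (fun i => cumul y (tau i.+1) - cumul y (tau i))) => [|i _];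
    last exact: (qP i).2.
  by rewrite telescope_sumr// cumul0 subr0; exact: (cumul_le1 flow).
have hls : \sum_(0 <= i < J) kap i * q i ^+ 7 <= 64 * (56 * P ^+ 7).
  have := @discrete_hls R J q p 1 P ltr01 P0 (fun i => (qP i).1) p0.
  rewrite !expr1n mulr1 => /(_ sumq pP) h; apply: le_trans (ler_wpM2l _ h) => //.
  rewrite mulr_sumr; apply: ler_sum => i _; rewrite /kap -mulrA ler_pM2l//.
  rewrite mulr_suml; apply: ler_sum => j _; rewrite le_eqVlt; apply/orP; left.
  by apply/eqP; ring.
pose N0 := \max_(0 <= j < J) `|m j|%N.
have mN0 j : (j < J)%N -> (`|m j| <= N0)%N.
  by move=> jJ; apply: leq_bigmax_seq => //; rewrite mem_index_iota.
have jump N i : (i < J)%N -> (N0 < N)%N ->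
    pair (k i) u N (t i) - pair (k i.+1) u N (t i) = (tent N (m i) * p i ^+ 8)%:C.
  move=> iJ N0N; rewrite /pair -sumrB.
  have mz : m i \in zs N.+2.
    by rewrite mem_zs; exact: leq_trans (mN0 i iJ) (leqW (leqW (ltnW N0N))).
  have kd n : k i (t i) n - k i.+1 (t i) n = a i * (m i == n)%:R.
    rewrite /k /backward -sumrB (bigD1_seq i) ?mem_index_iota ?iota_uniq//=.
    rewrite big1 ?addr0 => [|j ji].
      by rewrite /ai leqnn ltnn mul0r subr0 subrr kernel0 subr_eq0.
    by rewrite /ai [(i < j)%N]ltn_neqAle eq_sym ji /= subrr.
  rewrite (bigD1_seq (m i)) ?uniq_zs//= big1 ?addr0 => [|n nm].
    by rewrite -mulrBr -mulrBl kd eqxx mulr1 aE -rmorphM.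
  by rewrite -mulrBr -mulrBl kd eq_sym (negbTE nm) mulr0 mul0r mulr0.
have pair0 N : normc (pair (k 0%N) u N 0) <= Y * D.
  apply: le_trans (normc_sum _ _) _.
  apply: (@le_trans _ _ (\sum_(n <- zs N.+2) normc (k 0%N 0 n) * normc (u 0 n))).
    apply: ler_sum => n _; rewrite !normcM normc_real ger0_norm ?tent_ge0//.
    by rewrite -[leRHS]mul1r ler_wpM2r ?tent_le1// mulr_ge0 ?normc_ge0.
  apply: cauchy_schwarz => //; [exact/kY/uniq_zs|exact/(flow_initial flow)/uniq_zs].
have kJ s n : k J s n = 0.
  rewrite /k /backward big_nat big1// => j /andP[_ jJ].
  by rewrite /ai leqNgt jJ /= mul0r.
have main N : (N0 < N)%N ->
    S <= sampled_const * D * P ^+ 7 + (N0%:R * S + tau J * (12 * Y * B)) / N%:R.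
  move=> N0N; have N_gt0 : (0 < N)%N by exact: leq_ltn_trans N0N.
  (* Abel summation: the jumps equal the initial pairing plus the increments over the pieces, since
     [k J] is zero. *)
  have E : \sum_(0 <= i < J) (tent N (m i) * p i ^+ 8)%:C = pair (k 0%N) u N 0 +
      \sum_(0 <= i < J) (pair (k i) u N (tau i.+1) - pair (k i) u N (tau i)).
    have -> : pair (k 0%N) u N 0 =
        \sum_(0 <= i < J) (pair (k i) u N (tau i) - pair (k i.+1) u N (tau i.+1)).
      rewrite -[RHS]opprK -sumrN; under eq_bigr do rewrite opprB.
      rewrite (telescope_sumr (fun i => pair (k i) u N (tau i)))//= opprB.
      suff -> : pair (k J) u N (tau J) = 0 by rewrite subr0.
      by rewrite /pair big1// => n _; rewrite kJ mul0r mulr0.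
    rewrite -big_split /=; apply: eq_big_nat => i /andP[_ iJ].
    by rewrite -(jump N i iJ N0N) /=; ring.
  have lhs : (1 - N0%:R / N%:R) * S <=
      normc (\sum_(0 <= i < J) (tent N (m i) * p i ^+ 8)%:C).
    apply: le_trans (le_trans (ler_norm _) (Re_le_normc _)).
    rewrite Re_sum mulr_sumr; apply: ler_sum_nat => i /andP[_ iJ] /=.
    rewrite -/(p i); apply: ler_wpM2r; first exact: exprn_ge0.
    exact: tent_ge (mN0 i iJ).
  have rhs : normc (\sum_(0 <= i < J)
      (pair (k i) u N (tau i.+1) - pair (k i) u N (tau i))) <=
      \sum_(0 <= i < J) (D * (Y * q i ^+ 8 + 3 * (kap i * q i ^+ 7)) +
       (tau i.+1 - tau i) * (12 * Y * B / N%:R)).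
    apply: le_trans (normc_sum _ _) _; apply: ler_sum_nat => i /andP[_ iJ].
    have [q0 qE] := qP i.
    apply: (@piece_bound _ u F y D flow (k i) (tau i) (tau i.+1) Y (kap i) (q i) (tau J) B N) => //.
    - exact: tauJ.
    - by move=> n; exact: backward_lipschitz.
    - by move=> s n; exact: is_cderive_backward.
    - by move=> s n; exact: kkap.
  have rE : \sum_(0 <= i < J) (D * (Y * q i ^+ 8 + 3 * (kap i * q i ^+ 7)) +
       (tau i.+1 - tau i) * (12 * Y * B / N%:R)) =
      D * (Y * (\sum_(0 <= i < J) q i ^+ 8) +
      3 * \sum_(0 <= i < J) kap i * q i ^+ 7) + tau J * (12 * Y * B / N%:R).
    rewrite big_split /= -mulr_sumr -mulr_suml telescope_sumr//= subr0.
    by rewrite big_split /= -!mulr_sumr.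
  rewrite rE in rhs.
  have h2 : D * (Y * (\sum_(0 <= i < J) q i ^+ 8) +
      3 * \sum_(0 <= i < J) kap i * q i ^+ 7) <= D * (Y * 1 + 3 * (64 * (56 * P ^+ 7))).
    by rewrite ler_wpM2l// lerD// ?ler_wpM2l.
  rewrite E in lhs; have h3 := le_trans lhs (le_normcD _ _).
  have h4 := le_trans h3 (lerD (pair0 N) (le_trans rhs (lerD h2 (lexx _)))).
  have e : (N0%:R * S + tau J * (12 * Y * B)) / N%:R =
    N0%:R / N%:R * S + tau J * (12 * Y * B / N%:R) by ring.
  rewrite e; rewrite mulrBl mul1r in h4.
  have e2 : Y * D + D * (Y * 1 + 3 * (64 * (56 * P ^+ 7))) = sampled_const * D * P ^+ 7.
    by rewrite /Y /sampled_const; ring.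
  by rewrite -e2; move: h4; lra.
exact: le_of_forall_nat main.
Qed.

End FlowEstimates.

(** * Norms and measurability *)

Section CountingInt.
Context {R : realType}.
Notation ct := (@counting int R).
Implicit Types f : int -> \bar R.
Local Open Scope ereal_scope.

Lemma integral_counting_seq f (s : seq int) : (forall m, 0 <= f m) -> uniq s ->
  \int[ct]_(m in [set` s]) f m = \sum_(m <- s) f m.
Proof.
move=> f0; elim: s => [|a s IH]; first by rewrite big_nil set_nil integral_set0.
rewrite cons_uniq big_cons => /andP[as_ us].
have -> : [set` a :: s] = [set a] `|` [set` s].
  apply/seteqP; split => x /=; rewrite inE; first by case/predU1P; [left|right].
  by case=> [->|->]; rewrite ?eqxx ?orbT.
rewrite ge0_integral_setU//=; last first.
  by apply/eqP; rewrite predeqE => x; split=> // -[/= -> xs]; rewrite xs in as_.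
rewrite -IH//; congr (_ + _).
rewrite (eq_integral (fun=> f a)); last by move=> x; rewrite inE => ->.
rewrite integral_cst//.
rewrite -[RHS]mule1; congr (f a * _).
by rewrite /= /counting asboolT// fset_set1 finmap.cardfs1.
Qed.

Lemma zs_mono : {homo (fun n => [set` zs n]) : n m / (n <= m)%N >-> (n <= m)%O}.
Proof.
move=> n m nm; apply/subsetPset => k /=; rewrite !mem_zs => kn; exact: leq_trans nm.
Qed.

Lemma integral_counting_cvg f : (forall m, 0 <= f m) ->
  \sum_(m <- zs n) f m @[n --> \oo] --> \int[ct]_m f m.
Proof.
move=> f0.
have -> : \int[ct]_m f m = \int[ct]_(m in \bigcup_n [set` zs n]) f m.
  congr (integral _ _ _); apply/seteqP; split => // m _.
  by exists `|m|%N => //=; rewrite mem_zs.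
have -> : (fun n => \sum_(m <- zs n) f m) = (fun n => \int[ct]_(m in [set` zs n]) f m).
  by apply/funext => n; rewrite integral_counting_seq// uniq_zs.
apply: ge0_nondecreasing_set_cvg_integral => //.
exact: zs_mono.
Qed.

Lemma sum_le_integral_counting f (s : seq int) : (forall m, 0 <= f m) -> uniq s ->
  \sum_(m <- s) f m <= \int[ct]_m f m.
Proof.
move=> f0 us; rewrite -integral_counting_seq//; exact: ge0_subset_integral.
Qed.

Lemma integral_counting_le f (M : \bar R) : (forall m, 0 <= f m) ->
  (forall n, \sum_(m <- zs n) f m <= M) -> \int[ct]_m f m <= M.
Proof.
move=> f0 fM; have c := integral_counting_cvg f0.
rewrite -(cvg_lim _ c)//; apply: lime_le; last exact: nearW.
by apply/cvg_ex; exists (\int[ct]_m f m).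
Qed.

End CountingInt.
Section SequenceNorms.
Context {R : realType}.
Implicit Types (phi : int -> R[i]) (p M : R).
Notation ct := (@counting int R).

Lemma poweR_lnorm phi p : 0 < p ->
  (lnorm p%:E phi `^ p = \int[ct]_m ((normc (phi m)) `^ p)%:E)%E.
Proof.
move=> p0; rewrite /lnorm (poweR_Lnorm _ _ (lt0r_neq0 p0)); apply: eq_integral => m _.
by rewrite /= ger0_norm ?normc_ge0// poweR_EFin.
Qed.

Lemma lnorm_ge0 (p : \bar R) phi : (0 <= lnorm p phi)%E.
Proof. exact: Lnorm_ge0. Qed.

Lemma powR_normc_ge0 phi p m : (0 <= (normc (phi m) `^ p)%:E)%E.
Proof. by rewrite lee_fin powR_ge0. Qed.

Lemma sum_powR_le_lnorm phi p M s : 0 < p -> (lnorm p%:E phi <= M%:E)%E ->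
  uniq s -> \sum_(m <- s) normc (phi m) `^ p <= M `^ p.
Proof.
move=> p0 h us; have M0 : 0 <= M by rewrite -lee_fin; exact: le_trans (lnorm_ge0 _ _) h.
rewrite -lee_fin -sumEFin; apply: le_trans (sum_le_integral_counting _ us) _.
  by move=> m; exact: powR_normc_ge0.
rewrite -poweR_lnorm// -poweR_EFin; apply: gt0_ler_poweR (ltW p0) _ _ _ _ h.
- by rewrite in_itv /= lnorm_ge0 leey.
- by rewrite in_itv /= lee_fin M0 leey.
Qed.

Lemma lnorm_le phi p M : 0 < p -> 0 <= M ->
  (forall n, \sum_(m <- zs n) normc (phi m) `^ p <= M `^ p) ->
  (lnorm p%:E phi <= M%:E)%E.
Proof.
move=> p0 M0 h.
have E : lnorm p%:E phi = ((lnorm p%:E phi `^ p) `^ p^-1)%E.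
  by rewrite -poweRrM divff ?gt_eqF// poweRe1// lnorm_ge0.
have -> : M%:E = ((M%:E `^ p) `^ p^-1)%E.
  by rewrite -poweRrM divff ?gt_eqF// poweRe1.
rewrite E; apply: gt0_ler_poweR; rewrite ?invr_ge0 ?(ltW p0)//.
- by rewrite in_itv /= poweR_ge0 leey.
- by rewrite in_itv /= lee_fin powR_ge0 leey.
rewrite poweR_lnorm// poweR_EFin; apply: integral_counting_le.
  by move=> m; exact: powR_normc_ge0.
by move=> n; rewrite sumEFin lee_fin.
Qed.

Lemma sum_normc_le_lnorm1 phi M s : (lnorm 1%:E phi <= M%:E)%E -> uniq s ->
  \sum_(m <- s) normc (phi m) <= M.
Proof.
move=> h us; have M0 : 0 <= M by rewrite -lee_fin; exact: le_trans (lnorm_ge0 _ _) h.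
have := sum_powR_le_lnorm ltr01 h us; rewrite powRr1//.
by under eq_bigr do rewrite powRr1 ?normc_ge0//.
Qed.

Lemma lnorm2_bounded phi M : (lnorm 2%:E phi <= M%:E)%E -> l2_bounded phi M.
Proof.
move=> h s us; have M0 : 0 <= M by rewrite -lee_fin; exact: le_trans (lnorm_ge0 _ _) h.
have := sum_powR_le_lnorm (ltr0n _ 2) h us; rewrite powR_mulrn//.
by under eq_bigr do rewrite powR_mulrn ?normc_ge0//.
Qed.

Lemma counting_setT_gt0 : (0 < ct [set: int])%E.
Proof.
apply: (@lt_le_trans _ _ (ct [set 0])).
  by rewrite /counting asboolT// fset_set1 finmap.cardfs1 lte_fin.
by apply: le_measure; rewrite ?inE.
Qed.

Lemma lnorm_oo_le phi M : (forall m, normc (phi m) <= M) ->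
  (lnorm +oo phi <= M%:E)%E.
Proof.
move=> h; rewrite /lnorm unlock counting_setT_gt0; apply/ess_supP/nearW => m /=.
by rewrite ger0_norm ?normc_ge0// lee_fin.
Qed.

(** Only the empty set is null for the counting measure, so the essential supremum bounds every
    value. *)
Lemma normc_le_lnorm_oo phi m : ((normc (phi m))%:E <= lnorm +oo phi)%E.
Proof.
rewrite /lnorm unlock counting_setT_gt0.
have [N [mN N0 sN]] := ess_sup_ge ct (abse \o (fun m => (normc (phi m))%:E)).
have [h|h] := pselect (N m); last first.
  have := contra_not (sN m) h => /= /contrapT; rewrite ger0_norm ?normc_ge0//.
suff : (1%:E <= ct N)%E by rewrite N0 lee_fin ler10.
apply: (@le_trans _ _ (ct [set m])).
  by rewrite /counting asboolT// fset_set1 finmap.cardfs1.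
by apply: le_measure; rewrite ?inE// => _ ->.
Qed.

End SequenceNorms.

Section LooseMonotonicity.
Context d (T : measurableType d) (R : realType) (mu : {measure set T -> \bar R}).
Local Open Scope ereal_scope.

(** The integral of a nonnegative function is a supremum over the simple functions below it, which
    makes it monotone for arbitrary functions. It serves for the norms of u, known only through
    pointwise bounds. *)
Lemma ge0_le_integral_nonmeas (f g : T -> \bar R) : (forall x, 0 <= f x) ->
  (forall x, f x <= g x) -> \int[mu]_x f x <= \int[mu]_x g x.
Proof.
move=> f0 fg; have g0 x : 0 <= g x by exact: le_trans (fg x).
rewrite !ge0_integralTE//; apply: ge_ereal_sup => _ [h hf <-].
apply: ereal_sup_ubound; exists h => // x; exact: le_trans (hf x) (fg x).
Qed.

Lemma ge0_integral_setT_ge (D : set T) (f : T -> \bar R) : (forall x, 0 <= f x) ->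
  \int[mu]_(x in D) f x <= \int[mu]_x f x.
Proof.
move=> f0; rewrite integral_mkcond; apply: ge0_le_integral_nonmeas => x.
  by rewrite patchE; case: ifP.
by rewrite patchE; case: ifP.
Qed.

End LooseMonotonicity.

Section Halfline.
Context {R : realType}.
Notation mu := (@lebesgue_measure R).
Notation nu := (@halfline_lebesgue R).
Notation D := (@halfline R).
Local Open Scope ereal_scope.

Lemma measurable_halfline : measurable D.
Proof. exact: measurable_itv. Qed.

Lemma integral_halfline (f : R -> \bar R) :
  \int[nu]_(x in D) f x = \int[mu]_(x in D) f x.
Proof.
apply: eq_measure_integral => A mA AD; rewrite /= /mrestr.
by congr (lebesgue_measure _); exact/setIidl.
Qed.

Lemma ae_halfline (P : R -> Prop) : {ae mu, forall t, D t -> P t} ->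
  {ae nu, forall t, P t}.
Proof.
move=> [N [mN N0 sN]]; exists (N `|` ~` D); split.
- apply: measurableU => //; exact: measurableC measurable_halfline.
- rewrite /= /mrestr setIUl setICl setU0; apply: subset_measure0 N0 => //.
    exact: measurableI.
- move=> t /= nP; have [Dt|] := pselect (D t); last by right.
  by left; apply: sN => /= h; apply: nP; exact: h.
Qed.

End Halfline.
Section NormMeasurability.
Context {R : realType}.
Implicit Types (F u : R -> int -> R[i]) (p : R) (D : set R).

Lemma normc_sqrt (z : R[i]) :
  normc z = Num.sqrt (complex.Re z ^+ 2 + complex.Im z ^+ 2).
Proof. by case: z. Qed.

Lemma measurable_normc D (f : R -> R[i]) :
  measurable_fun D (fun t => complex.Re (f t)) ->
  measurable_fun D (fun t => complex.Im (f t)) ->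
  measurable_fun D (fun t => normc (f t)).
Proof.
move=> mr mi.
have -> : (fun t => normc (f t)) =
    Num.sqrt \o (fun t => complex.Re (f t) ^+ 2 + complex.Im (f t) ^+ 2).
  by apply/funext => t; exact: normc_sqrt.
apply: measurableT_comp.
  by apply: continuous_measurable_fun => x; exact: sqrt_continuous.
by apply: measurable_funD; apply: measurable_funX.
Qed.

Lemma measurable_lnorm D F p : 0 < p ->
  (forall m, measurable_fun D (fun t => normc (F t m))) ->
  measurable_fun D (fun t => lnorm p%:E (F t)).
Proof.
move=> p0 mF.
have -> : (fun t => lnorm p%:E (F t)) = (fun x => x `^ p^-1)%E \o
    (fun t => \int[counting]_m ((normc (F t m)) `^ p)%:E)%E.
  apply/funext => t /=; rewrite -poweR_lnorm// -poweRrM divff ?gt_eqF//.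
  by rewrite poweRe1// lnorm_ge0.
apply: measurableT_comp; first exact: measurable_poweR.
apply: (@emeasurable_fun_cvg _ _ _ _
  (fun n t => \sum_(m <- zs n) (normc (F t m) `^ p)%:E)%E).
  move=> n; apply: emeasurable_sum => m; apply/measurable_EFinP.
  exact: (measurableT_comp (measurable_powR p)) (mF m).
move=> t Dt; apply: integral_counting_cvg => m; exact: powR_normc_ge0.
Qed.

(** [cousin] for boundedness: near x the distance to u x is below 1 by continuity, and bounds on
    adjacent intervals can be added. *)
Lemma l2_bounded_local u T : (forall t, 0 <= t -> (lnorm 2%:E (u t) < +oo)%E) ->
  (forall t, 0 <= t -> lnorm 2%:E (fun n => u s n - u t n)
      @[s --> within halfline (nbhs t)] --> 0%E) ->
  0 <= T -> exists2 B, 0 <= B & forall t, 0 <= t <= T -> l2_bounded (u t) B.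
Proof.
move=> fu cu T0.
pose P (a b : R) := exists2 B, 0 <= B & forall t, a <= t <= b -> l2_bounded (u t) B.
apply: (@cousin R P 0 T T0).
  move=> x y z _ _ _ _ [B B0 hB] [B' B'0 hB']; exists (B + B'); first exact: addr_ge0.
  move=> t /andP[xt tz] s us; have [ty|yt] := leP t y.
    apply: le_trans (hB t _ s us) _; first by rewrite xt.
    by rewrite lerXn2r ?nnegrE ?addr_ge0// lerDl.
  apply: le_trans (hB' t _ s us) _; first by rewrite ltW.
  by rewrite lerXn2r ?nnegrE ?addr_ge0// lerDr.
move=> x /andP[x0 xT]; have /lnorm2_bounded hx : (lnorm 2%:E (u x) <= (fine (lnorm 2%:E (u x)))%:E)%E.
  by rewrite fineK// ge0_fin_numE ?lnorm_ge0// fu.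
set B := fine _ in hx; have B0 : 0 <= B by rewrite fine_ge0// lnorm_ge0.
have /(_ [set y | (y < 1)%E]) := cu x x0.
case=> [|d /= d0 hd].
  by apply: open_nbhs_nbhs; split; [exact: open_ereal_lt_ereal|rewrite /= lte_fin ltr01].
exists d => // y z y0 yx xz zT dy zd; exists (2 * (1 + B)).
  by rewrite mulr_ge0// addr_ge0.
move=> t /andP[yt tz] s us.
have t0 : 0 <= t by exact: le_trans yt.
have /ltW/lnorm2_bounded/(_ s us) h1 : (lnorm 2%:E (fun n => u t n - u x n)%R < 1%:E)%E.
  apply: hd; last by rewrite /= /halfline /= in_itv /= t0.
  by rewrite /= ltr_distlC; apply/andP; split; lra.
have h2 := hx s us.
apply: (@le_trans _ _ (\sum_(m <- s) (2 * normc (u t m - u x m) ^+ 2 + 2 * normc (u x m) ^+ 2))).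
  by apply: ler_sum => m _; exact: normcB_sqr.
rewrite big_split /= -!mulr_sumr; move: h1 h2.
set S1 := \sum_(m <- s) _; set S2 := \sum_(m <- s) _ => h1 h2.
by clear -h1 h2 B0; nra.
Qed.
End NormMeasurability.

(** * Splitting the forcing at a level *)

Section PowerSplit.
Context {R : realType}.

Lemma powRD_pos (x r s : R) : 0 < x -> x `^ (r + s) = x `^ r * x `^ s.
Proof. by move=> x0; rewrite powRD// (gt_eqF x0) implybT. Qed.

Lemma sum_powR_le0 (s : seq int) (z : int -> R) p : 0 < p -> (forall m, 0 <= z m) ->
  \sum_(m <- s) z m `^ p <= 0 -> forall m, m \in s -> z m = 0.
Proof.
move=> p0 z0 h m ms; have : z m `^ p <= 0.
  apply: le_trans h; rewrite (big_rem m)//= lerDl.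
  by apply: sumr_ge0 => i _; exact: powR_ge0.
move=> h'; have /eqP/powR_eq0_eq0 : z m `^ p == 0 by rewrite eq_le h' powR_ge0.
exact.
Qed.

(* With w = z / x in [0, 1] and p1 = 2 b / (9 b - 8) in [1, 2], the threshold
   y ^ 9 for z is the threshold c = x ^ a for w, a = 9 b / 8 - 1 = b / (4 p1). *)
Lemma power_split (s : seq int) (z : int -> R) (x b p : R) :
  0 <= x -> 1 <= b -> 7 * b <= 8 -> 0 < p -> p * (9 * b - 8) <= 2 * b ->
  (forall m, 0 <= z m) -> \sum_(m <- s) z m `^ p <= x `^ p ->
  let y := x `^ (b / 8) in
  \sum_(m <- s | z m <= y ^+ 9) z m ^+ 2 <= (y ^+ 8) ^+ 2 /\
  \sum_(m <- s | ~~ (z m <= y ^+ 9)) z m <= y ^+ 7.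
Proof.
move=> x0 b1 b87 p0 pb z0 zx y; have y0 : 0 <= y by exact: powR_ge0.
have pN0 : p != 0 by rewrite gt_eqF.
move: x0; rewrite le_eqVlt => /predU1P[xE|x_gt0].
  rewrite -xE powR0// in zx; have zE := sum_powR_le0 p0 z0 zx.
  split; rewrite big_seq_cond big1 ?exprn_ge0// => m /andP[ms _].
    by rewrite zE// expr0n.
  exact: zE.
have x_neq0 : x != 0 by rewrite gt_eqF.
pose a := 9 * b / 8 - 1; have a0 : 0 < a by rewrite /a; lra.
pose p1 := b / (4 * a); have ap1 : a * p1 = b / 4 by rewrite /p1; field; rewrite gt_eqF.
have p1_ge1 : 1 <= p1 by rewrite /p1 ler_pdivlMr ?mulr_gt0//; rewrite /a; lra.
have p1_le2 : p1 <= 2 by rewrite /p1 ler_pdivrMr ?mulr_gt0//; rewrite /a; lra.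
have pp1 : p <= p1 by rewrite /p1 ler_pdivlMr ?mulr_gt0//; rewrite /a; lra.
have p1N0 : p1 != 0 by rewrite gt_eqF// (lt_le_trans ltr01).
pose c := x `^ a; have c0 : 0 < c by exact: powR_gt0.
pose w m := z m / x; have w0 m : 0 <= w m by rewrite divr_ge0// ltW.
have zE m : z m = w m * x by rewrite divfK.
have yX n : y ^+ n = x `^ (b / 8 * n%:R) by rewrite powRrM powR_mulrn.
have y9 : y ^+ 9 = c * x.
  rewrite yX -[X in _ = _ * X](powRr1 (ltW x_gt0)) -powRD_pos//; congr (_ `^ _).
  by rewrite /a; field.
have wp : \sum_(m <- s) w m `^ p <= 1.
  rewrite -(ler_pM2r (powR_gt0 p x_gt0)) mul1r mulr_suml; apply: le_trans zx.
  by apply: ler_sum => m _; rewrite zE powRM// ltW.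
have w1 m : m \in s -> w m <= 1.
  move=> ms; rewrite leNgt; apply/negP => h.
  suff : 1 < w m `^ p.
    apply/negP; rewrite -leNgt; apply: le_trans wp; rewrite (big_rem m)//= lerDl.
    by apply: sumr_ge0 => i _; exact: powR_ge0.
  have <- : 1 `^ p = 1 :> R by rewrite powR1.
  by apply: gt0_ltr_powR; rewrite ?nnegrE ?ler01.
(* All entries of [w] are at most 1, so the exponent may be raised from p to p1, where the powers of
   x on both sides agree exactly. *)
have wp1 : \sum_(m <- s) w m `^ p1 <= 1.
  apply: le_trans wp; rewrite big_seq [leRHS]big_seq; apply: ler_sum => m ms.
  have := w0 m; rewrite le_eqVlt => /predU1P[<-|wm]; first by rewrite !powR0.
  by apply: ger_powR => //; rewrite wm w1.
have wp1P (P : pred int) : \sum_(m <- s | P m) w m `^ p1 <= 1.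
  apply: le_trans wp1; rewrite [leRHS](bigID P) /= lerDl.
  by apply: sumr_ge0 => i _; exact: powR_ge0.
have cE r : c `^ r = x `^ (a * r) by rewrite /c powRrM.
split.
- apply: (@le_trans _ _ (\sum_(m <- s | z m <= y ^+ 9)
      w m `^ p1 * (c `^ (2 - p1) * x ^+ 2))).
    apply: ler_sum => m; rewrite y9 zE ler_pM2r// exprMn mulrA => wc.
    rewrite ler_pM2r ?exprn_gt0//.
    have := w0 m; rewrite le_eqVlt => /predU1P[<-|wm].
      by rewrite expr0n /= mulr_ge0// powR_ge0.
    rewrite -(powR_mulrn 2 (ltW wm)) -[X in _ `^ X](subrK p1) addrC powRD_pos//.
    rewrite ler_pM2l ?powR_gt0//; apply: ge0_ler_powR; rewrite ?nnegrE ?subr_ge0//.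
    exact: ltW.
  rewrite -mulr_suml; apply: (@le_trans _ _ (1 * (c `^ (2 - p1) * x ^+ 2))).
    by apply: ler_wpM2r (wp1P _); rewrite mulr_ge0 ?powR_ge0// exprn_ge0// ltW.
  rewrite mul1r cE -powR_mulrn ?(ltW x_gt0)// -powRD_pos// yX.
  rewrite -[leRHS]powR_mulrn ?powR_ge0// -powRrM le_eqVlt; apply/orP; left; apply/eqP.
  congr (_ `^ _); have -> : a * (2 - p1) = 2 * a - a * p1 by ring.
  by rewrite ap1 /a; field.
apply: (@le_trans _ _ (\sum_(m <- s | ~~ (z m <= y ^+ 9))
    w m `^ p1 * (c `^ (1 - p1) * x))).
  apply: ler_sum => m; rewrite y9 zE ler_pM2r// -ltNge mulrA => wc.
  rewrite ler_pM2r//; have wm : 0 < w m by exact: lt_trans wc.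
  have cc : c `^ (p1 - 1) * c `^ (1 - p1) = 1.
    by rewrite -powRD_pos// (_ : _ + _ = 0) ?powRr0//; ring.
  apply: (@le_trans _ _ (w m * (c `^ (p1 - 1) * c `^ (1 - p1)))).
    by rewrite cc mulr1.
  rewrite mulrA ler_pM2r ?powR_gt0//.
  rewrite -[X in X * _](powRr1 (ltW wm)).
  have -> : w m `^ p1 = w m `^ 1 * w m `^ (p1 - 1).
    by rewrite -powRD_pos//; congr (_ `^ _); ring.
  rewrite ler_pM2l ?powR_gt0//; apply: ge0_ler_powR; rewrite ?nnegrE ?subr_ge0// ltW//.
rewrite -mulr_suml; apply: (@le_trans _ _ (1 * (c `^ (1 - p1) * x))).
  by apply: ler_wpM2r (wp1P _); rewrite mulr_ge0 ?powR_ge0// ltW.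
rewrite mul1r cE -[X in _ * X](powRr1 (ltW x_gt0)) -powRD_pos// yX.
rewrite le_eqVlt; apply/orP; left; apply/eqP; congr (_ `^ _).
have -> : a * (1 - p1) = a - a * p1 by ring.
by rewrite ap1 /a; field.
Qed.

(** Cauchy-Schwarz below the level y ^ 9, the supremum of k above it. *)
Lemma split_pairing (s : seq int) (z : int -> R) (k : int -> R[i]) (x b p Y kap : R) :
  0 <= x -> 1 <= b -> 7 * b <= 8 -> 0 < p -> p * (9 * b - 8) <= 2 * b ->
  (forall m, 0 <= z m) -> \sum_(m <- s) z m `^ p <= x `^ p ->
  uniq s -> 0 <= Y -> l2_bounded k Y -> (forall m, normc (k m) <= kap) ->
  \sum_(m <- s) normc (k m) * z m <=
    Y * (x `^ (b / 8)) ^+ 8 + kap * (x `^ (b / 8)) ^+ 7.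
Proof.
move=> x0 b1 b87 p0 pb z0 zx us Y0 kY kk.
have [h1 h2] := power_split x0 b1 b87 p0 pb z0 zx.
move: h1 h2; set y := x `^ (b / 8) => h1 h2.
have y0 : 0 <= y by exact: powR_ge0.
have kap0 : 0 <= kap by apply: le_trans (kk 0); exact: normc_ge0.
rewrite (bigID (fun m => z m <= y ^+ 9)) /=; apply: lerD.
  rewrite -big_filter; apply: cauchy_schwarz => //; first exact: exprn_ge0.
    exact/kY/filter_uniq.
  by rewrite big_filter.
apply: le_trans (ler_wpM2l kap0 h2); rewrite mulr_sumr; apply: ler_sum => m _.
by rewrite ler_wpM2r.
Qed.

End PowerSplit.

Section FlowOfSolution.
Context {R : realType}.
Notation mu := (@lebesgue_measure R).
Notation nu := (@halfline_lebesgue R).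
Notation Dom := (@halfline R).

(** Normalised so that the eighth power, the b-th power of the norm of F(t) / D, has integral at
    most 1 when D bounds the mixed norm of F. An infinite norm is read as 0 by [fine]; integrability
    of the b-th power confines this to a null set of times. *)
Definition forcing_profile (F : R -> int -> R[i]) (b p D : R) : R -> R :=
  (fun t => (fine (lnorm p%:E (F t)) / D) `^ (b / 8)) \_ Dom.

Variables (F u : R -> int -> R[i]) (b p D : R).
Hypotheses (mF : measurable_forcing F) (sol : bi_schrodinger_solution F u).
Hypotheses (b1 : 1 <= b) (b87 : 7 * b <= 8) (p0 : 0 < p).
Hypotheses (pb : p * (9 * b - 8) <= 2 * b) (D0 : 0 < D).
Hypothesis u0D : (lnorm 2%:E (u 0) <= D%:E)%E.
Hypothesis FD : (mixed_norm b%:E p%:E F <= D%:E)%E.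

Notation y := (forcing_profile F b p D).
Let l t := lnorm p%:E (F t).

Let b0 : 0 < b. Proof. exact: lt_le_trans ltr01 b1. Qed.
Let ml : measurable_fun Dom l.
Proof.
by apply: measurable_lnorm => // m; apply: measurable_normc; have [] := mF m.
Qed.

Let mlb : measurable_fun Dom (fun t => (l t `^ b)%E).
Proof. by apply: (@measurableT_comp _ _ _ _ _ _ (fun x => x `^ b)%E); [exact: measurable_poweR|exact: ml]. Qed.

Let int_lb : (\int[mu]_(t in Dom) l t `^ b <= (D `^ b)%:E)%E.
Proof.
rewrite -integral_halfline -poweR_EFin.
have h : (mixed_norm b%:E p%:E F `^ b <= D%:E `^ b)%E.
  apply: gt0_ler_poweR (ltW b0) _ _ _ _ FD; rewrite in_itv /= leey andbT.
    exact: Lnorm_ge0.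
  by rewrite lee_fin ltW.
apply: le_trans h; rewrite poweR_Lnorm ?gt_eqF//.
apply: le_trans (ge0_integral_setT_ge _ _ _); last by move=> t; exact: poweR_ge0.
rewrite le_eqVlt; apply/orP; left; apply/eqP; apply: eq_integral => t _.
by rewrite gee0_abs// lnorm_ge0.
Qed.

Let y0 t : 0 <= y t.
Proof. by rewrite /forcing_profile patchE; case: ifP => // _; exact: powR_ge0. Qed.

Let my : measurable_fun setT y.
Proof.
apply/(measurable_restrictT _ measurable_halfline).
apply: (measurableT_comp (measurable_powR (b / 8))).
apply: measurable_funM => //; apply: (measurableT_comp (fine_measurable _) ml) => //.
Qed.

Let y8 t : Dom t -> y t ^+ 8 = (fine (l t) / D) `^ b.
Proof.
move=> Dt; rewrite /forcing_profile patchE mem_set// -powR_mulrn ?powR_ge0// -powRrM.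
by rewrite divfK.
Qed.

Let int_y8 : (\int[mu]_(t in Dom) (y t ^+ 8)%:E <= 1)%E.
Proof.
apply: (@le_trans _ _ (\int[mu]_(t in Dom) ((D^-1 `^ b)%:E * (l t `^ b)))%E).
  apply: ge0_le_integral => //.
  - exact: measurable_halfline.
  - by move=> t _; rewrite lee_fin exprn_ge0.
  - apply/measurable_EFinP; apply: measurable_funX; exact: measurable_funS my.
  - exact: measurable_funeM mlb.
  - move=> t Dt; rewrite y8// powRM ?fine_ge0 ?lnorm_ge0 ?invr_ge0 ?(ltW D0)// mulrC.
    rewrite EFinM lee_wpmul2l ?lee_fin ?powR_ge0// -fine_poweR.
    have := lnorm_ge0 p%:E (F t); rewrite -/(l t); case: (l t) => [r| |] //= _.
    by rewrite gt_eqF// leey.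
rewrite ge0_integralZl//; last 3 first.
- exact: measurable_halfline.
- by move=> t _; exact: poweR_ge0.
- by rewrite lee_fin powR_ge0.
apply: (@le_trans _ _ ((D^-1 `^ b)%:E * (D `^ b)%:E)%E).
  by rewrite lee_wpmul2l// lee_fin powR_ge0.
by rewrite -EFinM -powRM ?invr_ge0 ?(ltW D0)// mulVf ?gt_eqF// powR1.
Qed.

Let int_y8_itv (T : R) : (\int[mu]_(t in `[0%R, T]) (y t ^+ 8)%:E <= 1)%E.
Proof.
apply: le_trans int_y8; apply: ge0_subset_integral => //.
- exact: measurable_halfline.
- apply/measurable_EFinP; apply: measurable_funX; exact: measurable_funS my.
- by move=> t _; rewrite lee_fin exprn_ge0.
- by move=> t; rewrite /Dom /= !in_itv /= => /andP[->].
Qed.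

Lemma forced_flow_of_solution : forced_flow u F y D.
Proof.
have FF := ae_filter_ringOfSetsType mu.
split => //.
- by move=> T T0; apply: l2_bounded_local T0; [exact: solution_l2 sol|exact: solution_continuous sol].
- by move=> m T T0; exact: (solution_abs_continuous sol).
- apply: (@filterS _ _ FF _ _ _ (solution_equation sol)) => t ht t0 m.
  have [[dr di] eq] := ht t0 m.
  have <- : cderive (fun s => u s m) t = - 'i%C * dbilaplacian (u t) m + 'i%C * F t m.
    have ii : 'i%C * 'i%C = -1 :> R[i] by rewrite -expr2 sqr_i.
    have -> : dbilaplacian (u t) m = 'i%C * cderive (fun s => u s m) t + F t m.
      by apply/esym/eqP; rewrite -subr_eq0; apply/eqP; rewrite -[RHS]eq; ring.
    by rewrite mulNr mulrDr mulrA ii; ring.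
  by split; rewrite /cderive /= derive1E; exact: derivableP.
- exact: ltW.
- exact: lnorm2_bounded.
- move=> T; apply/integrableP; split.
    apply/measurable_EFinP; apply: measurable_funX; exact: measurable_funS my.
  apply: (@le_lt_trans _ _ 1%E); last by rewrite ltry.
  apply: le_trans (int_y8_itv T); rewrite le_eqVlt; apply/orP; left; apply/eqP.
  by apply: eq_integral => t _; rewrite /= ger0_norm// exprn_ge0.
- move=> T; rewrite /Rintegral -lee_fin fineK// ge0_fin_numE.
    by apply: le_lt_trans (int_y8_itv T) _; rewrite ltry.
  by apply: integral_ge0 => t _; rewrite lee_fin exprn_ge0.
have ilb : mu.-integrable Dom (fun t => (l t `^ b)%E).
  apply/integrableP; split => //; apply: (@le_lt_trans _ _ (D `^ b)%:E); last by rewrite ltry.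
  apply: le_trans int_lb; rewrite le_eqVlt; apply/orP; left; apply/eqP.
  by apply: eq_integral => t _; rewrite gee0_abs ?poweR_ge0.
have fin_ae : {ae mu, forall t, Dom t -> (l t `^ b)%E \is a fin_num}.
  have h := @integrable_ae _ _ R mu Dom (measurable_itv _) _ ilb; exact: h.
apply: (@filterS _ _ FF _ _ _ fin_ae) => t ht t0 s k Y kap us Y0 k0 kY kk.
have Dt : Dom t by rewrite /halfline /= in_itv /= ltW.
have lf : lnorm p%:E (F t) = (fine (l t))%:E.
  rewrite fineK// ge0_fin_numE ?lnorm_ge0//.
  apply: (@lty_poweRy _ _ b); first by rewrite gt_eqF.
  by rewrite -ge0_fin_numE ?poweR_ge0// ht.
have l0 : 0 <= fine (l t) by rewrite fine_ge0// lnorm_ge0.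
have := @sum_powR_le_lnorm R (F t) p (fine (l t)) s p0 _ us.
rewrite lf lexx => /(_ isT) Fl.
have yE : y t = (fine (l t) / D) `^ (b / 8) by rewrite /forcing_profile patchE mem_set.
have -> : \sum_(m <- s) normc (k m) * normc (F t m) =
    D * \sum_(m <- s) normc (k m) * (normc (F t m) / D).
  by rewrite mulr_sumr; apply: eq_bigr => m _; rewrite mulrCA [D * _]mulrC divfK ?gt_eqF.
rewrite ler_pM2l// yE; apply: (@split_pairing R s (fun m => normc (F t m) / D) k _ b p) => //.
- by rewrite divr_ge0// ltW.
- by move=> m; rewrite divr_ge0 ?normc_ge0// ltW.
rewrite powRM ?invr_ge0 ?(ltW D0)//; under eq_bigr do rewrite powRM ?normc_ge0 ?invr_ge0 ?(ltW D0)//.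
by rewrite -mulr_suml ler_wpM2r// powR_ge0.
Qed.

End FlowOfSolution.

(** * Strichartz estimates *)

Section Exponents.
Context {R : realType}.
Implicit Types (q r : \bar R).

(* e stands for 2 / r, the condition on the pair being 8 / q <= 1 - e. *)
Lemma strichartz_pairs_exponent q r : strichartz_pairs R (q, r) ->
  exists e : R, [/\ 0 <= e <= 1,
    (r = +oo%E /\ e = 0) \/ (exists r0 : R, [/\ r = r0%:E, 2 <= r0 & e = 2 / r0]) &
    q = +oo%E \/ (exists q0 : R, q = q0%:E /\ 8 <= q0 * (1 - e))].
Proof.
move=> [/= _]; case: q => [q| |]; case: r => [r| |] //=; rewrite ?lee_fin.
- move=> + q2 r2; have q0 : 0 < q by exact: lt_le_trans q2.
  have r0 : 0 < r by exact: lt_le_trans r2.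
  rewrite -EFinM !inver !gt_eqF ?mulr_gt0// -EFinD lee_fin => h.
  exists (2 / r); split.
  + by rewrite divr_ge0 ?(ltW r0)//= ler_pdivrMr// mul1r.
  + by right; exists r.
  right; exists q; split => //.
  have := ler_wpM2l (ltW q0) h; rewrite mulrDr divff ?gt_eqF//.
  have -> : q * (4 * r)^-1 = q * (2 / r) / 8 by field; rewrite gt_eqF.
  by move=> h2; rewrite mulrBr mulr1; lra.
- move=> + q2 _; have q0 : 0 < q by exact: lt_le_trans q2.
  rewrite gt0_muley ?lte_fin// invey adde0 inver gt_eqF// lee_fin => h.
  exists 0; split; [by rewrite lexx ler01|by left|right].
  exists q; split => //; rewrite subr0 mulr1.
  have := ler_wpM2l (ltW q0) h; rewrite divff ?gt_eqF//; lra.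
- move=> _ _ r2; have r0 : 0 < r by exact: lt_le_trans r2.
  exists (2 / r); split; [|by right; exists r|by left].
  by rewrite divr_ge0 ?(ltW r0)//= ler_pdivrMr// mul1r.
- by move=> _ _ _; exists 0; split; [rewrite lexx ler01|left|left].
Qed.

Lemma hoelder_conjugate_fin (x : R) : 1 < x ->
  hoelder_conjugate x%:E = (x / (x - 1))%:E.
Proof.
move=> x1; rewrite /hoelder_conjugate /=.
rewrite eqe gt_eqF ?(lt_trans ltr01)// -EFinB inver subr_eq0 gt_eqF// -EFinM //.
Qed.

(** With e = 2 / r the dual exponent of r is p = 2 / (2 - e). The condition 8 / q <= 1 - e turns
    into b (7 + e) <= 8, which is equivalent to p (9 b - 8) <= 2 b, the hypothesis of
    [power_split]. *)
Lemma strichartz_pairs_dual q r : strichartz_pairs R (q, r) -> exists b p : R,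
  [/\ hoelder_conjugate q = b%:E, hoelder_conjugate r = p%:E,
      1 <= b, 7 * b <= 8 & 0 < p /\ p * (9 * b - 8) <= 2 * b].
Proof.
move=> /strichartz_pairs_exponent[e [/andP[e0 e1] re qe]].
have e2 : 0 < 2 - e by lra.
have pE : hoelder_conjugate r = (2 / (2 - e))%:E.
  case: re => [[-> ->]|[r0 [-> r2 eE]]].
    by rewrite /hoelder_conjugate eqxx subr0 divff.
  have r0' : 0 < r0 by lra.
  have r1 : 0 < r0 - 1 by lra.
  rewrite hoelder_conjugate_fin; last by lra.
  rewrite eE; congr EFin; field; rewrite !gt_eqF//; lra.
have main b : 0 < b -> b * (7 + e) <= 8 -> 1 <= b ->
    [/\ 1 <= b, 7 * b <= 8 & 0 < 2 / (2 - e) /\ 2 / (2 - e) * (9 * b - 8) <= 2 * b].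
  move=> b0 hb b1; split => //; first by nra.
  split; first by rewrite divr_gt0.
  by rewrite mulrAC ler_pdivrMr//; nra.
case: qe => [->|[q0 [-> hq]]].
  exists 1, (2 / (2 - e)); have [|||h1 h2 h3] := main 1; [lra..|].
  by split => //; rewrite /hoelder_conjugate eqxx.
have q1 : 1 < q0 by nra.
have q10 : 0 < q0 - 1 by lra.
exists (q0 / (q0 - 1)), (2 / (2 - e)); have [|||h1 h2 h3] := main (q0 / (q0 - 1)).
- by rewrite divr_gt0//; lra.
- by rewrite mulrAC ler_pdivrMr//; lra.
- by rewrite ler_pdivlMr//; lra.
by split => //; exact: hoelder_conjugate_fin.
Qed.

End Exponents.

(** * From unit windows to mixed norms *)

Section Windows.
Context {R : realType}.
Notation mu := (@lebesgue_measure R).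
Notation nu := (@halfline_lebesgue R).

Lemma integral_windows (c : nat -> R) (B : R) : (forall j, 0 <= c j) ->
  (forall J, \sum_(0 <= j < J) c j <= B) -> forall f : R -> \bar R,
  (forall t, 0 <= f t)%E ->
  (forall j t, j%:R <= t <= j.+1%:R -> (f t <= (c j)%:E)%E) ->
  (\int[nu]_t f t <= B%:E)%E.
Proof.
move=> c0 cB f f0 fc; pose W j : set R := `[j%:R, j.+1%:R]%classic.
have mI j : measurable (W j) by exact: measurable_itv.
have mC : measurable (~` halfline : set R) by exact: measurableC measurable_halfline.
(* A measurable majorant of f, which itself may fail to be measurable. It is infinite at negative
   times, where nothing is known about f and where the measure has no mass. *)
pose g (t : R) := (\sum_(0 <= j <oo) ((c j)%:E * (\1_(W j) t)%:E) +
   +oo * (\1_(~` halfline) t : R)%:E)%E.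
have g1 t j : (0 <= (c j)%:E * (\1_(W j) t)%:E)%E.
  by rewrite mule_ge0 ?lee_fin.
have g2 t : (0 <= \sum_(0 <= j <oo) ((c j)%:E * (\1_(W j) t)%:E))%E.
  exact: nneseries_ge0.
apply: (@le_trans _ _ (\int[nu]_t g t)%E).
  apply: ge0_le_integral_nonmeas => // t; have [t0|t0] := ltP t 0.
    rewrite /g indicE mem_set; last by rewrite /= /halfline /= in_itv /= andbT; apply/negP; rewrite -ltNge.
    rewrite mule1 addey ?leey//.
    by apply: contraTneq (g2 t) => ->.
  pose j := Num.truncn t.
  have tj : j%:R <= t <= j.+1%:R by rewrite truncn_le t0 /= ltW ?truncnS_gt.
  apply: le_trans (fc j t tj) _; rewrite /g.
  apply: (@le_trans _ _ (\sum_(0 <= j <oo) ((c j)%:E * (\1_(W j) t)%:E))%E); last first.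
    by rewrite leeDl// mule_ge0 ?lee_fin.
  apply: le_trans (nneseries_lim_ge j.+1 _) => //.
  rewrite big_nat_recr//= indicE mem_set//= mule1 leeDr//.
  by apply: sume_ge0 => i _.
have m1 j : measurable_fun setT (fun t => ((c j)%:E * (\1_(W j) t)%:E)%E).
  by apply: measurable_funeM; apply/measurable_EFinP; exact: measurable_indic.
have m2 : measurable_fun setT (fun t : R => (+oo * (\1_(~` halfline) t : R)%:E)%E).
  by apply: measurable_funeM; apply/measurable_EFinP; exact: measurable_indic.
have m3 : measurable_fun setT (fun t : R => (\sum_(0 <= j <oo) ((c j)%:E * (\1_(W j) t)%:E))%E).
  exact: ge0_emeasurable_sum.
rewrite /g ge0_integralD//.
have -> : (\int[nu]_t (+oo * (\1_(~` halfline) t : R)%:E) = 0)%E.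
  rewrite ge0_integralZl ?integral_indic//.
    by rewrite setIT /= /mrestr setICl measure0 mule0.
  by apply/measurable_EFinP; exact: measurable_indic.
rewrite adde0 integral_nneseries//.
apply: lime_le; first by apply: is_cvg_nneseries => j _ _; apply: integral_ge0.
apply: nearW => J; apply: (@le_trans _ _ (\sum_(0 <= j < J) c j)%:E); last first.
  by rewrite lee_fin.
rewrite -sumEFin; apply: lee_sum => j _.
have m0 : measurable_fun setT (fun t : R => (\1_(W j) t : R)%:E).
  by apply/measurable_EFinP; exact: measurable_indic.
rewrite ge0_integralZl ?lee_fin// integral_indic//; last exact: mI.
rewrite setIT -[leRHS]mule1; apply: lee_wpmul2l; first by rewrite lee_fin.
rewrite /= /mrestr; apply: (@le_trans _ _ (mu (W j))).
  have mWD : measurable (W j `&` `[0%R, +oo[) by exact: measurableI.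
  apply: le_measure; rewrite ?inE; [exact: mWD|exact: mI|exact: subIsetl].
rewrite lebesgue_measure_itv /= lte_fin ltr_nat ltnSn -EFinB lee_fin -natr1; lra.
Qed.

End Windows.

Section FlowNorms.
Context {R : realType}.

(** A power r0 is split into a square, summed by the l^2 bound, and a power r0 - 2, estimated by the
    supremum. *)
Lemma lnorm_interpolation (phi : int -> R[i]) (r : \bar R) (A s e : R) :
  0 < A -> 0 <= s <= 1 -> l2_bounded phi A -> (forall m, normc (phi m) <= A * s) ->
  (r = +oo%E /\ e = 0) \/ (exists r0 : R, [/\ r = r0%:E, 2 <= r0 & e = 2 / r0]) ->
  (lnorm r phi <= (A * s `^ (1 - e))%:E)%E.
Proof.
move=> A0 /andP[s0 s1] phiA phis [[-> ->]|[r0 [-> r2 ->]]].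
  by rewrite subr0 powRr1//; exact: lnorm_oo_le.
have r0_gt0 : 0 < r0 by lra.
apply: lnorm_le => //; first by rewrite mulr_ge0 ?powR_ge0// ltW.
move=> n; rewrite powRM ?powR_ge0 ?(ltW A0)// -powRrM.
have -> : (1 - 2 / r0) * r0 = r0 - 2 by field; rewrite gt_eqF.
have splitp (x : R) : 0 <= x -> x `^ r0 = x ^+ 2 * x `^ (r0 - 2).
  move=> x0; rewrite -powR_mulrn// -powRD; first by congr (_ `^ _); ring.
  by rewrite gt_eqF//; lra.
apply: (@le_trans _ _ (\sum_(m <- zs n) normc (phi m) ^+ 2 * (A * s) `^ (r0 - 2))).
  apply: ler_sum => m _; rewrite splitp ?normc_ge0// ler_wpM2l ?sqr_ge0//.
  apply: ge0_ler_powR (phis m); rewrite ?nnegrE ?normc_ge0 ?mulr_ge0 ?(ltW A0)//.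
  by rewrite subr_ge0.
rewrite -mulr_suml powRM ?(ltW A0)// (splitp A (ltW A0)) -mulrA.
by apply: ler_wpM2r; [rewrite mulr_ge0 ?powR_ge0|exact/phiA/uniq_zs].
Qed.


Variables (u F : R -> int -> R[i]) (y : R -> R) (D : R).
Hypothesis flow : forced_flow u F y D.
Hypothesis D_gt0 : 0 < D.
Notation mu := (@lebesgue_measure R).
Notation nu := (@halfline_lebesgue R).

(** The factor 2 pays for the near-extremal sample points of [near_sup]; the value also exceeds the
    constant 722 of the l^2 bound. *)
Definition strichartz_const : R := 2 * sampled_const.

Lemma strichartz_const_ge : 722 <= strichartz_const.
Proof. rewrite /strichartz_const /sampled_const; lra. Qed.

Let A := strichartz_const * D.

Let A0 : 0 < A.
Proof.
apply: mulr_gt0 D_gt0; apply: lt_le_trans strichartz_const_ge.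
by rewrite ltr0n.
Qed.

Lemma flow_l2_bounded t : 0 <= t -> l2_bounded (u t) A.
Proof.
move=> t0 s us; apply: le_trans (l2_estimate flow t0 us) _.
have h : 722 * D <= A.
  by rewrite /A; apply: ler_wpM2r; [exact: ltW|exact: strichartz_const_ge].
have h0 : 0 <= 722 * D by exact: mulr_ge0 (ler0n _ 722) (ltW D_gt0).
have sq (x z : R) : 0 <= x -> x <= z -> x ^+ 2 <= z ^+ 2.
  by move=> x0 xz; rewrite lerXn2r ?nnegrE// (le_trans x0).
exact: sq h0 h.
Qed.

(** [sampled_estimate] leaves the sample points free, so near-extremal ones turn it into a bound on
    the suprema over whole windows. *)
Lemma flow_windows : exists sigma : nat -> R,
  [/\ forall j, 0 <= sigma j <= 1,
      forall J, \sum_(0 <= j < J) sigma j ^+ 8 <= 1 &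
      forall j t m, j%:R <= t <= j.+1%:R -> normc (u t m) <= A * sigma j].
Proof.
have /choice[w wP] : forall j, exists w : R * int, j%:R <= w.1 <= j.+1%:R /\
    forall t m, j%:R <= t <= j.+1%:R -> normc (u t m) <= 2 * normc (u w.1 w.2).
  move=> j; pose S := [set x | exists t m, j%:R <= t <= j.+1%:R /\ x = normc (u t m)].
  have [||x [t [m [ht ->]]] hx] := @near_sup R S A.
  - by exists (normc (u j%:R 0)), j%:R, 0; rewrite lexx ler_nat leqnSn.
  - move=> x [t [m [/andP[jt _] ->]]]; rewrite normc_ge0/=.
    apply: l2_bounded_normc; first exact: ltW.
    by apply: flow_l2_bounded; exact: le_trans jt.
  by exists (t, m); split => // t' m' ht'; apply: hx; exists t', m'.
pose sigma j := 2 * normc (u (w j).1 (w j).2) / A.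
have s0 j : 0 <= sigma j by apply: divr_ge0 (ltW A0); rewrite mulr_ge0 ?normc_ge0.
have sum1 J : \sum_(0 <= j < J) sigma j ^+ 8 <= 1.
  have := @sampled_estimate R u F y D flow J (fun j => (w j).1) (fun j => (w j).2)
    (fun j => (wP j).1).
  have sD : 0 < sampled_const * D.
    by have := A0; rewrite /A /strichartz_const -mulrA pmulr_rgt0.
  move=> h.
  have -> : \sum_(0 <= j < J) sigma j ^+ 8 =
      (\sum_(0 <= j < J) normc (u (w j).1 (w j).2) ^+ 8) / (sampled_const * D) ^+ 8.
    rewrite mulr_suml; apply: eq_bigr => j _; rewrite -expr_div_n; congr (_ ^+ _).
    rewrite /sigma /A /strichartz_const; field.
    by have := gt_eqF sD; rewrite mulf_eq0 orbC => /negbT; rewrite negb_or.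
  by rewrite ler_pdivrMr ?exprn_gt0// mul1r.
exists sigma; split => //.
- move=> j; rewrite s0 /=; have : sigma j ^+ 8 <= 1.
    apply: le_trans (sum1 j.+1); rewrite big_nat_recr//= lerDr.
    by apply: sumr_ge0 => i _; exact: exprn_ge0.
  by rewrite expr_le1.
- move=> j t m /(wP j).2 h; apply: le_trans (h m) _.
  by rewrite /sigma [leRHS]mulrC divfK ?lexx// (gt_eqF A0).
Qed.

(** Interpolation bounds the norm of u on window j by A sigma_j ^ (1 - e). As sigma_j <= 1 and q (1
    - e) >= 8, its q-th power is at most A ^ q sigma_j ^ 8, which is summable; for q = +oo the bound
    sigma_j <= 1 is enough. *)
Lemma strichartz_bound (q r : \bar R) : strichartz_pairs R (q, r) ->
  (mixed_norm q r u <= A%:E)%E.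
Proof.
move=> /strichartz_pairs_exponent[e [/andP[e0 e1] re qe]].
have [sigma [s01 sum1 us]] := flow_windows.
have bound j t : j%:R <= t <= j.+1%:R -> (lnorm r (u t) <= (A * sigma j `^ (1 - e))%:E)%E.
  move=> jt; apply: lnorm_interpolation => //.
    by apply: flow_l2_bounded; case/andP: jt => h _; exact: le_trans h.
  by move=> m; exact: us.
rewrite /mixed_norm; case: qe => [->|[q0 [-> hq]]].
  rewrite unlock; case: ifP => _; last by rewrite lee_fin ltW.
  apply/ess_supP; apply: ae_halfline; apply: aeW => t Dt /=.
  have t0 : 0 <= t by move: Dt; rewrite /halfline /= in_itv /= andbT.
  rewrite gee0_abs ?lnorm_ge0//.
  have tj : (Num.truncn t)%:R <= t <= (Num.truncn t).+1%:R.
    by rewrite truncn_le t0 /= ltW ?truncnS_gt.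
  apply: le_trans (bound _ t tj) _; rewrite lee_fin -[leRHS]mulr1 ler_pM2l//.
  have /andP[h0 h1] := s01 (Num.truncn t).
  apply: (@le_trans _ _ (1 `^ (1 - e))); last by rewrite powR1.
  by apply: ge0_ler_powR; rewrite ?nnegrE ?subr_ge0 ?ler01.
have q0_gt0 : 0 < q0 by nra.
have AE : A%:E = ((A `^ q0)%:E `^ q0^-1)%E.
  by rewrite poweR_EFin -powRrM divff ?gt_eqF// powRr1// ltW.
rewrite unlock AE; apply: gt0_ler_poweR.
- by rewrite invr_ge0 ltW.
- by rewrite in_itv /= leey andbT integral_ge0// => t _; exact: poweR_ge0.
- by rewrite in_itv /= leey lee_fin powR_ge0.
apply: (@integral_windows R (fun j => A `^ q0 * sigma j ^+ 8)).
- by move=> j; rewrite mulr_ge0 ?powR_ge0// exprn_ge0//; case/andP: (s01 j).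
- by move=> J; rewrite -mulr_sumr -[leRHS]mulr1 ler_wpM2l ?powR_ge0.
- by move=> t; exact: poweR_ge0.
move=> j t jt; have /andP[h0 h1] := s01 j; rewrite gee0_abs ?lnorm_ge0//.
apply: (@le_trans _ _ ((A * sigma j `^ (1 - e))%:E `^ q0)%E).
  apply: gt0_ler_poweR (bound j t jt); first exact: ltW.
  - by rewrite in_itv /= lnorm_ge0 leey.
  - by rewrite in_itv /= leey lee_fin mulr_ge0 ?powR_ge0// ltW.
rewrite poweR_EFin lee_fin powRM ?powR_ge0 ?(ltW A0)// ler_wpM2l ?powR_ge0//.
rewrite -powRrM -powR_mulrn//; move: h0; rewrite le_eqVlt => /predU1P[<-|h0].
  by rewrite !powR0// ?pnatr_eq0// gt_eqF// mulrC; lra.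
by apply: ger_powR; rewrite ?h0// mulrC.
Qed.

End FlowNorms.

Section Strichartz.
Context {R : realType}.

Lemma strichartz_estimate (q r q' r' : \bar R) :
  strichartz_pairs R (q, r) -> strichartz_pairs R (q', r') ->
  exists C : R, forall F u : R -> int -> R[i],
    measurable_forcing F -> bi_schrodinger_solution F u ->
    (mixed_norm q r u <=
     C%:E * (lnorm 2%:E (u 0%R) +
             mixed_norm (hoelder_conjugate q') (hoelder_conjugate r') F))%E.
Proof.
move=> qr qr'; have [b [p [-> -> b1 b87 [p0 pb]]]] := strichartz_pairs_dual qr'.
exists strichartz_const => F u mF sol.
have C0 : 0 < (strichartz_const : R).
  by apply: lt_le_trans strichartz_const_ge; rewrite ltr0n.
set X := (_ + _)%E.
have u0X : (lnorm 2%:E (u 0%R) <= X)%E by rewrite leeDl// Lnorm_ge0.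
have FX : (mixed_norm b%:E p%:E F <= X)%E by rewrite leeDr// lnorm_ge0.
have X0 : (0 <= X)%E by exact: le_trans (lnorm_ge0 _ _) u0X.
move: X X0 u0X FX => [x| |] //; last first.
  by move=> _ _ _; rewrite gt0_muley ?lte_fin// leey.
rewrite lee_fin => x0 u0x Fx; apply/lee_addgt0Pr => eps eps0.
(* The right-hand side may vanish, whereas the normalisation divides by D; hence a perturbation that
   costs [eps]. *)
have D0 : 0 < x + eps / strichartz_const by rewrite ltr_wpDl// divr_gt0.
have xD : (x%:E <= (x + eps / strichartz_const)%:E)%E.
  by rewrite lee_fin lerDl divr_ge0// ltW.
have flow := forced_flow_of_solution mF sol b1 b87 p0 pb D0
  (le_trans u0x xD) (le_trans Fx xD).
apply: le_trans (strichartz_bound flow D0 qr) _.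
by rewrite -EFinM -EFinD lee_fin mulrDr mulrCA divff ?gt_eqF// mulr1.
Qed.

End Strichartz.

(** * The exponential series and the decay estimate *)

Section TaylorRemainder.
Context {R : realType}.
Implicit Types (f df : R -> R) (s t B M : R) (z : R[i]).

Lemma is_derive_pow k t : is_derive t 1 (fun s => s ^+ k.+1) (k.+1%:R * t ^+ k).
Proof.
elim: k => [|k IH].
  by apply: is_derive_eq (is_derive_id t 1) _; rewrite expr0 mulr1.
rewrite (_ : (fun s => s ^+ k.+2) = fun s => s * s ^+ k.+1); last first.
  by apply/funext => s; rewrite exprS.
apply: is_derive_eq (derM (is_derive_id t 1) IH) _.
by rewrite mul1r mulrCA -exprS -[k.+2%:R]natr1 mulrDl mul1r addrC.
Qed.

Lemma power_growth f df M k t : 0 <= t -> f 0 = 0 ->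
  (forall s, is_derive s 1 f (df s)) ->
  (forall s, 0 <= s -> `|df s| <= M * (s ^+ k / k`!%:R)) ->
  `|f t| <= M * (t ^+ k.+1 / k.+1`!%:R).
Proof.
move=> t0 f0 fdf dfM; pose g s := M * (s ^+ k.+1 / k.+1`!%:R).
have dg s : is_derive s 1 g (M * (s ^+ k / k`!%:R)).
  rewrite (_ : g = fun s => (M / k.+1`!%:R) * s ^+ k.+1); last first.
    by apply/funext => x; rewrite /g [_ / _]mulrC mulrA.
  apply: is_derive_eq (derMl _ (is_derive_pow k s)) _.
  rewrite factS natrM; field.
  by rewrite nat1r !pnatr_eq0 -!lt0n fact_gt0.
have g0 : g 0 = 0 by rewrite /g expr0n mul0r mulr0.
rewrite -/(g t) ler_norml; apply/andP; split.
  have := @derive_ge0_le R (fun s => g s + f s) _ 0 t t0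
    (fun s _ => derD (dg s) (fdf s)).
  rewrite g0 f0 addr0 => h; rewrite -subr_ge0 opprK addrC; apply: h => s /andP[s0 _].
  have := dfM s s0; rewrite ler_norml => /andP[h _]; lra.
have := @derive_ge0_le R (fun s => g s - f s) _ 0 t t0
  (fun s _ => derB (dg s) (fdf s)).
rewrite g0 f0 subr0 => h; rewrite -subr_ge0; apply: h => s /andP[s0 _].
have := dfM s s0; rewrite ler_norml => /andP[_ h]; lra.
Qed.

Lemma rbilap_le (g : int -> R) M n : (forall m, `|g m| <= M) -> `|rbilap g n| <= 16 * M.
Proof.
move=> gM; rewrite /rbilap ler_norml.
have h m := gM m; have := (h (n + 2), h (n - 2), h (n + 1), h (n - 1), h n).
rewrite !ler_norml => -[[[[/andP[h1 h2] /andP[h3 h4]] /andP[h5 h6]] /andP[h7 h8]] /andP[h9 h10]].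
apply/andP; split; lra.
Qed.

Definition exp_term z s k : R[i] := (z * s%:C) ^+ k / k`!%:R.

Lemma cder_pow z k t : is_cderive (fun s => (z * s%:C) ^+ k.+1) t
  (k.+1%:R * z * (z * t%:C) ^+ k).
Proof.
have cid : is_cderive (fun s => s%:C) t 1.
  by split => /=; [exact: is_derive_id|exact: derC].
have c1 : is_cderive (fun s => z * s%:C) t z.
  by have := cderMl z cid; rewrite mulr1.
elim: k => [|k IH]; first by rewrite expr0 mulr1 mul1r.
rewrite (_ : (fun s => _ ^+ k.+2) = fun s => (z * s%:C) * (z * s%:C) ^+ k.+1); last first.
  by apply/funext => s; rewrite exprS.
have -> : k.+2%:R * z * (z * t%:C) ^+ k.+1 = z * (z * t%:C) ^+ k.+1 +
    (z * t%:C) * (k.+1%:R * z * (z * t%:C) ^+ k).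
  by rewrite -[k.+2%:R]natr1 exprS; ring.
exact: cderM.
Qed.

Lemma cder_exp_term z k t :
  is_cderive (fun s => exp_term z s k.+1) t (z * exp_term z t k).
Proof.
rewrite (_ : (fun s => _) = fun s => (k.+1`!%:R)^-1 * (z * s%:C) ^+ k.+1); last first.
  by apply/funext => s; rewrite mulrC.
have := cderMl (k.+1`!%:R)^-1 (cder_pow z k t); congr is_cderive.
rewrite /exp_term factS natrM; field.
by rewrite nat1r !pnatr_eq0 -!lt0n fact_gt0.
Qed.

Variables (w : R -> int -> R[i]) (z : R[i]) (B : R).
Hypothesis zi : z = 'i%C \/ z = - 'i%C.
Hypothesis w_der : forall t m,
  is_cderive (fun s => w s m) t (z * dbilaplacian (w t) m).
Hypothesis w_Re : forall t m, `|complex.Re (w t m)| <= B.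
Hypothesis w_Im : forall t m, `|complex.Im (w t m)| <= B.

Definition exp_sum K t n : R[i] :=
  \sum_(0 <= k < K) exp_term z t k * iter k dbilaplacian (w 0) n.

Lemma dbilaplacianB (phi psi : int -> R[i]) n :
  dbilaplacian (fun m => phi m - psi m) n = dbilaplacian phi n - dbilaplacian psi n.
Proof. by rewrite !dbilaplacianE; ring. Qed.

Lemma dbilaplacian_sum (I : Type) (r : seq I) (c : I -> R[i]) (phi : I -> int -> R[i]) n :
  dbilaplacian (fun m => \sum_(i <- r) c i * phi i m) n =
  \sum_(i <- r) c i * dbilaplacian (phi i) n.
Proof.
rewrite dbilaplacianE -!big_split /= !mulr_sumr -sumrB -big_split /=.
by apply: eq_bigr => i _; rewrite dbilaplacianE; ring.
Qed.

Lemma cder_exp_sum K t n : is_cderive (fun s => exp_sum K.+1 s n) t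
  (z * dbilaplacian (exp_sum K t) n).
Proof.
rewrite /exp_sum dbilaplacian_sum mulr_sumr.
rewrite (_ : (fun s => _) = fun s => exp_term z s 0 * w 0 n +
    \sum_(0 <= k < K) exp_term z s k.+1 * iter k.+1 dbilaplacian (w 0) n); last first.
  by apply/funext => s; rewrite big_nat_recl.
rewrite -[X in is_cderive _ _ X]add0r; apply: cderD.
  rewrite (_ : (fun s => _) = fun=> w 0 n); first exact: cderC.
  by apply/funext => s; rewrite /exp_term expr0 fact0 divr1 mul1r.
apply: cder_sum => k; have := cderMl (iter k.+1 dbilaplacian (w 0) n) (cder_exp_term z k t).
congr is_cderive; first by apply/funext => s; rewrite mulrC.
by rewrite /=; ring.
Qed.

(** The remainder of order K + 1 vanishes at time 0 and its derivative is z Delta^2 of the remainder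
    of order K. Since Delta^2 has norm at most 16 on bounded sequences, repeated integration gives
    the exponential term. Both signs of z occur because negative times are reached by reversing
    time. *)
Lemma taylor_remainder K t n : 0 <= t ->
  `|complex.Re (w t n - exp_sum K t n)| <= B * ((16 * t) ^+ K / K`!%:R) /\
  `|complex.Im (w t n - exp_sum K t n)| <= B * ((16 * t) ^+ K / K`!%:R).
Proof.
have powE k s : B * ((16 * s) ^+ k / k`!%:R) = B * 16 ^+ k * (s ^+ k / k`!%:R).
  by rewrite exprMn; ring.
elim: K t n => [|K IH] t n t0.
  by rewrite /exp_sum big_geq// subr0 expr0 fact0 divr1 mulr1; split.
have d s : is_cderive (fun s => w s n - exp_sum K.+1 s n) s
    (z * dbilaplacian (fun m => w s m - exp_sum K s m) n).
  rewrite dbilaplacianB mulrBr -mulN1r.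
  rewrite (_ : (fun s => _) = fun s => w s n + (-1) * exp_sum K.+1 s n); last first.
    by apply/funext => x; rewrite mulN1r.
  by apply: cderD; [exact: w_der|apply: cderMl; exact: cder_exp_sum].
have E0 : w 0 n - exp_sum K.+1 0 n = 0.
  rewrite /exp_sum big_nat_recl// big1 ?addr0.
    by rewrite /exp_term expr0 fact0 divr1 mul1r subrr.
  by move=> k _; rewrite /exp_term mulr0 expr0n !mul0r.
have bnd s : 0 <= s ->
   `|complex.Re (z * dbilaplacian (fun m => w s m - exp_sum K s m) n)| <=
     B * 16 ^+ K.+1 * (s ^+ K / K`!%:R) /\
   `|complex.Im (z * dbilaplacian (fun m => w s m - exp_sum K s m) n)| <=
     B * 16 ^+ K.+1 * (s ^+ K / K`!%:R).
  move=> s0.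
  have hr := @rbilap_le (fun m => complex.Re (w s m - exp_sum K s m)) _ n
     (fun m => (IH s m s0).1).
  have hi := @rbilap_le (fun m => complex.Im (w s m - exp_sum K s m)) _ n
     (fun m => (IH s m s0).2).
  rewrite -Re_dbilaplacian in hr; rewrite -Im_dbilaplacian in hi.
  have -> : B * 16 ^+ K.+1 * (s ^+ K / K`!%:R) = 16 * (B * ((16 * s) ^+ K / K`!%:R)).
    by rewrite powE exprS; ring.
  move: hr hi; case: (dbilaplacian _ n) => a b /= hr hi.
  case: zi => ->; last by rewrite ReMNi ImMNi /= normrN.
  have -> : complex.Re ('i%C * (a +i* b)) = - b by rewrite /=; ring.
  have -> : complex.Im ('i%C * (a +i* b)) = a by rewrite /=; ring.
  by rewrite normrN.
rewrite !powE; split.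
  apply: (@power_growth (fun s => complex.Re (w s n - exp_sum K.+1 s n)) _ _ K t t0).
  - by rewrite E0.
  - by move=> s; exact: (d s).1.
  - by move=> s s0; exact: (bnd s s0).1.
apply: (@power_growth (fun s => complex.Im (w s n - exp_sum K.+1 s n)) _ _ K t t0).
- by rewrite E0.
- by move=> s; exact: (d s).2.
- by move=> s s0; exact: (bnd s s0).2.
Qed.

End TaylorRemainder.

(** * The exponential series as convolution with the kernel *)

Section Propagator.
Context {R : realType}.
Implicit Types (s : seq int) (psi phi : int -> R[i]) (t B M kap : R) (k K N : nat) (n : int).

Lemma is_cderive_evolve s psi t n :
  is_cderive (fun t => evolve s psi t n) t (- 'i%C * dbilaplacian (evolve s psi t) n).
Proof.
have -> : dbilaplacian (evolve s psi t) n =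
    \sum_(m <- s) psi m * dbilaplacian (kernel t) (m - n).
  rewrite dbilaplacianE /evolve -!big_split /= !mulr_sumr -sumrB -big_split /=.
  apply: eq_bigr => m _; rewrite dbilaplacianE.
  have -> : m - (n + 2) = m - n - 2 by ring.
  have -> : m - (n - 2) = m - n + 2 by ring.
  have -> : m - (n + 1) = m - n - 1 by ring.
  have -> : m - (n - 1) = m - n + 1 by ring.
  by ring.
rewrite mulr_sumr (eq_bigr (fun m => psi m * (- 'i%C * dbilaplacian (kernel t) (m - n)))).
  by apply: cder_sum => m; apply: cderMl; exact: is_cderive_kernel.
by move=> m _; rewrite mulrCA.
Qed.

Lemma is_cderive_evolveN s psi t n :
  is_cderive (fun t => evolve s psi (- t) n) t
    ('i%C * dbilaplacian (evolve s psi (- t)) n).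
Proof.
have E x : evolve s psi (- x) = backward s psi (fun=> 0) id x.
  by apply/funext => m; apply: eq_bigr => j _; rewrite sub0r.
rewrite (_ : (fun t => _) = fun t => backward s psi (fun=> 0) id t n).
  by rewrite E; exact: is_cderive_backward.
by apply/funext => x; rewrite E.
Qed.

Lemma normc_evolve_le s psi t kap n : (forall m, normc (kernel t m) <= kap) ->
  normc (evolve s psi t n) <= kap * \sum_(m <- s) normc (psi m).
Proof.
move=> h; apply: le_trans (normc_sum _ _) _; rewrite mulr_sumr; apply: ler_sum => m _.
by rewrite normcM mulrC ler_wpM2r// normc_ge0.
Qed.

Lemma evolve0 s psi n : uniq s -> (forall m, m \notin s -> psi m = 0) ->
  evolve s psi 0 n = psi n.
Proof.
move=> us psi0; have h m : m != n -> psi m * kernel 0 (m - n) = 0.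
  by move=> mn; rewrite kernel0 subr_eq0 (negbTE mn) mulr0.
rewrite /evolve; case ns : (n \in s); last first.
  rewrite psi0 ?ns// big_seq big1// => m ms; apply: h; apply/eqP => mn.
  by rewrite mn ns in ms.
rewrite (bigD1_seq n)//= subrr kernel0 eqxx mulr1 big1 ?addr0//.
Qed.

Lemma evolve_taylor s psi t n K : let S := \sum_(m <- s) normc (psi m) in
  let E := evolve s psi t n - \sum_(0 <= k < K)
    exp_term (- 'i%C) t k * iter k dbilaplacian (evolve s psi 0) n in
  `|complex.Re E| <= 2 * S * ((16 * `|t|) ^+ K / K`!%:R) /\
  `|complex.Im E| <= 2 * S * ((16 * `|t|) ^+ K / K`!%:R).
Proof.
move=> S E; have bnd x m : normc (evolve s psi x m) <= 2 * S.
  by apply: normc_evolve_le => j; exact: normc_kernel_le2.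
have bRe x m : `|complex.Re (evolve s psi x m)| <= 2 * S.
  by apply: le_trans (bnd x m); exact: Re_le_normc.
have bIm x m : `|complex.Im (evolve s psi x m)| <= 2 * S.
  by apply: le_trans (bnd x m); exact: Im_le_normc.
rewrite /E; have [t0|/ltW t0] := leP 0 t.
  rewrite (ger0_norm t0).
  by apply: (@taylor_remainder R (evolve s psi) (- 'i%C) (2 * S)) => //; [right|exact: is_cderive_evolve].
have t1 : 0 <= - t by rewrite oppr_ge0.
rewrite (ler0_norm t0).
have := @taylor_remainder R (fun x => evolve s psi (- x)) 'i%C (2 * S) (or_introl erefl)
  (is_cderive_evolveN s psi) (fun x => bRe (- x)) (fun x => bIm (- x)) K (- t) n t1.
rewrite opprK /exp_sum oppr0.
have termE k : exp_term 'i%C (- t) k = exp_term (- 'i%C) t k.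
  by rewrite /exp_term rmorphN /= mulrN mulNr.
have -> : \sum_(0 <= k < K) exp_term 'i%C (- t) k * iter k dbilaplacian (evolve s psi 0) n =
    \sum_(0 <= k < K) exp_term (- 'i%C) t k * iter k dbilaplacian (evolve s psi 0) n.
  by apply: eq_bigr => k _; rewrite termE.
exact.
Qed.

(** Finite range of propagation: each application reaches two sites further. *)
Lemma iter_dbilaplacian_local k phi psi n :
  (forall m, (`|m - n| <= k.*2)%N -> phi m = psi m) ->
  iter k dbilaplacian phi n = iter k dbilaplacian psi n.
Proof.
elim: k n => [|k IH] n h; first by apply: h; rewrite subrr.
have h' d : (`|d| <= 2)%N -> iter k dbilaplacian phi (n + d) = iter k dbilaplacian psi (n + d).
  by move=> d2; apply: IH => m hm; apply: h; lia.
rewrite !iterS !dbilaplacianE !h' //; have := h' 0; rewrite !addr0 => -> //.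
Qed.

Lemma normc_iter_dbilaplacian k phi B n : (forall m, normc (phi m) <= B) ->
  normc (iter k dbilaplacian phi n) <= 16 ^+ k * B.
Proof.
move=> hB; elim: k n => [|k IH] n; first by rewrite expr0 mul1r.
rewrite iterS dbilaplacianE exprS.
have nn d (x : R[i]) : normc (d%:R * x) = d%:R * normc x.
  by rewrite normcM -(rmorph_nat (real_complex R)) normc_real ger0_norm.
apply: le_trans (le_normcD _ _) _; rewrite nn.
have h1 := le_normcD (iter k dbilaplacian phi (n + 2) + iter k dbilaplacian phi (n - 2))
   (- (4 * (iter k dbilaplacian phi (n + 1) + iter k dbilaplacian phi (n - 1)))).
rewrite normcN nn in h1.
have h2 := le_normcD (iter k dbilaplacian phi (n + 2)) (iter k dbilaplacian phi (n - 2)).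
have h3 := le_normcD (iter k dbilaplacian phi (n + 1)) (iter k dbilaplacian phi (n - 1)).
have := (IH (n + 2), IH (n - 2), IH (n + 1), IH (n - 1), IH n).
move=> -[[[[i1 i2] i3] i4] i5]; lra.
Qed.

End Propagator.

Section Decay.
Context {R : realType}.
Implicit Types (s : seq int) (psi phi : int -> R[i]) (t B M kap : R) (k K N : nat) (n : int).

Lemma cvg_exp_coeff0 (c x : R) : c * (x ^+ K / K`!%:R) @[K --> \oo] --> 0.
Proof.
rewrite -(mulr0 c); apply: cvgM; first exact: cvg_cst.
exact: (cvg_series_cvg_0 (is_cvg_series_exp_coeff x)).
Qed.

Lemma limn_abs_le (v e : R^nat) (b : R) : cvgn v -> e @ \oo --> 0 ->
  (forall K, `|v K| <= b + e K) -> `|limn v| <= b.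
Proof.
move=> cv e0 h; rewrite -[b]addr0.
have cb : (fun K => b + e K) @ \oo --> b + 0 by apply: cvgD => //; exact: cvg_cst.
rewrite -(cvg_lim _ cb)//.
have cnv : (fun K => `|v K|) @ \oo --> `|limn v| by exact: cvg_norm.
rewrite -(cvg_lim _ cnv)//; apply: ler_lim.
- by apply/cvg_ex; exists `|limn v|.
- by apply/cvg_ex; exists (b + 0).
- exact: nearW.
Qed.

Lemma limn_eq_of_dist (v e : R^nat) (b : R) : e @ \oo --> 0 ->
  (forall K, `|b - v K| <= e K) -> limn v = b.
Proof.
move=> e0 h; apply: cvg_lim => //; apply/cvgrPdist_le => eps eps0.
have /cvgrPdist_le/(_ eps eps0) := e0; apply: filterS => K hK.
apply: le_trans (h K) _; apply: le_trans (ler_norm _) _.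
by move: hK; rewrite sub0r normrN.
Qed.

Definition bi_term t phi n k : R[i] :=
  (- 'i%C * t%:C) ^+ k / (k`!)%:R * iter k dbilaplacian phi n.

Lemma Re_series_bi_term t phi n K :
  series (fun k => complex.Re (bi_term t phi n k)) K =
  complex.Re (\sum_(0 <= k < K) bi_term t phi n k).
Proof. by rewrite Re_sum. Qed.

Lemma Im_series_bi_term t phi n K :
  series (fun k => complex.Im (bi_term t phi n k)) K =
  complex.Im (\sum_(0 <= k < K) bi_term t phi n k).
Proof. by rewrite Im_sum. Qed.

Lemma normc_bi_term t phi n k M : (forall m, normc (phi m) <= M) ->
  normc (bi_term t phi n k) <= M * ((16 * `|t|) ^+ k / k`!%:R).
Proof.
move=> hM; rewrite /bi_term !normcM.
have -> : normc ((- 'i%C * t%:C) ^+ k) = `|t| ^+ k.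
  have ni : normc (- 'i%C * t%:C) = `|t|.
    by rewrite normcM normcN normc_real /= expr0n /= expr1n add0r sqrtr1 mul1r.
  elim: k => [|k IH]; first by rewrite !expr0 normc1.
  by rewrite !exprS normcM ni IH.
have -> : normc ((k`!%:R : R[i])^-1) = (k`!%:R)^-1.
  rewrite -(rmorph_nat (real_complex R)) -fmorphV normc_real ger0_norm//.
have -> : M * ((16 * `|t|) ^+ k / k`!%:R) = `|t| ^+ k / k`!%:R * (16 ^+ k * M).
  by rewrite exprMn; ring.
apply: ler_wpM2l; first by rewrite divr_ge0// exprn_ge0.
exact: normc_iter_dbilaplacian.
Qed.

Lemma is_cvg_series_bi_term (f : R[i] -> R) t phi n M :
  (forall z, `|f z| <= normc z) -> (forall m, normc (phi m) <= M) ->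
  cvgn (series (fun k => f (bi_term t phi n k))).
Proof.
move=> fn hM; apply: normed_cvg.
apply: (@series_le_cvg _ _ (fun k => M * ((16 * `|t|) ^+ k / k`!%:R))).
- by move=> k; exact: normr_ge0.
- move=> k; rewrite mulr_ge0 ?divr_ge0 ?exprn_ge0 ?mulr_ge0//.
  by apply: le_trans (hM 0); exact: normc_ge0.
- by move=> k; apply: le_trans (fn _) _; exact: normc_bi_term.
have -> : series (fun k => M * ((16 * `|t|) ^+ k / k`!%:R)) =
    (fun K => M * series (exp_coeff (16 * `|t|)) K).
  by apply/funext => K; rewrite /series /= mulr_sumr.
by apply: is_cvgMr; exact: is_cvg_series_exp_coeff.
Qed.

(** The first K terms at n only see the data in |m| <= |n| + 2 K. Truncating there leaves the
    partial sum unchanged, and by [evolve_taylor] it is close to the kernel convolution of the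
    truncated data, bounded by kap * M uniformly in K. The factor 2 comes from adding real and
    imaginary parts. *)
Lemma normc_bi_propagator_le t phi n M kap :
  (forall s, uniq s -> \sum_(m <- s) normc (phi m) <= M) ->
  (forall m, normc (kernel t m) <= kap) ->
  normc (bi_propagator t phi n) <= 2 * (kap * M).
Proof.
move=> hM hk.
have phiM m : normc (phi m) <= M.
  by have := hM [:: m] isT; rewrite big_seq1.
have M0 : 0 <= M by apply: le_trans (phiM 0); exact: normc_ge0.
have kap0 : 0 <= kap by apply: le_trans (hk 0); exact: normc_ge0.
pose e K := 2 * M * ((16 * `|t|) ^+ K / K`!%:R).
have e0 : e @ \oo --> 0 by exact: cvg_exp_coeff0.
have main K : exists W : R[i], normc W <= kap * M /\
    (`|complex.Re (W - \sum_(0 <= k < K) bi_term t phi n k)| <= e K /\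
     `|complex.Im (W - \sum_(0 <= k < K) bi_term t phi n k)| <= e K).
  pose N := (`|n| + K.*2)%N; exists (evolve (zs N) phi t n); split.
    apply: le_trans (normc_evolve_le _ _ _ hk) _; rewrite ler_wpM2l// hM//.
    exact: uniq_zs.
  have := evolve_taylor (zs N) phi t n K.
  have -> : \sum_(0 <= k < K) exp_term (- 'i%C) t k *
        iter k dbilaplacian (evolve (zs N) phi 0) n =
      \sum_(0 <= k < K) bi_term t phi n k.
    apply: eq_big_nat => k /andP[_ kK]; rewrite /bi_term /exp_term.
    congr (_ * _); apply: iter_dbilaplacian_local => m mn.
    have mN : m \in zs N.
      by rewrite mem_zs /N; move: mn kK; rewrite -!muln2; lia.
    rewrite /evolve (bigD1_seq m) ?uniq_zs//= subrr kernel0 eqxx mulr1 big1 ?addr0//.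
    by move=> j jm; rewrite kernel0 subr_eq0 (negbTE jm) mulr0.
  have le K' : 2 * (\sum_(m <- zs N) normc (phi m)) * ((16 * `|t|) ^+ K' / K'`!%:R) <= e K'.
    rewrite /e; apply: ler_wpM2r; first by rewrite divr_ge0// exprn_ge0// mulr_ge0.
    by rewrite ler_wpM2l// hM// uniq_zs.
  by move=> /= [h1 h2]; split; [exact: le_trans h1 (le K)|exact: le_trans h2 (le K)].
have bnd (f : R[i] -> R) K W : (forall z w, f (z - w) = f z - f w) ->
    (forall z, `|f z| <= normc z) -> normc W <= kap * M ->
    `|f (W - \sum_(0 <= k < K) bi_term t phi n k)| <= e K ->
    `|f (\sum_(0 <= k < K) bi_term t phi n k)| <= kap * M + e K.
  move=> fB fn WM h.
  have -> : f (\sum_(0 <= k < K) bi_term t phi n k) =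
    f W - f (W - \sum_(0 <= k < K) bi_term t phi n k) by rewrite fB; ring.
  apply: le_trans (ler_normB _ _) _; apply: lerD => //.
  exact: le_trans (fn W) WM.
apply: le_trans (normc_le_ReIm _) _; rewrite mulr_natl mulr2n; apply: lerD => /=.
  apply: (limn_abs_le _ e0); first by apply: is_cvg_series_bi_term phiM; exact: Re_le_normc.
  move=> K; have [W [WM [h _]]] := main K; rewrite Re_series_bi_term.
  apply: bnd WM h; last exact: Re_le_normc.
  by move=> z w; rewrite Re_add Re_opp.
apply: (limn_abs_le _ e0); first by apply: is_cvg_series_bi_term phiM; exact: Im_le_normc.
move=> K; have [W [WM [_ h]]] := main K; rewrite Im_series_bi_term.
apply: bnd WM h; last exact: Im_le_normc.
by move=> z w; rewrite Im_add Im_opp.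
Qed.

Lemma bi_propagator_evolve s psi t n : uniq s ->
  (forall m, m \notin s -> psi m = 0) -> bi_propagator t psi n = evolve s psi t n.
Proof.
move=> us psi0; pose S := \sum_(m <- s) normc (psi m).
have E0 : evolve s psi 0 = psi by apply/funext => m; exact: evolve0.
have e0 := cvg_exp_coeff0 (2 * S) (16 * `|t|).
have h K := evolve_taylor s psi t n K; rewrite E0 /= in h.
have hr : limn (series (fun k => complex.Re (bi_term t psi n k))) =
    complex.Re (evolve s psi t n).
  apply: (limn_eq_of_dist e0) => K; rewrite Re_series_bi_term.
  by have := (h K).1; rewrite Re_add Re_opp.
have hi : limn (series (fun k => complex.Im (bi_term t psi n k))) =
    complex.Im (evolve s psi t n).
  apply: (limn_eq_of_dist e0) => K; rewrite Im_series_bi_term.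
  by have := (h K).2; rewrite Im_add Im_opp.
have -> : bi_propagator t psi n =
    limn (series (fun k => complex.Re (bi_term t psi n k))) +i*
    limn (series (fun k => complex.Im (bi_term t psi n k))) by [].
by rewrite hr hi; case: (evolve s psi t n).
Qed.

Lemma root4_powR (x : R) : 0 <= x -> root4 x = x `^ 4^-1.
Proof.
move=> x0; rewrite /root4 -powR12_sqrt ?sqrtr_ge0// -powR12_sqrt// -powRrM.
by congr (_ `^ _); field.
Qed.

Lemma normc_kernel_powR t m : t != 0 -> normc (kernel t m) <= 32 * `|t| `^ (- 4^-1).
Proof.
move=> t0; have nt : 0 < `|t| by rewrite normr_gt0.
rewrite powRN -root4_powR// -/(32 / root4 `|t|).
have r0 : 0 < root4 `|t| by exact: root4_gt0.
have rE := root4K (ltW nt).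
have [t1|t1] := leP 1 (root4 `|t|); first exact: normc_kernel_decay.
apply: le_trans (normc_kernel_le2 _ _) _; rewrite ler_pdivlMr//.
by lra.
Qed.

Lemma decay_quarter : decay_rates R 4^-1.
Proof.
exists 64 => t t0 phi fphi.
have fE : lnorm 1%:E phi = (fine (lnorm 1%:E phi))%:E.
  by rewrite fineK// ge0_fin_numE// lnorm_ge0.
rewrite fE -EFinM; apply: lnorm_oo_le => n.
have -> : 64 * `|t| `^ (- 4^-1) * fine (lnorm 1%:E phi) =
  2 * (32 * `|t| `^ (- 4^-1) * fine (lnorm 1%:E phi)) by ring.
apply: normc_bi_propagator_le.
  by move=> s us; apply: sum_normc_le_lnorm1 => //; rewrite -fE.
by move=> m; exact: normc_kernel_powR.
Qed.

End Decay.

(** * Sharpness of the decay rate *)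

Section Concentration.
Context {R : realType}.
Implicit Types (psi : int -> R) (s : seq int) (t : R) (m n : int).

(** The form is the average of g times the squared modulus of the trigonometric polynomial with
    coefficients [psi]. *)
Lemma avg_posdef s psi (g : R -> R) : continuous g -> (forall x, 0 <= g x) ->
  0 <= \sum_(m <- s) \sum_(n <- s) psi m * psi n *
    avg (fun x => cos ((m - n)%:~R * x) * g x).
Proof.
move=> cg g0.
have cc (d : int) : continuous (fun x : R => cos (d%:~R * x) * g x : R).
  move=> x; apply: cvgM; last exact: cg.
  by move: x; apply: is_derive_continuous => x; apply: dercos; exact: derMl.
have cZ (k : R) (d : int) : continuous (fun x : R => k * (cos (d%:~R * x) * g x) : R).
  by move=> x; apply: cvgM; [exact: cvg_cst|exact: cc].
rewrite (_ : \sum_(m <- s) _ = avg (fun x => \sum_(m <- s) \sum_(n <- s)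
    psi m * psi n * (cos ((m - n)%:~R * x) * g x))).
  apply: avg_ge0 => x.
  pose c m := psi m * cos (m%:~R * x); pose d m := psi m * sin (m%:~R * x).
  rewrite (_ : \sum_(m <- s) _ =
      ((\sum_(m <- s) c m) ^+ 2 + (\sum_(m <- s) d m) ^+ 2) * g x).
    by rewrite mulr_ge0// addr_ge0// sqr_ge0.
  rewrite !expr2 !big_distrlr /= -big_split mulr_suml; apply: eq_bigr => m _.
  rewrite -big_split mulr_suml; apply: eq_bigr => n _.
  by rewrite intrB mulrBl cosB /c /d /=; ring.
rewrite avg_sum; last by move=> m; exact: continuous_sum.
apply: eq_bigr => m _; rewrite avg_sum//; apply: eq_bigr => n _.
by rewrite avgZ.
Qed.

Lemma cos_ge_sub (x : R) : 0 <= x -> 1 - x <= cos x.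
Proof.
move=> x0; have := @derive_ge0_le R (fun y => cos y + y) (fun y => - sin y * 1 + 1) 0 x x0.
rewrite cos0 addr0 => h; rewrite lerBlDr; apply: h => y _.
  exact: derD (dercos (is_derive_id _ _)) (is_derive_id _ _).
by have := sin_max y; rewrite ler_norml mulr1; lra.
Qed.

Definition delta0 m : R := (m == 0)%:R.

Lemma kern00 m : kern 0 0 m = delta0 m :> R.
Proof.
have := congr1 (@complex.Re R) (kernel0 m); rewrite /kernel /= => ->.
by rewrite Re_nat.
Qed.

Lemma symb_ge0 (x : R) : 0 <= symb x.
Proof. by rewrite /symb mulr_ge0// sqr_ge0. Qed.

Lemma continuous_symb : continuous (symb : R -> R).
Proof.
rewrite /symb => x; apply: cvgM; first exact: cvg_cst.
rewrite expr2; apply: cvgM; (apply: cvgB; [exact: cvg_cst|exact: continuous_cos]).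
Qed.

(** The left side is the real part of the kernel of exp(-i t Delta^2) - 1 + t Delta^2. For t >= 0
    the multiplier on the right is nonnegative because cos y >= 1 - y for y >= 0; this is the
    positivity behind [form_lower_bound]. *)
Lemma kern_second_order t m : kern 0 t m - delta0 m + t * rbilap delta0 m =
  avg (fun x => cos (m%:~R * x) * (cos (t * symb x) - 1 + t * symb x)).
Proof.
have c1 := @continuous_kern R 0 t m.
have c0 m' := @continuous_kern R 0 0 m'.
have rE : rbilap delta0 m = avg (fun x => symb x * (cos (m%:~R * x) * cos (0 * symb x + 0))).
  rewrite (_ : delta0 = kern 0 0); last by apply/funext => k; rewrite kern00.
  rewrite /kern -(avg_rbilap m c0); apply: eq_avg => x.
  transitivity (rbilap (fun k => cos (k%:~R * x)) m * cos (0 * symb x + 0)).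
    by rewrite /rbilap; ring.
  by rewrite rbilap_cos; ring.
have c2 : continuous (fun x => symb x * (cos (m%:~R * x) * cos (0 * symb x + 0)) : R).
  by move=> x; apply: cvgM; [exact: continuous_symb|exact: c0].
rewrite rE -kern00 /kern -avgZ// -avgN// -avgD//; last first.
  by move=> x; apply: cvgN; exact: c0.
rewrite -avgD; last 2 first.
- by move=> x; apply: cvgD; [exact: c1|apply: cvgN; exact: c0].
- by move=> x; apply: cvgM; [exact: cvg_cst|exact: c2].
by apply: eq_avg => x; rewrite mul0r !addr0 cos0; ring.
Qed.

Lemma sum_delta0 s psi k : uniq s -> (forall m, m \notin s -> psi m = 0) ->
  \sum_(n <- s) psi n * delta0 (k - n) = psi k.
Proof.
move=> us psi0; rewrite /delta0; case ks : (k \in s); last first.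
  rewrite psi0 ?ks// big_seq big1// => n ns; rewrite subr_eq0 eq_sym.
  by case: eqVneq => [nk|]; rewrite ?mulr0//; rewrite -nk ns in ks.
rewrite (bigD1_seq k)//= subrr eqxx mulr1 big1 ?addr0// => n nk.
by rewrite subr_eq0 eq_sym (negbTE nk) mulr0.
Qed.

Lemma form_lower_bound s psi t : 0 <= t -> uniq s ->
  (forall m, m \notin s -> psi m = 0) ->
  \sum_(m <- s) psi m ^+ 2 - t * \sum_(m <- s) psi m * rbilap psi m <=
  \sum_(m <- s) \sum_(n <- s) psi m * psi n * kern 0 t (m - n).
Proof.
move=> t0 us psi0.
pose g (x : R) := cos (t * symb x) - 1 + t * symb x.
have g0 x : 0 <= g x.
  have := @cos_ge_sub (t * symb x) (mulr_ge0 t0 (symb_ge0 x)); rewrite /g; lra.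
have ct : continuous (fun x : R => t * symb x : R).
  by move=> x; apply: cvgM; [exact: cvg_cst|exact: continuous_symb].
have cg : continuous g.
  move=> x; apply: cvgD; last exact: ct.
  apply: cvgB; last exact: cvg_cst.
  by apply: (@continuous_comp _ _ _ (fun x : R => t * symb x) cos); [exact: ct|exact: continuous_cos].
rewrite -subr_ge0; apply: le_trans (avg_posdef s psi cg g0) _.
rewrite le_eqVlt; apply/orP; left; apply/eqP; apply/esym.
have -> : \sum_(m <- s) psi m ^+ 2 = \sum_(m <- s) \sum_(n <- s) psi m * psi n * delta0 (m - n).
  apply: eq_bigr => m _; rewrite expr2 -{2}(sum_delta0 m us psi0) mulr_sumr.
  by apply: eq_bigr => n _; rewrite mulrA.
have -> : \sum_(m <- s) psi m * rbilap psi m =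
    \sum_(m <- s) \sum_(n <- s) psi m * psi n * rbilap delta0 (m - n).
  apply: eq_bigr => m _; rewrite /rbilap -!(sum_delta0 _ us psi0).
  rewrite -!big_split /= !mulr_sumr -sumrB -big_split /= mulr_sumr.
  apply: eq_bigr => n _.
  have -> : m - n + 2 = m + 2 - n by ring.
  have -> : m - n - 2 = m - 2 - n by ring.
  have -> : m - n + 1 = m + 1 - n by ring.
  have -> : m - n - 1 = m - 1 - n by ring.
  by ring.
rewrite opprB mulr_sumr -sumrB -big_split /=; apply: eq_bigr => m _.
rewrite mulr_sumr -sumrB -big_split /=; apply: eq_bigr => n _.
by rewrite -kern_second_order; ring.
Qed.

End Concentration.

Section Sharpness.
Context {R : realType}.
Implicit Types (m n : int) (N L : nat) (t : R).

(** Being a square, it dominates its own truncation; its zeros at the ends of the support make the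
    end points harmless; being a monic quartic, it has fourth difference 4! = 24. *)
Definition bump_poly N m : R := (N%:R ^+ 2 - m%:~R ^+ 2) ^+ 2.

Definition bump N m : R := if (`|m| <= N)%N then bump_poly N m else 0.

Lemma bump_ge0 N m : 0 <= bump N m.
Proof. by rewrite /bump; case: ifP => // _; exact: sqr_ge0. Qed.

Lemma bump_le N m : bump N m <= bump_poly N m.
Proof. by rewrite /bump; case: ifP => // _; exact: sqr_ge0. Qed.

Lemma bump_out N m : m \notin zs N -> bump N m = 0.
Proof. by rewrite mem_zs /bump => /negbTE ->. Qed.

Lemma absz_sqr m : (`|m|%N%:R : R) ^+ 2 = m%:~R ^+ 2.
Proof. by rewrite natr_absz intr_norm real_normK ?num_real. Qed.

(* The fourth difference of the polynomial is 24, and replacing the polynomial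
   by 0 outside the support only decreases the fourth difference inside. *)
Lemma bump_rbilap_le N m : bump N m * rbilap (bump N) m <= 24 * bump N m.
Proof.
have [mN|Nm] := ltnP `|m|%N N; last first.
  suff -> : bump N m = 0 by rewrite mul0r mulr0.
  rewrite /bump; case: ifP => // mN.
  have e : `|m|%N = N by apply/eqP; rewrite eqn_leq mN.
  have -> : bump_poly N m = 0; last by [].
  by rewrite /bump_poly -e absz_sqr subrr expr0n.
rewrite [leRHS]mulrC; apply: ler_wpM2l; first exact: bump_ge0.
rewrite /rbilap.
have i0 : bump N m = bump_poly N m by rewrite /bump ltnW.
have i1 : bump N (m + 1) = bump_poly N (m + 1).
  by rewrite /bump (_ : (absz (m + 1)%R <= N)%N)//; lia.
have i2 : bump N (m - 1) = bump_poly N (m - 1).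
  by rewrite /bump (_ : (absz (m - 1)%R <= N)%N)//; lia.
have i3 := bump_le N (m + 2); have i4 := bump_le N (m - 2).
have e : bump_poly N (m + 2) + bump_poly N (m - 2)
    - 4 * (bump_poly N (m + 1) + bump_poly N (m - 1)) + 6 * bump_poly N m = 24.
  by rewrite /bump_poly !intrD !rmorphN /=; ring.
rewrite i0 i1 i2; move: i3 i4 e; lra.
Qed.

(** Only the middle half |m| <= 2 L is counted: there N ^ 2 - m ^ 2 >= 12 L ^ 2 for N = 4 L, at 4 L
    + 1 points. *)
Lemma sum_bump_ge L : 144 * L%:R ^+ 4 * (4 * L%:R + 1) <= \sum_(m <- zs (4 * L)) bump (4 * L) m.
Proof.
rewrite (bigID (fun m => (`|m| <= 2 * L)%N)) /= -[leLHS]addr0; apply: lerD; last first.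
  by apply: sumr_ge0 => m _; exact: bump_ge0.
rewrite -big_filter.
apply: (@le_trans _ _ (\sum_(m <- [seq m <- zs (4 * L) | (`|m| <= 2 * L)%N]) 144 * L%:R ^+ 4)).
  rewrite big_const_seq iter_addr_0 count_predT -[leRHS]mulr_natr.
  apply: ler_wpM2l; first by rewrite mulr_ge0// exprn_ge0.
  have -> : size [seq m <- zs (4 * L) | (`|m| <= 2 * L)%N] = size (zs (2 * L)).
    apply: perm_size; apply: uniq_perm; [exact/filter_uniq/uniq_zs|exact: uniq_zs|].
    move=> m; rewrite mem_filter !mem_zs; lia.
  by rewrite /zs size_map size_iota -natrM -[1]/(1%:R) -natrD ler_nat; lia.
rewrite big_seq [leRHS]big_seq; apply: ler_sum => m; rewrite mem_filter mem_zs => /andP[m2 m4].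
rewrite /bump m4 /bump_poly natrM.
have h : (m%:~R : R) ^+ 2 <= (2 * L%:R) ^+ 2.
  by rewrite -absz_sqr lerXn2r ?nnegrE ?mulr_ge0// -natrM ler_nat.
have hL : 0 <= (L%:R : R) ^+ 2 by exact: sqr_ge0.
have -> : 144 * (L%:R : R) ^+ 4 = (12 * L%:R ^+ 2) ^+ 2 by ring.
rewrite ler_pXn2r// ?nnegrE; [|by rewrite mulr_ge0|]; by move: h; rewrite !exprMn; lra.
Qed.

Lemma evolve_form s (psi : int -> R) t :
  \sum_(m <- s) \sum_(n <- s) psi m * psi n * kern 0 t (m - n) <=
  \sum_(n <- s) `|psi n| * normc (evolve s (fun m => (psi m)%:C) t n).
Proof.
rewrite exchange_big /=; apply: ler_sum => n _.
have -> : \sum_(m <- s) psi m * psi n * kern 0 t (m - n) =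
    psi n * complex.Re (evolve s (fun m => (psi m)%:C) t n).
  rewrite /evolve Re_sum mulr_sumr; apply: eq_bigr => m _.
  by rewrite Re_mul /= mul0r subr0; ring.
by apply: le_trans (ler_norm _) _; rewrite normrM ler_wpM2l// Re_le_normc.
Qed.

(** At the time t chosen below the quadratic form is still at least Q / 2, while the decay estimate
    bounds it by C t ^ (- alpha) S ^ 2 <= C t ^ (- alpha) (8 L + 1) Q. With t >= L ^ 4 this bounds L
    ^ (1 - 4 alpha) from below, which fails for large L if alpha > 1/4. *)
Lemma decay_rate_le (alpha : R) : decay_rates R alpha -> alpha <= 4^-1.
Proof.
move=> [C0 HC]; rewrite leNgt; apply/negP => alpha4.
pose C := Num.max C0 0; have C_ge0 : 0 <= C by rewrite le_max lexx orbT.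
have alpha0 : 0 < alpha by apply: lt_trans alpha4; rewrite invr_gt0.
have main L : (0 < L)%N -> 1 <= 18 * C * (L%:R * L%:R `^ (4 * - alpha)).
  move=> L0; have LR : 1 <= L%:R :> R by rewrite ler1n.
  pose N := (4 * L)%N; pose psi := bump N; pose s := zs N.
  pose S := \sum_(m <- s) psi m; pose Q := \sum_(m <- s) psi m ^+ 2.
  have S_ge := sum_bump_ge L; rewrite -/N -/S in S_ge.
  have S0 : 0 < S.
    by apply: lt_le_trans S_ge; rewrite !mulr_gt0 ?exprn_gt0 ?ltr0n.
  have SQ : S ^+ 2 <= (8 * L%:R + 1) * Q.
    have := cauchy_schwarz_sqr s (fun=> 1) psi.
    under eq_bigr do rewrite mul1r; rewrite -/S -/Q => h; apply: le_trans h _.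
    apply: ler_wpM2r; first by apply: sumr_ge0 => m _; exact: sqr_ge0.
    under eq_bigr do rewrite expr1n.
    rewrite big_const_seq iter_addr_0 count_predT /s /zs size_map size_iota.
    by rewrite -natrM -[1]/(1%:R) -natrD ler_nat /N; lia.
  have L8 : 0 < 8 * L%:R + 1 :> R by lra.
  have Q0 : 0 < Q.
    rewrite -(pmulr_rgt0 _ L8); apply: lt_le_trans SQ; exact: exprn_gt0.
  (* Chosen so that the loss t * 24 * S is exactly Q / 2. *)
  pose t := Q / (48 * S).
  have t0 : 0 < t by rewrite divr_gt0// mulr_gt0.
  (* Cauchy-Schwarz in the form S ^ 2 <= (8 L + 1) Q is combined with S >= 144 L ^ 4 (4 L + 1) >= 48
     L ^ 4 (8 L + 1). *)
  have tL : L%:R ^+ 4 <= t.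
    rewrite /t ler_pdivlMr ?mulr_gt0//.
    have h1 : (8 * L%:R + 1) * (L%:R ^+ 4 * (48 * S)) <= S ^+ 2.
      rewrite expr2 mulrA mulrA; apply: ler_wpM2r; first exact: ltW.
      apply: le_trans S_ge.
      have -> : (8 * L%:R + 1) * L%:R ^+ 4 * 48 = L%:R ^+ 4 * (48 * (8 * L%:R + 1)) :> R by ring.
      have -> : 144 * L%:R ^+ 4 * (4 * L%:R + 1) = L%:R ^+ 4 * (144 * (4 * L%:R + 1)) :> R by ring.
      by apply: ler_wpM2l; [rewrite exprn_ge0|lra].
    by rewrite -(ler_pM2l L8); exact: le_trans h1 SQ.
  have psi0 m : m \notin s -> psi m = 0 by exact: bump_out.
  pose phi m : R[i] := (psi m)%:C.
  have nphi m : normc (phi m) = psi m by rewrite normc_real ger0_norm// bump_ge0.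
  have phi_out m : m \notin s -> phi m = 0 by move=> /psi0 h; rewrite /phi h.
  have l1 : (lnorm 1%:E phi <= S%:E)%E.
    apply: lnorm_le => //; first exact: ltW.
    move=> n; rewrite powRr1 ?(ltW S0)//.
    under eq_bigr do rewrite powRr1 ?normc_ge0// nphi.
    rewrite (bigID (mem s)) /= [X in _ + X]big1 ?addr0 => [|m /psi0//].
    rewrite /S [leRHS](bigID (mem (zs n))) /= -[leLHS]addr0; apply: lerD; last first.
      by apply: sumr_ge0 => m _; exact: bump_ge0.
    rewrite -big_filter -[leRHS]big_filter le_eqVlt; apply/orP; left; apply/eqP.
    apply: perm_big; apply: uniq_perm; [exact/filter_uniq/uniq_zs|exact/filter_uniq/uniq_zs|].
    by move=> m; rewrite !mem_filter andbC.
  have ev n : normc (evolve s phi t n) <= C * t `^ (- alpha) * S.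
    rewrite -(bi_propagator_evolve t n (uniq_zs N) phi_out) -lee_fin.
    apply: le_trans (normc_le_lnorm_oo _ n) _.
    have fphi : (lnorm 1%:E phi < +oo)%E by apply: le_lt_trans l1 _; rewrite ltry.
    have tN : t != 0 by rewrite gt_eqF.
    apply: le_trans (HC t tN phi fphi) _; rewrite (gtr0_norm t0) [leRHS]EFinM.
    apply: (@le_trans _ _ ((C * t `^ (- alpha))%:E * lnorm 1%:E phi)%E).
      apply: lee_wpmul2r; first exact: lnorm_ge0.
      by rewrite lee_fin ler_wpM2r ?powR_ge0// le_max lexx.
    by apply: lee_wpmul2l => //; rewrite lee_fin mulr_ge0// powR_ge0.
  have up : \sum_(m <- s) \sum_(n <- s) psi m * psi n * kern 0 t (m - n) <=
      C * t `^ (- alpha) * S ^+ 2.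
    apply: le_trans (evolve_form _ _ _) _; rewrite expr2 mulrA [leRHS]mulrC mulr_suml.
    by apply: ler_sum => n _; rewrite ger0_norm ?bump_ge0// ler_wpM2l ?bump_ge0.
  have low := form_lower_bound (ltW t0) (uniq_zs N) psi0.
  have bil : \sum_(m <- s) psi m * rbilap psi m <= 24 * S.
    by rewrite mulr_sumr; apply: ler_sum => m _; exact: bump_rbilap_le.
  have half : t * \sum_(m <- s) psi m * rbilap psi m <= Q / 2.
    apply: le_trans (ler_wpM2l (ltW t0) bil) _; rewrite le_eqVlt; apply/orP; left; apply/eqP.
    by rewrite /t; field; rewrite gt_eqF.
  have ta : t `^ (- alpha) <= L%:R `^ (4 * - alpha).
    rewrite powRrM powR_mulrn// !powRN lef_pV2 ?posrE ?powR_gt0 ?exprn_gt0 ?ltr0n//.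
    by apply: (ge0_ler_powR (ltW alpha0)) tL; rewrite nnegrE ?exprn_ge0// (ltW t0).
  have p0 : 0 <= t `^ (- alpha) by exact: powR_ge0.
  have fin : Q / 2 <= C * t `^ (- alpha) * ((8 * L%:R + 1) * Q).
    apply: (@le_trans _ _ (C * t `^ (- alpha) * S ^+ 2)).
      by apply: le_trans up; apply: le_trans low; rewrite -/Q; lra.
    by apply: ler_wpM2l SQ; exact: mulr_ge0.
  have fin2 : 1 <= 2 * (C * t `^ (- alpha) * (8 * L%:R + 1)).
    rewrite -(ler_pM2r Q0) mul1r; move: fin; lra.
  apply: le_trans fin2 _.
  have -> : 18 * C * (L%:R * L%:R `^ (4 * - alpha)) =
      2 * (C * L%:R `^ (4 * - alpha) * (9 * L%:R)) by ring.
  apply: ler_wpM2l => //; apply: ler_pM; [exact: mulr_ge0|exact: ltW| |lra].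
  exact: ler_wpM2l.
pose d := 4 * alpha - 1; have d0 : 0 < d by rewrite /d; lra.
have C18 : 0 <= 18 * C by rewrite mulr_ge0.
(* Any L above X has L ^ d > 18 C, which contradicts [main]. *)
pose X := (18 * C + 1) `^ d^-1; have X0 : 0 <= X by exact: powR_ge0.
pose L := (Num.truncn X).+1; have XL : X < L%:R by exact: truncnS_gt.
have := main L isT.
have L0 : 0 < L%:R :> R by rewrite ltr0n.
have -> : L%:R * L%:R `^ (4 * - alpha) = (L%:R `^ d)^-1 :> R.
  rewrite -powRN -{1}(powRr1 (ltW L0)) -powRD_pos//; congr (_ `^ _).
  by rewrite /d; ring.
rewrite -/(_ / _) ler_pdivlMr ?powR_gt0// mul1r leNgt => /negP; apply.
apply: (@lt_le_trans _ _ (18 * C + 1)); first by rewrite ltrDl.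
have -> : 18 * C + 1 = X `^ d.
  by rewrite /X -powRrM mulVf ?gt_eqF// powRr1// addr_ge0.
by apply: (ge0_ler_powR (ltW d0)) (ltW XL); rewrite nnegrE// ltW.
Qed.

Lemma sup_decay_rates : has_sup (decay_rates R) /\ sup (decay_rates R) = 4^-1.
Proof.
have q := @decay_quarter R.
have ub : ubound (decay_rates R) 4^-1 by move=> a; exact: decay_rate_le.
split; first by split; exists 4^-1.
apply/eqP; rewrite eq_le; apply/andP; split.
  by apply: ge_sup => //; exists 4^-1.
by apply: ub_le_sup => //; exists 4^-1.
Qed.

End Sharpness.

Theorem theorem3p6 (R : realType) :
  (forall q r q' r' : \bar R,
     strichartz_pairs R (q, r) -> strichartz_pairs R (q', r') ->
     exists C : R, forall F u : R -> int -> R[i],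
       measurable_forcing F ->
       bi_schrodinger_solution F u ->
       (mixed_norm q r u <=
        C%:E * (lnorm 2%:E (u 0%R) +
                mixed_norm (hoelder_conjugate q') (hoelder_conjugate r') F))%E)
  /\
  (decay_rates R 4^-1 /\ has_sup (decay_rates R) /\ sup (decay_rates R) = 4^-1).
Proof.
split; last by split; [exact: decay_quarter|exact: sup_decay_rates].
by move=> q r q' r'; exact: strichartz_estimate.
Qed.
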